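(* For any prime $g \geq 5$, any real number $k\ge 1$ and any $\varepsilon>0$, \[ \sum_{0<d<X} h_g(-d)^k \ll \begin{cases} X^{1+ k\left( \frac{g-2}{2g+2} \right) + \varepsilon} & \text{if } 1 \leq k \leq \frac{g^2-1}{2g-1},\\ X^{1 +k\left( \frac{g-1}{2g} \right) - \left( \frac{g-1}{2g} \right) + \varepsilon} & \text{if } \frac{g^2-1}{2g-1} \leq k \leq g+1,\\ X^{\frac{k}{2}+\varepsilon}& \text{if } k\ge g+1, \end{cases}\] for all $X\ge 2$, where the sum runs over square-free integers $d$ with $0<d<X$.
   Context: For a square-free positive integer $d$ and an odd prime $g$, $h_g(-d)$ denotes the number of ideal classes in the class group of $\mathbb{Q}(\sqrt{-d})$ whose $g$-th power is the principal class. Implied constants may depend on $\varepsilon$, $g$ and $k$. *)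

(* Defs.v *)
From HB Require Import structures.
From mathcomp Require Import all_boot all_order all_algebra all_field finmap.
From mathcomp Require Import all_classical all_reals all_analysis.

Set Implicit Arguments.
Unset Strict Implicit.
Unset Printing Implicit Defensive.

Import Order.TTheory GRing.Theory Num.Theory.

Local Open Scope classical_set_scope.
Local Open Scope ring_scope.

Definition squarefree (n : nat) : Prop :=
  forall m : nat, (m ^ 2 %| n)%N -> m = 1%N.

(* The field Q(sqrt(-d)), as a subset of the algebraic complex numbers. *)
Definition imag_quad_field (d : nat) : set algC :=
  [set x | exists a b : rat, x = ratr a + ratr b * sqrtC (- d%:R)].

Definition ring_of_integers (d : nat) : set algC :=
  [set x | imag_quad_field d x /\ x \in Aint].

(* Nonzero fractional ideals of the ring of integers of Q(sqrt(-d)). *)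
Definition fractional_ideal (d : nat) (I : set algC) : Prop :=
  [/\ I `<=` imag_quad_field d,
      exists2 x, I x & x != 0,
      forall x y, I x -> I y -> I (x + y),
      forall c x, ring_of_integers d c -> I x -> I (c * x)
    & exists2 c, ring_of_integers d c /\ c != 0 &
        forall x, I x -> ring_of_integers d (c * x)].

Definition ideal_mul (I J : set algC) : set algC :=
  [set x | exists2 s : seq (algC * algC),
     (forall p, p \in s -> I p.1 /\ J p.2) & x = \sum_(p <- s) p.1 * p.2].

Definition ideal_scale (a : algC) (I : set algC) : set algC :=
  [set a * x | x in I].

(* The class of I is its coset modulo the nonzero principal fractional
   ideals. *)
Definition ideal_class (d : nat) (I : set algC) : set (set algC) :=
  [set ideal_scale a I | a in [set a | imag_quad_field d a /\ a != 0]].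

Definition class_group (d : nat) : set (set (set algC)) :=
  [set ideal_class d I | I in [set I | fractional_ideal d I]].

Definition principal_class (d : nat) : set (set algC) :=
  ideal_class d (ring_of_integers d).

(* Product of cosets, taken elementwise. *)
Definition class_mul (C D : set (set algC)) : set (set algC) :=
  [set ideal_mul I J | I in C & J in D].

Definition class_pow (d : nat) (C : set (set algC)) (n : nat) :
    set (set algC) :=
  iter n (class_mul C) (principal_class d).

(* class_torsion g d is h_g(-d).  The set counted is finite, since the class
   group is. *)
Definition class_torsion (g d : nat) : nat :=
  #|` fset_set [set C | class_group d C /\
                        class_pow d C g = principal_class d] |.

Definition torsion_moment (R : realType) (g : nat) (k X : R) : R :=
  \sum_(d \in [set d : nat | [/\ (0 < d)%N, squarefree d & d%:R < X]])
    (class_torsion g d)%:R `^ k.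

(* Main.v *)
Require Import Defs.
From HB Require Import structures.
From mathcomp Require Import all_boot all_order all_algebra all_field finmap.
From mathcomp Require Import zify ring lra.
From mathcomp Require Import all_classical all_reals all_analysis.

Set Implicit Arguments.
Unset Strict Implicit.
Unset Printing Implicit Defensive.

Import Order.TTheory GRing.Theory Num.Theory.

Local Open Scope ring_scope.

(* Fix the class group Cl of Q(sqrt(-d)) with d of size D, and let Q be a set of
   primes p <= Z splitting in the field, with a prime ideal P_p above each.  By
   Cauchy-Schwarz applied to the map (C, p) |-> C [P_p] from Cl[g] x Q to Cl,
   h_g |Q|^2 <= |Cl| (|Q| + N), where N counts the pairs p <> q with
   [P_p]^g = [P_q]^g; each of these gives a solution of 4 (p q)^g = x^2 + d y^2
   with y prime to p q.  Reduction theory gives |Cl| << D^(1/2 + eps), and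
   counting x modulo y^2 gives
     sum_d N << Z^2 (Z^g D^(-1/2) + D^(1/2)) D^eps.
   If Z is a fixed power of D, then all but D^eps values of d have about Z split
   primes up to Z: otherwise the m-th moment of sum_p (-d/p) would be too large
   for the dual large sieve, in which the off-diagonal terms are sums of the
   periodic character n |-> (d d'/n), by reciprocity.  Since N > Z for at most
   Z^(-1) sum_d N values of d, taking Z = D^z with z on a fine grid up to
   3 / (2 g + 2) and summing over dyadic D bounds every moment. *)

(** * Quadratic reciprocity and the characters n |-> (-d/n) *)

(** No L-function enters: the d with too few split primes are charged the trivial bound D^(1/2 +
    eps), and D^eps of them contribute D^(k/2 + eps). Any other d is charged at the last grid point
    z before a failure, where failing at z means N > D^z; there h << D^(1/2 - z + eps), and failing
    at the next point costs only one grid step. Up to D^eps, at most D^z (D^(1/2) + D^(g z - 1/2))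
    values of d fail at z. The first term times D^(k (1/2 - z)) is non-increasing in z because k >=
    1, and for large D no d fails while z < 1/(2 g), since 4 (p q)^g is then less than D; at z =
    1/(2 g) it gives the second exponent of the theorem. The second term, D^((g + 1) z - 1/2),
    reaches D exactly at z = 3/(2 g + 2), beyond which the count of failures is trivial; there both
    this term and the d that never fail give the first exponent. For k > g + 1 its contribution
    decreases in z and k/2 takes over. *)

Definition legendre (p n : nat) : int :=
  if (n%:R : 'F_p) == 0 then 0 else
  if (n%:R : 'F_p) ^+ p./2 == 1 then 1 else -1.

Lemma Fp_natr_eq0 p n : prime p -> ((n%:R : 'F_p) == 0) = (p %| n)%N.
Proof. by move=> pp; rewrite (dvdn_pcharf (pchar_Fp pp)). Qed.

Lemma odd_prime_half p : prime p -> odd p -> p = (p./2 + p./2).+1 /\ (0 < p./2)%N.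
Proof. move=> /prime_gt1 pp op; lia. Qed.

Lemma Fp_expf_half p (x : 'F_p) : prime p -> odd p -> x != 0 ->
  x ^+ p./2 = 1 \/ x ^+ p./2 = -1.
Proof.
move=> pp op x0; have [pE hp] := odd_prime_half pp op.
have : x ^+ p = x by have := expf_card x; rewrite card_Fp.
rewrite (_ : x ^+ p = x * (x ^+ p./2 * x ^+ p./2)); last by rewrite -exprD -exprS -pE.
rewrite -[RHS]mulr1 => /(mulfI x0) e.
have : (x ^+ p./2 - 1) * (x ^+ p./2 + 1) = 0 by rewrite mulrDr mulrBl mulr1 mul1r e; ring.
move/eqP; rewrite mulf_eq0 subr_eq0 addr_eq0 => /orP[] /eqP ->; [by left|by right].
Qed.

(** Euler's criterion serves as the definition of [legendre], which makes multiplicativity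
    immediate; that the value 1 really produces a square root is recovered in [legendre1_square]. *)
Lemma legendre_Fp p n : prime p -> odd p ->
  ((legendre p n)%:~R : 'F_p) = (n%:R) ^+ p./2.
Proof.
move=> pp op; rewrite /legendre; have [pE hp] := odd_prime_half pp op.
case: eqP => [->|/eqP n0]; first by rewrite expr0n; case: (p./2) hp.
case: eqP => [->//|ne]; case: (Fp_expf_half pp op n0) => //  ->.
Qed.

Lemma legendre_values p n : legendre p n \in [:: 0; 1; -1 : int].
Proof. by rewrite /legendre; case: (_ == 0); last case: (_ == 1). Qed.

(** For odd [p] the residues of 0, 1, -1 are distinct, so identities between signs can be proved in
    F_p, where Euler's criterion lives, and lifted back to integers. *)
Lemma Fp_sign_inj p (a b : int) : prime p -> odd p ->
  a \in [:: 0; 1; -1 : int] -> b \in [:: 0; 1; -1 : int] ->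
  (a%:~R : 'F_p) = b%:~R -> a = b.
Proof.
move=> pp op.
have n1 : (1 : 'F_p) != 0 by apply: oner_neq0.
have n2 : (2%:R : 'F_p) != 0.
  by rewrite Fp_natr_eq0 //; apply/negP => /(dvdn_leq _); have := prime_gt1 pp; lia.
have sN1 : (1 == -1 :> 'F_p) = false by rewrite -addr_eq0 -mulr2n (negPf n2).
have [z1 z2 z3] : [/\ (0 == 1 :> 'F_p) = false, (0 == -1 :> 'F_p) = false & (-1 == 1 :> 'F_p) = false].
  by rewrite eq_sym (negPf n1) eq_sym oppr_eq0 (negPf n1) eq_sym sN1.
by rewrite !inE => /or3P[] /eqP-> /or3P[] /eqP-> //= /eqP;
  rewrite ?mulrN1z ?mulr0z ?mulr1z ?z1 ?z2 ?z3 ?sN1 ?oppr_eq0 ?(negPf n1).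
Qed.

Lemma sign3M (a b : int) : a \in [:: 0; 1; -1 : int] -> b \in [:: 0; 1; -1 : int] ->
  a * b \in [:: 0; 1; -1 : int].
Proof. by rewrite !inE => /or3P[] /eqP-> /or3P[] /eqP->. Qed.

Lemma legendreM p m n : prime p -> odd p ->
  legendre p (m * n) = legendre p m * legendre p n.
Proof.
move=> pp op; apply: (Fp_sign_inj pp op); rewrite ?sign3M ?legendre_values //.
by rewrite intrM !legendre_Fp // natrM exprMn.
Qed.

Lemma legendre_mod p m n : prime p -> m = n %[mod p] -> legendre p m = legendre p n.
Proof.
move=> pp mn; have e : (m%:R : 'F_p) = n%:R by rewrite -(Fp_nat_mod pp m) mn Fp_nat_mod.
by rewrite /legendre e.
Qed.

Lemma legendre1 p : legendre p 1 = 1.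
Proof. by rewrite /legendre oner_eq0 expr1n eqxx. Qed.

Lemma legendre_eq0 p n : prime p -> (legendre p n == 0) = (p %| n)%N.
Proof. by move=> pp; rewrite /legendre Fp_natr_eq0 //; case: ifP => //; case: ifP. Qed.

Lemma legendre_pred p : prime p -> odd p -> legendre p p.-1 = (-1) ^+ p./2.
Proof.
move=> pp op; apply: (Fp_sign_inj pp op); rewrite ?legendre_values //.
  by rewrite -signr_odd; case: odd.
rewrite legendre_Fp // rmorphXn /= mulrN1z; congr (_ ^+ _).
by apply/eqP; rewrite -addr_eq0 natr1 prednK ?prime_gt0 // pchar_Fp_0.
Qed.

(** Otherwise all p - 1 nonzero residues would be roots of X^((p-1)/2) - 1. *)
Lemma legendre_nonresidue p : prime p -> odd p -> exists a, legendre p a = -1.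
Proof.
move=> pp op; have [pE hp] := odd_prime_half pp op.
apply: contrapT => ne.
have all1 (x : 'F_p) : x != 0 -> x ^+ p./2 = 1.
  move=> x0; case: (Fp_expf_half pp op x0) => // e; case: ne; exists (x : nat).
  apply: (Fp_sign_inj pp op); rewrite ?legendre_values //.
  by rewrite legendre_Fp // natr_Zp e mulrN1z.
have : (size (rem 0%R (enum 'F_p)) < size ('X^(p./2) - 1 : {poly 'F_p})%R)%N.
  apply: max_poly_roots; last by rewrite rem_uniq // enum_uniq.
    by rewrite -size_poly_eq0 -[1]polyC1 size_XnsubC.
  apply/allP => x; rewrite mem_rem_uniq ?enum_uniq // inE => /andP[x0 _].
  by rewrite /root !hornerE all1 // subrr.
rewrite size_rem ?mem_enum // -cardE card_Fp // -[1]polyC1 size_XnsubC //; lia.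
Qed.

(** The squares of 1, ..., (p-1)/2 already supply (p-1)/2 distinct roots of X^((p-1)/2) - 1; a
    non-square [n] with symbol 1 would be one root too many. *)
Lemma legendre1_square p n : prime p -> odd p -> legendre p n = 1 ->
  exists b : nat, (b ^ 2 = n %[mod p])%N.
Proof.
move=> pp op ln; have [pE hp] := odd_prime_half pp op.
have e : (n%:R : 'F_p) ^+ p./2 = 1 by rewrite -legendre_Fp // ln.
apply: contrapT => ne.
pose sq := [seq ((i.+1)%:R : 'F_p) ^+ 2 | i <- iota 0 p./2].
have : (size ((n%:R : 'F_p) :: sq) < size ('X^(p./2) - 1 : {poly 'F_p})%R)%N.
  apply: max_poly_roots.
  - by rewrite -size_poly_eq0 -[1]polyC1 size_XnsubC.
  - apply/allP => x; rewrite /root !hornerE subr_eq0 inE => /orP[/eqP->|].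
      by rewrite e.
    case/mapP => i; rewrite mem_iota /= add0n => ih ->; rewrite -exprM mulnC.
    have i0 : (i.+1%:R : 'F_p) != 0.
      by rewrite Fp_natr_eq0 //; apply/negP => /(dvdn_leq _); lia.
    by rewrite exprM; case: (Fp_expf_half pp op i0) => ->; rewrite ?sqrrN expr1n.
  - rewrite /=; apply/andP; split.
      apply/negP => /mapP[i _ ei]; case: ne; exists i.+1.
      have : ((i.+1 ^ 2)%:R : 'F_p) = n%:R by rewrite natrX ei.
      move=> /(congr1 (fun x : 'F_p => nat_of_ord x)).
      by rewrite !val_Fp_nat.
    rewrite map_inj_in_uniq ?iota_uniq // => i j; rewrite !mem_iota /= add0n => ih jh /eqP.
    wlog ij : i j ih jh / (i <= j)%N => [W|].
      by case: (leqP i j) => [l|/ltnW l] e0; [exact: W|symmetry; apply: W; rewrite // eq_sym].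
    rewrite eq_sym -subr_eq0 subr_sqr mulf_eq0 => /orP[].
      rewrite -natrB ?ltnS // Fp_natr_eq0 // subSS => /dvdn_leq; lia.
    rewrite -natrD Fp_natr_eq0 // => /dvdn_leq; lia.
by rewrite /= size_map size_iota -[1]polyC1 size_XnsubC // ltnn.
Qed.

Lemma fold_eq p h x y : p = (h + h).+1 -> (x < p)%N -> (y < p)%N ->
  (if (x <= h)%N then x else p - x)%N = (if (y <= h)%N then y else p - y)%N ->
  x = y \/ (x + y = p)%N.
Proof. by move=> -> ? ?; case: ifP => ?; case: ifP => ? ?; lia. Qed.

Section Gauss.
Variables (p a : nat).
Hypotheses (pp : prime p) (op : odd p) (pa : ~~ (p %| a)%N).
Let h := p./2.
Let r j := ((a * j) %% p)%N.
Let s j := if (r j <= h)%N then r j else (p - r j)%N.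

Let sP j : (0 < j <= h)%N -> (0 < s j <= h)%N.
Proof.
move=> /andP[j0 jh]; have [pE hp] := odd_prime_half pp op.
have rp : (r j < p)%N by rewrite ltn_mod; lia.
have r0 : (0 < r j)%N.
  rewrite lt0n; apply/negP => /eqP e.
  have : (p %| a * j)%N by rewrite /dvdn; apply/eqP.
  by rewrite Euclid_dvdM // (negPf pa) /= => /(dvdn_leq j0); rewrite /h in jh; lia.
by rewrite /s /h in pE *; case: ifP; lia.
Qed.

Let s_inj i j : (0 < i <= h)%N -> (0 < j <= h)%N -> s i = s j -> i = j.
Proof.
move=> /andP[i0 ih] /andP[j0 jh]; have [pE hp] := odd_prime_half pp op.
wlog ij : i j i0 ih j0 jh / (i <= j)%N => [W|].
  by case: (leqP i j) => [l|/ltnW l] e; [exact: W|symmetry; exact: W].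
have rip : (r i < p)%N by rewrite ltn_mod prime_gt0.
have rjp : (r j < p)%N by rewrite ltn_mod prime_gt0.
have jip : (j + i < p)%N by rewrite pE ltnS leq_add.
move=> /(fold_eq pE rip rjp)[e|e].
  have : (p %| a * (j - i))%N.
    by rewrite mulnBr -eqn_mod_dvd ?leq_mul2l ?ij ?orbT //; apply/eqP/esym.
  rewrite Euclid_dvdM // (negPf pa) /=; case: (posnP (j - i)) => [|j_i /(dvdn_leq j_i)].
    by move/eqP; rewrite subn_eq0 => ji _; apply/eqP; rewrite eqn_leq ij ji.
  move: jip; clear; lia.
have : (p %| a * (i + j))%N by rewrite mulnDr /dvdn -modnDm -/(r i) -/(r j) e modnn.
rewrite Euclid_dvdM // (negPf pa) /= => /dvdn_leq; move: jip i0; clear; lia.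
Qed.

Let s_perm : perm_eq (map s (index_iota 1 h.+1)) (index_iota 1 h.+1).
Proof.
have u : uniq (map s (index_iota 1 h.+1)).
  rewrite map_inj_in_uniq ?iota_uniq // => i j; rewrite !mem_index_iota !ltnS.
  exact: s_inj.
apply: uniq_perm; rewrite ?iota_uniq //.
have sub : {subset map s (index_iota 1 h.+1) <= index_iota 1 h.+1}.
  by move=> x /mapP[j]; rewrite mem_index_iota ltnS => /sP + ->; rewrite mem_index_iota ltnS.
by have [] := uniq_min_size u sub; rewrite ?size_map.
Qed.

(** [s j] is the absolute value of the least absolute residue of [a * j]. As [p] is odd,
    [r j + s j], which is either twice [r j] or [p], is odd exactly when the residue was reflected,
    so its parity records the sign. *)
Let Fp_sj j : (0 < j <= h)%N -> ((a * j)%N%:R : 'F_p) = (-1) ^+ (r j + s j) * (s j)%:R.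
Proof.
move=> /sP /andP[s0 sh]; have [pE hp] := odd_prime_half pp op.
have rp : (r j < p)%N by rewrite ltn_mod; lia.
rewrite -(Fp_nat_mod pp) -/(r j); rewrite /s; case: ifP => rh.
  by rewrite -signr_odd addnn odd_double mul1r.
rewrite subnKC ?(ltnW rp) // -signr_odd op expr1 natrB ?(ltnW rp) // pchar_Fp_0 //.
by rewrite sub0r mulN1r opprK.
Qed.

(** Gauss's lemma: multiply the a j for j <= (p-1)/2 and cancel the factorial, since [s] permutes 1,
    ..., (p-1)/2. The exponent is kept in a form that serves both uses: modulo 2 the first term
    drops out for odd [a], and the floors vanish for [a = 2]. *)
Lemma gauss_legendre :
  legendre p a = (-1) ^+ ((a.+1 * \sum_(1 <= j < h.+1) j) +
                          \sum_(1 <= j < h.+1) ((a * j) %/ p))%N.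
Proof.
have [pE hp] := odd_prime_half pp op.
set e := (X in _ ^+ X); set F := \prod_(1 <= j < h.+1) (j%:R : 'F_p).
have F0 : F != 0.
  rewrite /F prodf_seq_neq0; apply/allP => j; rewrite mem_index_iota => /andP[j0 jh] /=.
  by rewrite Fp_natr_eq0 //; apply/negP => /(dvdn_leq j0); rewrite /h in jh; lia.
have sE : (\sum_(1 <= j < h.+1) s j = \sum_(1 <= j < h.+1) j)%N.
  by rewrite -[RHS](perm_big _ s_perm) /= big_map.
have key : ((a%:R : 'F_p) ^+ h) * F = (-1) ^+ e * F.
  transitivity (\prod_(1 <= j < h.+1) ((a * j)%N%:R : 'F_p)).
    have -> : (a%:R : 'F_p) ^+ h = \prod_(1 <= j < h.+1) a%:R.
      by rewrite prodr_const_nat subn1.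
    by rewrite -big_split; apply: eq_bigr => j _; rewrite natrM.
  rewrite (eq_big_seq (fun j => (-1) ^+ (r j + s j) * (s j)%:R)); last first.
    by move=> j; rewrite mem_index_iota ltnS => /Fp_sj.
  rewrite big_split /=; congr (_ * _); last first.
    by rewrite /F -[RHS](perm_big _ s_perm) /= big_map.
  have -> : \prod_(1 <= j < h.+1) ((-1) ^+ (r j + s j) : 'F_p) =
            (-1) ^+ (\sum_(1 <= j < h.+1) (r j + s j))%N by rewrite expr_sum.
  rewrite -signr_odd -[RHS]signr_odd; congr ((-1) ^+ (nat_of_bool _)).
  rewrite big_split /= sE /e mulSn !oddD.
  (* Summing a j = p floor(a j / p) + r j with p odd trades the residues for the floors modulo 2. *)
  have -> : odd (a * \sum_(1 <= j < h.+1) j) =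
            odd (\sum_(1 <= j < h.+1) (a * j) %/ p) (+) odd (\sum_(1 <= j < h.+1) r j).
    rewrite -oddD big_distrr /= -big_split /=.
    rewrite (eq_bigr (fun j => (a * j) %/ p * p + r j)%N); last by move=> j _; rewrite -divn_eq.
    by rewrite !big_split /= !oddD -big_distrl /= oddM op andbT.
  by case: odd; case: odd; case: odd.
apply: (Fp_sign_inj pp op); rewrite ?legendre_values //.
  by rewrite -signr_odd; case: odd.
rewrite legendre_Fp // (mulIf F0 key) rmorphXn /= mulrN1z //.
Qed.
End Gauss.

Lemma legendre2 p : prime p -> odd p ->
  legendre p 2 = (-1) ^+ (\sum_(1 <= j < (p./2).+1) j)%N.
Proof.
move=> pp op; have [pE hp] := odd_prime_half pp op.
rewrite gauss_legendre //; last by apply/negP => /dvdn_leq; lia.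
rewrite [X in (_ + X)%N]big1_seq ?addn0; last first.
  by move=> j; rewrite mem_index_iota => /andP[_ H]; rewrite divn_small //; lia.
by rewrite -signr_odd oddM /= signr_odd.
Qed.

Lemma sum_leq_count m n : (m <= n)%N -> (\sum_(1 <= j < n.+1) (j <= m) = m)%N.
Proof.
move=> mn; rewrite (@big_cat_nat _ _ _ m.+1) //=.
rewrite (eq_big_nat _ _ (F2 := fun=> 1%N)); last by move=> j /andP[_]; rewrite ltnS => ->.
rewrite [X in (_ + X)%N](eq_big_nat _ _ (F2 := fun=> 0%N)); last first.
  by move=> j /andP[H _]; rewrite leqNgt H.
by rewrite big1_eq sum_nat_const_nat subn1 muln1 addn0.
Qed.

(** The floor counts lattice points under the diagonal; none lies on it because [q] divides neither
    [i] nor [p]. *)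
Lemma sum_floor_count p q i : prime p -> odd p -> prime q -> odd q -> p != q ->
  (0 < i <= q./2)%N ->
  ((p * i) %/ q = \sum_(1 <= j < (p./2).+1) (j * q < i * p))%N.
Proof.
move=> pp op pq oq pnq /andP[i0 iq].
have [pE hp] := odd_prime_half pp op; have [qE hq] := odd_prime_half pq oq.
have b : ((p * i) %/ q <= p./2)%N.
  rewrite -ltnS ltn_divLR; last lia.
  have : (p * i <= p * q./2)%N by rewrite leq_mul2l iq orbT.
  move: pE qE; set h := p./2; set h' := q./2 => -> ->; nia.
rewrite -[LHS](sum_leq_count b); apply: eq_big_nat => j /andP[j0 jp].
rewrite leq_divRL; last lia.
rewrite leq_eqVlt (mulnC p) orbC; case: (_ < _)%N => //=.
apply/eqP; rewrite eqb0; apply/eqP => e.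
have : (q %| i * p)%N by rewrite -e dvdn_mull.
rewrite Euclid_dvdM // => /orP[/(dvdn_leq i0)|]; first lia.
by rewrite dvdn_prime2 // eq_sym (negPf pnq).
Qed.

(** Eisenstein's argument: the two floor sums count the lattice points of a [p./2] by [q./2] box on
    the two sides of its diagonal, so together they count the whole box. *)
Lemma quadratic_reciprocity p q : prime p -> odd p -> prime q -> odd q -> p != q ->
  legendre p q = legendre q p * (-1) ^+ (p./2 * q./2).
Proof.
move=> pp op pq oq pnq; have qnp : q != p by rewrite eq_sym.
have pE := gauss_legendre pp op (a := q); have qE := gauss_legendre pq oq (a := p).
rewrite pE ?dvdn_prime2 // qE ?dvdn_prime2 //.
rewrite -[LHS]signr_odd -exprD -[RHS]signr_odd; congr ((-1) ^+ (nat_of_bool _)).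
rewrite !oddD !oddM /= op oq /=.
have : (\sum_(1 <= j < (p./2).+1) ((q * j) %/ p) + \sum_(1 <= i < (q./2).+1) ((p * i) %/ q) =
         p./2 * q./2)%N.
  rewrite (eq_big_nat _ _ (F2 := fun j => \sum_(1 <= i < (q./2).+1) (i * p < j * q))%N); last first.
    by move=> j H; rewrite sum_floor_count.
  rewrite exchange_big /= -big_split /=.
  rewrite (eq_big_nat _ _ (F2 := fun i => p./2)); last first.
    move=> i Hi; rewrite (@sum_floor_count p q) // -big_split /=.
    rewrite (eq_big_nat _ _ (F2 := fun=> 1%N)).
      by rewrite sum_nat_const_nat subn1 muln1.
    move=> j Hj; case: ltngtP => // e; exfalso.
    have : (q %| i * p)%N by rewrite e dvdn_mull.
    have [qE' _] := odd_prime_half pq oq.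
    rewrite Euclid_dvdM // => /orP[/dvdn_leq|]; first lia.
    by rewrite dvdn_prime2 // eq_sym (negPf pnq).
  by rewrite sum_nat_const_nat subn1 mulnC.
move=> /(congr1 odd); rewrite oddD oddM => <-.
by rewrite !addbb /= [RHS]addbC -addbA addbb addbF.
Qed.

(** * The character n |-> (-d/n): multiplicativity, periodicity, values at primes *)

Definition chi4 (n : nat) : int := if odd n then (-1) ^+ n./2 else 0.

Definition chi8 (n : nat) : int := if (n %% 8)%N \in [:: 1; 7]%N then 1 else -1.

(** For odd [n] this is the Jacobi symbol (q/n), flipped by reciprocity, with [chi8] as the
    supplementary law for 2. The values at even [n] carry no meaning; the factor [chi4] of [chi]
    erases them. *)
Definition chiq (q n : nat) : int :=
  if q == 2%N then chi8 n else legendre q n * (-1) ^+ (n./2 * q./2).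

(* For squarefree d this is the Jacobi symbol (-d/n), already rewritten by
   reciprocity, so that periodicity in n is immediate and the content lies in
   its value at primes (chi_prime). *)
Definition chi (d n : nat) : int := chi4 n * \prod_(q <- primes d) chiq q n.

Lemma odd_mod8 n : odd n -> exists2 q, (n = 8 * q + n %% 8)%N & (n %% 8)%N \in [:: 1; 3; 5; 7]%N.
Proof.
move=> on; exists (n %/ 8)%N; first by rewrite {1}(divn_eq n 8) mulnC.
have : odd (n %% 8) by rewrite {1}(divn_eq n 8) oddD oddM andbF in on.
have : (n %% 8 < 8)%N by rewrite ltn_mod.
by move: (n %% 8)%N; do 8 case=> //.
Qed.

Lemma chi8M m n : odd m -> odd n -> chi8 (m * n) = chi8 m * chi8 n.
Proof.
move=> /odd_mod8[_ _ Hm] /odd_mod8[_ _ Hn]; rewrite /chi8 -modnMm.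
by move: Hm Hn; rewrite !inE => /or4P[] /eqP-> /or4P[] /eqP->.
Qed.

Lemma sum_index_iota2 h : (2 * \sum_(1 <= j < h.+1) j = h * h.+1)%N.
Proof.
elim: h => [|h IH]; first by rewrite big_geq.
by rewrite big_nat_recr //= mulnDr IH; lia.
Qed.

Lemma legendre2_chi8 p : prime p -> odd p -> legendre p 2 = chi8 p.
Proof.
move=> pp op; rewrite legendre2 //; have := sum_index_iota2 p./2.
have [q pE Hr] := odd_mod8 op; rewrite /chi8 -signr_odd.
set s := (\sum_(1 <= j < _) j)%N; move: s => s; clear pp op.
move: (p %% 8)%N Hr pE => r + ->.
rewrite !inE => /or4P[] /eqP-> e.
- have -> : odd s = false by nia.
  by [].
- have -> : odd s by nia.
  by [].
- have -> : odd s by nia.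
  by [].
- have -> : odd s = false by nia.
  by [].
Qed.

Lemma chi4M m n : chi4 (m * n) = chi4 m * chi4 n.
Proof.
rewrite /chi4 oddM; case om: (odd m); case on: (odd n); rewrite /= ?mul0r ?mulr0 //.
rewrite -exprD -signr_odd -[RHS]signr_odd; congr ((-1) ^+ (nat_of_bool _)).
have [a ->] : exists a, m = (a.*2).+1 by exists m./2; lia.
have [b ->] : exists b, n = (b.*2).+1 by exists n./2; lia.
have -> : ((a.*2.+1 * b.*2.+1) = ((a * b).*2 + a + b).*2.+1)%N by lia.
have hd k : (k.*2.+1)./2 = k by rewrite /= uphalf_double.
by rewrite !hd !oddD odd_double.
Qed.

Lemma sign_halfM k m n : odd m -> odd n ->
  (-1) ^+ ((m * n)./2 * k) = (-1) ^+ (m./2 * k) * (-1) ^+ (n./2 * k) :> int.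
Proof.
move=> om on; have := chi4M m n; rewrite /chi4 oddM om on /= !exprM => ->.
by rewrite exprMn.
Qed.

Lemma chiqM q m n : prime q -> odd m -> odd n -> chiq q (m * n) = chiq q m * chiq q n.
Proof.
move=> pq om on; rewrite /chiq; case: eqP => [_|/eqP q2]; first exact: chi8M.
have oq : odd q by case: (even_prime pq) q2 => [->|].
rewrite legendreM // sign_halfM //; ring.
Qed.

Lemma chiM d m n : chi d (m * n) = chi d m * chi d n.
Proof.
case om : (odd m); last by rewrite /chi /chi4 oddM om !mul0r.
case on : (odd n); last by rewrite /chi /chi4 oddM om on !mul0r mulr0.
rewrite /chi chi4M (eq_big_seq (fun q => chiq q m * chiq q n)).
  by rewrite big_split /=; ring.
by move=> q; rewrite mem_primes => /andP[pq _]; rewrite chiqM.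
Qed.

Lemma chi4_mod m n : m = n %[mod 4] -> chi4 m = chi4 n.
Proof.
move=> e; have -> : chi4 m = chi4 (m %% 4) by rewrite /chi4 -signr_odd -[in RHS]signr_odd;
  have -> : odd (m %% 4) = odd m by [lia]; case: ifP => // om;
  have -> : odd (m %% 4)./2 = odd m./2 by [lia].
rewrite e; rewrite /chi4 -signr_odd -[in RHS]signr_odd.
have -> : odd (n %% 4) = odd n by lia.
case: ifP => // on.
by have -> : odd (n %% 4)./2 = odd n./2 by lia.
Qed.

Lemma chiq_mod q m n : prime q -> odd m -> m = n %[mod 8 * q] -> chiq q m = chiq q n.
Proof.
move=> pq om e.
have dvd k : (k %| 8 * q)%N -> m = n %[mod k].
  by move=> kd; rewrite -(modn_dvdm m kd) e modn_dvdm.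
rewrite /chiq /chi8 (dvd 8%N) ?dvdn_mulr //; case: eqP => // _.
rewrite (legendre_mod pq (dvd q _)) ?dvdn_mull //; congr (_ * _).
have e4 : m = n %[mod 4] by apply: dvd; rewrite dvdn_mulr.
have on : odd n by lia.
by have := chi4_mod e4; rewrite /chi4 om on !exprM => ->.
Qed.

Lemma chi_mod d m n : m = n %[mod 8 * d] -> chi d m = chi d n.
Proof.
move=> e; have dvd k : (k %| 8 * d)%N -> m = n %[mod k].
  by move=> kd; rewrite -(modn_dvdm m kd) e modn_dvdm.
have e4 : m = n %[mod 4] by apply: dvd; rewrite dvdn_mulr.
rewrite /chi (chi4_mod e4); case om : (odd m); last first.
  have on : odd n = false by lia.
  by rewrite /chi4 on !mul0r.
congr (_ * _); apply: eq_big_seq => q; rewrite mem_primes => /and3P[pq _ qd].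
by apply: chiq_mod => //; apply: dvd; rewrite dvdn_pmul2l.
Qed.

Lemma squarefree_prod_primes d : (0 < d)%N -> squarefree d ->
  d = (\prod_(q <- primes d) q)%N.
Proof.
move=> d0 sq; rewrite {1}(prod_prime_decomp d0) prime_decompE big_map /=.
apply: eq_big_seq => q qd; have : (logn q d <= 1)%N.
  rewrite leqNgt; apply/negP => l2; move: qd; rewrite mem_primes => /and3P[pq _ _].
  have q1 : q = 1%N by apply: sq; rewrite pfactor_dvdn.
  by rewrite q1 in pq.
have : (0 < logn q d)%N by rewrite logn_gt0.
by case: (logn q d) => [|[|]].
Qed.

(** Reciprocity is undone prime by prime, as a squarefree [d] is the product of its primes. The
    residue -d appears as [p.-1 * d] because [legendre] takes natural numbers. *)
Lemma chi_prime d p : (0 < d)%N -> squarefree d ->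
  prime p -> odd p -> chi d p = legendre p (p.-1 * d).
Proof.
move=> d0 sq pp op; rewrite legendreM // legendre_pred // /chi /chi4 op.
congr (_ * _); rewrite {2}(squarefree_prod_primes d0 sq).
rewrite (big_morph (legendre p) (fun x y => legendreM x y pp op) (legendre1 p)).
apply: eq_big_seq => q; rewrite mem_primes => /andP[pq _].
rewrite /chiq; case: eqP => [->|/eqP q2]; first by rewrite legendre2_chi8.
have oq : odd q by case: (even_prime pq) q2 => [->|].
case: (eqVneq p q) => [<-|pnq].
  have /eqP -> : legendre p p == 0 by rewrite legendre_eq0.
  by rewrite mul0r.
by rewrite (quadratic_reciprocity pp op pq oq pnq).
Qed.

(** This is the form in which split primes are used: [b] is the datum that defines the prime ideal
    (p, b + sqrt(-d)) above [p]. *)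
Lemma chi_prime1 d p : (0 < d)%N -> squarefree d ->
  prime p -> odd p -> chi d p = 1 -> ~~ (p %| d)%N /\ exists b, (p %| b ^ 2 + d)%N.
Proof.
move=> d0 sq pp op; rewrite chi_prime // => l1; split.
  apply/negP => pd; have : legendre p (p.-1 * d) == 0 by rewrite legendre_eq0 // dvdn_mull.
  by rewrite l1.
have [b eb] := legendre1_square pp op l1; exists b.
have -> : (p %| b ^ 2 + d)%N = (p %| p.-1 * d + d)%N by rewrite /dvdn -modnDml eb modnDml.
by rewrite -mulSnr prednK ?prime_gt0 // dvdn_mulr.
Qed.

Lemma chi_prime0 d p : (0 < d)%N -> squarefree d ->
  prime p -> odd p -> chi d p = 0 -> (p %| d)%N.
Proof.
move=> d0 sq pp op; rewrite chi_prime // => /eqP; rewrite legendre_eq0 // Euclid_dvdM //.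
by case/orP => // /dvdn_leq; have := prime_gt1 pp; lia.
Qed.

Lemma chi_values d n : chi d n \in [:: 0; 1; -1 : int].
Proof.
have sg k : (-1) ^+ k \in [:: 0; 1; -1 : int] by rewrite -signr_odd; case: odd.
apply: sign3M; first by rewrite /chi4; case: ifP => // _.
apply: (big_ind (fun x => x \in [:: 0; 1; -1 : int])) => // [x y|q _]; first exact: sign3M.
rewrite /chiq; case: ifP => _; first by rewrite /chi8; case: ifP.
exact: sign3M (legendre_values _ _) (sg _).
Qed.

(** * Near-orthogonality of the characters of two distinct squarefree numbers *)

Definition pos_squarefree d := (0 < d)%N /\ squarefree d.

Lemma chi_odd_one q n : odd n -> n = 1 %[mod q] -> n = 1 %[mod 4] -> prime q -> q != 2%N ->
  chiq q n = 1.
Proof.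
move=> on nq n4 pq q2; rewrite /chiq (negPf q2) (legendre_mod pq nq) legendre1 mul1r.
by have := chi4_mod n4; rewrite /chi4 on exprM => ->; rewrite expr1n.
Qed.

Lemma pos_squarefree_ndvd_div q d : pos_squarefree d -> prime q -> (q %| d)%N -> ~~ (q %| d %/ q)%N.
Proof.
move=> [d0 sq] pq qd; apply/negP => q2.
have : q = 1%N by apply: sq; rewrite expnS expn1 -(divnK qd) dvdn_mul.
by move=> q1; rewrite q1 in pq.
Qed.

Lemma odd_mod4_1 n : n = 1 %[mod 4] -> odd n.
Proof. by move=> h; rewrite (divn_eq n 4) h oddD oddM andbF. Qed.

Lemma mod4_mod8_5 n : n = 5 %[mod 8] -> n = 1 %[mod 4].
Proof. by move=> h; rewrite -(@modn_dvdm 8) // h. Qed.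

(* The witness is 1 modulo everything except a prime q dividing exactly one of
   the two numbers, where it is a non-residue (5 modulo 8 when q = 2). *)
Lemma chi_separate d e q : pos_squarefree d -> pos_squarefree e -> prime q -> (q %| d)%N -> ~~ (q %| e)%N ->
  exists2 n, coprime n (8 * d * e) & chi d n * chi e n = -1.
Proof.
move=> sd se pq qd qe; have [[d0 _] [e0 _]] := (sd, se).
have qdq := pos_squarefree_ndvd_div sd pq qd.
have [M [a [cM qM a_q H]]] : exists M a, [/\ coprime M (if q == 2 then 8 else q)%N,
   forall r, prime r -> (r %| 8 * d * e)%N -> r != q -> (r %| M)%N, coprime a q &
   forall n, n = a %[mod (if q == 2 then 8 else q)%N] -> n = 1 %[mod M] ->
     [/\ odd n, n = 1 %[mod 4], (q != 2%N -> n = 1 %[mod 8]) & chiq q n = -1]].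
  case: (eqVneq q 2%N) => [q2|q2].
    exists (d %/ q * e)%N, 5%N; subst q; split => //.
    - rewrite -[8%N]/(2 ^ 3)%N coprimeXr // coprime_sym prime_coprime // Euclid_dvdM //.
      by rewrite negb_or qdq.
    - move=> r pr; rewrite -mulnA Euclid_dvdM // -[8%N]/(2 ^ 3)%N Euclid_dvdX //= dvdn_prime2 //.
      move=> /orP[/andP[-> //]|]; rewrite -{1}(divnK qd) mulnAC (Euclid_dvdM _ _ pr).
      by move=> /orP[//|]; rewrite (dvdn_prime2 pr) // => /eqP ->; rewrite eqxx.
    - move=> n n5 _; have n4 := mod4_mod8_5 n5; have on := odd_mod4_1 n4.
      split=> //.
      by rewrite /chiq eqxx /chi8 n5.
  have oq : odd q by case: (even_prime pq) q2 => [->|].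
  have [a la] := legendre_nonresidue pq oq.
  exists (8 * (d %/ q) * e)%N, a; split.
  - rewrite coprime_sym prime_coprime // !Euclid_dvdM // !negb_or qdq qe !andbT.
    by rewrite -[8%N]/(2 ^ 3)%N Euclid_dvdX // dvdn_prime2 // (negPf q2).
  - move=> r pr; rewrite -{1}(divnK qd) mulnA (mulnAC _ q) (Euclid_dvdM _ _ pr).
    by move=> /orP[//|]; rewrite (dvdn_prime2 pr) // => /eqP ->; rewrite eqxx.
  - rewrite coprime_sym prime_coprime // -legendre_eq0 // la //.
  - move=> n na n1; have n4 : n = 1 %[mod 4].
      have d4 : (4 %| 8 * (d %/ q) * e)%N by rewrite !dvdn_mulr.
      by rewrite -(modn_dvdm n d4) n1 modn_dvdm.
    have n8 : n = 1 %[mod 8].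
      have d8 : (8 %| 8 * (d %/ q) * e)%N by rewrite !dvdn_mulr.
      by rewrite -(modn_dvdm n d8) n1 modn_dvdm.
    have on := odd_mod4_1 n4.
    split=> //; rewrite /chiq (negPf q2) (legendre_mod pq na) la.
    by have := chi4_mod n4; rewrite /chi4 on exprM => ->; rewrite expr1n.
set Q := (if _ then _ else _) in cM H; set n := chinese M Q 1 a.
have nM : n = 1 %[mod M] by apply: chinese_modl.
have nQ : n = a %[mod Q] by apply: chinese_modr.
have [on n4 n8 nq] := H n nQ nM.
exists n.
  rewrite coprime_sym coprime_has_primes ?muln_gt0 ?d0 ?e0 //; last by case: (n) on.
  apply/hasPn => r; rewrite mem_primes => /and3P[pr _ rn] /=.
  rewrite mem_primes negb_and pr /= muln_gt0 muln_gt0 d0 e0 /=; apply/negP => rde.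
  case: (eqVneq r q) => [rq|rq]; last first.
    have rM := qM r pr rde rq; have : (r %| 1)%N.
      by rewrite /dvdn -(modn_dvdm 1 rM) -nM modn_dvdm.
    by rewrite dvdn1 => /eqP r1; rewrite r1 in pr.
  have qQ : (q %| Q)%N by rewrite /Q; case: eqP => // ->.
  have : (q %| a)%N by rewrite /dvdn -(modn_dvdm a qQ) -nQ modn_dvdm // -/(dvdn _ _) -rq.
  by move=> qa; move: a_q; rewrite coprime_sym prime_coprime // qa.
have c4 : chi4 n = 1 by rewrite (chi4_mod n4).
have one r : prime r -> (r %| d * e)%N -> r != q -> chiq r n = 1.
  move=> pr rd rq; have rM : (r %| M)%N by apply: qM; rewrite // -mulnA dvdn_mull.
  case: (eqVneq r 2%N) => [r2|r2].
    have q2 : q != 2%N by rewrite eq_sym -r2.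
    by rewrite r2 /chiq eqxx /chi8 (n8 q2).
  apply: chi_odd_one => //.
  by rewrite -(modn_dvdm n rM) nM modn_dvdm.
rewrite /chi c4 !mul1r (bigD1_seq q) ?primes_uniq ?mem_primes ?pq ?d0 //= nq.
rewrite big_seq_cond big1 ?mulr1; last first.
  move=> r /andP[]; rewrite mem_primes => /and3P[pr _ rd] rq; apply: one => //.
  by rewrite dvdn_mulr.
rewrite big1_seq ?mulr1 // => r; rewrite andTb mem_primes => /and3P[pr _ re].
by apply: one; rewrite ?dvdn_mull //; apply: contraNneq qe => <-.
Qed.

(** Multiplication by [n0] permutes the residues modulo [M] and flips the sign of every term, so the
    sum equals its own opposite. *)
Lemma period_sum0 (psi : nat -> int) (M n0 : nat) : (0 < M)%N ->
  (forall m n, psi (m * n)%N = psi m * psi n) ->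
  (forall m n, m = n %[mod M] -> psi m = psi n) ->
  coprime n0 M -> psi n0 = -1 -> \sum_(n < M) psi n = 0.
Proof.
case: M => // M _ psiM psimod cM psi1.
pose f (i : 'I_M.+1) : 'I_M.+1 := inord ((n0 * i) %% M.+1).
have fE i : f i = ((n0 * i) %% M.+1)%N :> nat by rewrite /f inordK // ltn_mod.
have f_inj : injective f.
  move=> i j /(congr1 val); rewrite /= !fE => /eqP.
  wlog ij : i j / (i <= j)%N => [W|].
    by case: (leqP i j) => [/W//|/ltnW/W h]; rewrite eq_sym => /h.
  rewrite eq_sym eqn_mod_dvd ?leq_mul2l ?ij ?orbT // -mulnBr Gauss_dvdr 1?coprime_sym //.
  case: (posnP (j - i)) => [|j_i /(dvdn_leq j_i)]; last by have := ltn_ord j; lia.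
  by move=> e _; apply: val_inj => /=; lia.
set T := \sum_(_ < _) _.
have : T = - T.
  rewrite {1}/T (reindex_inj f_inj) /= (eq_bigr (fun i : 'I_M.+1 => - psi i)) ?sumrN //.
  move=> i _; rewrite (psimod _ (n0 * i)%N) ?psiM ?psi1 ?mulN1r //.
  by rewrite fE modn_mod.
lia.
Qed.

(** Full periods cancel and less than one period remains. So crude a bound is enough, because the
    sieve is later run at a length Z^m far beyond the moduli. *)
Lemma period_sum_bound (psi : nat -> int) (M n0 N : nat) : (0 < M)%N ->
  (forall m n, psi (m * n)%N = psi m * psi n) ->
  (forall m n, m = n %[mod M] -> psi m = psi n) ->
  coprime n0 M -> psi n0 = -1 -> (forall n, `|psi n| <= 1) ->
  \sum_(0 <= n < N) psi n <= M%:Z.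
Proof.
move=> M0 psiM psimod cM psi1 psib.
have T0 := period_sum0 M0 psiM psimod cM psi1.
have TqM q : \sum_(0 <= n < q * M) psi n = 0.
  elim: q => [|q IH]; first by rewrite mul0n big_geq.
  rewrite (@big_cat_nat _ _ _ (q * M)) ?leq_mul2r ?leqnSn ?orbT //= IH add0r.
  rewrite mulSn addnC -{1}[(q * M)%N]add0n big_addn addnC addnK big_mkord -[RHS]T0.
  by apply: eq_bigr => i _; apply: psimod; rewrite addnC modnMDl.
rewrite {1}(divn_eq N M) (@big_cat_nat _ _ _ (N %/ M * M)) ?leq_addr //= TqM add0r.
apply: le_trans (_ : \sum_(N %/ M * M <= n < N %/ M * M + N %% M) 1 <= _).
  by apply: ler_sum => n _; apply: le_trans (psib n); apply: ler_norm.
rewrite sumr_const_nat addKn natz lez_nat.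
by have := ltn_pmod N M0; lia.
Qed.

Lemma pos_squarefree_eq d e : pos_squarefree d -> pos_squarefree e -> primes d =i primes e -> d = e.
Proof.
move=> [d0 sd] [e0 se] de; rewrite (squarefree_prod_primes d0 sd) (squarefree_prod_primes e0 se).
by apply: perm_big; apply: uniq_perm; rewrite ?primes_uniq.
Qed.

(** Distinct squarefree numbers differ in some prime, where [chi_separate] shows that the product
    character takes the value -1; its full periods of length 8 d e therefore cancel. *)
Lemma chi_pair_sum d e N : pos_squarefree d -> pos_squarefree e -> d != e ->
  \sum_(0 <= n < N) (chi d n * chi e n) <= (8 * d * e)%N%:Z.
Proof.
move=> sd se dne; have [[d0 _] [e0 _]] := (sd, se).
have [n cn n1] : exists2 n, coprime n (8 * d * e) & chi d n * chi e n = -1.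
  have [q [pq]] : exists q, prime q /\ (q %| d)%N != (q %| e)%N.
    apply: contrapT => ne; move/eqP: dne; apply; apply: pos_squarefree_eq => // q.
    rewrite !mem_primes d0 e0 /=; case pq : (prime q) => //=.
    by apply: contrapT => /eqP H; case: ne; exists q.
  case qd : (q %| d)%N; case qe : (q %| e)%N => // _.
    by apply: (@chi_separate d e q); rewrite ?qe.
  have [n cn n1] := chi_separate se sd pq qe (negbT qd).
  by exists n; rewrite ?(mulrC (chi d n)) // mulnAC.
apply: (@period_sum_bound (fun n => chi d n * chi e n) _ n) => //.
- by rewrite !muln_gt0 d0 e0.
- by move=> a b; rewrite !chiM mulrACA.
- move=> a b ab; congr (_ * _); apply: chi_mod.
    have h : (8 * d %| 8 * d * e)%N by rewrite dvdn_mulr.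
    by rewrite -(modn_dvdm a h) ab modn_dvdm.
  have h : (8 * e %| 8 * d * e)%N by rewrite mulnAC dvdn_mulr.
  by rewrite -(modn_dvdm a h) ab modn_dvdm.
- move=> a; have := chi_values d a; have := chi_values e a.
  by rewrite !inE => /or3P[] /eqP-> /or3P[] /eqP->.
Qed.

(** * A large sieve for quadratic characters *)

Lemma sum_sqr_le (R : realDomainType) (I : finType) (B : I -> R) :
  (\sum_i B i) ^+ 2 <= #|I|%:R * \sum_i B i ^+ 2.
Proof.
have H : 0 <= \sum_i \sum_j (B i - B j) ^+ 2.
  by apply: sumr_ge0 => i _; apply: sumr_ge0 => j _; apply: sqr_ge0.
suff : \sum_i \sum_j (B i - B j) ^+ 2 =
   2 * (#|I|%:R * \sum_i B i ^+ 2 - (\sum_i B i) ^+ 2) by move=> E; rewrite E in H; lra.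
rewrite (eq_bigr (fun i => B i ^+ 2 * #|I|%:R - 2 * (B i * \sum_j B j) + \sum_j B j ^+ 2)).
  rewrite !big_split /= -mulr_suml sumrN -mulr_sumr -mulr_suml sumr_const.
  rewrite -[X in _ + X]mulr_natr expr2; ring.
move=> i _; rewrite (eq_bigr (fun j => B i ^+ 2 + (- 2 * B i * B j) + B j ^+ 2)).
  rewrite !big_split /= sumr_const -mulr_natr -mulr_sumr; ring.
by move=> j _; ring.
Qed.

Lemma Posz_expn a m : (a ^ m)%N%:Z = a%:Z ^+ m.
Proof. by elim: m => // m IH; rewrite expnS PoszM IH exprS. Qed.

Lemma Posz_mulrn a n : a%:Z *+ n = (a * n)%N%:Z.
Proof. by elim: n => [|n IH]; rewrite ?muln0 // mulrS IH mulnS PoszD. Qed.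

(* A tuple of primes with a given product takes its values among the entries of
   any other such tuple. *)
Lemma prime_tuples_le (m : nat) (P : seq nat) (n : nat) : uniq P -> {in P, forall p, prime p} ->
  (#|[set t : {ffun 'I_m -> 'I_(size P)} | \prod_i tnth (in_tuple P) (t i) == n]| <= m ^ m)%N.
Proof.
move=> uP Pp; set A := finset _.
case: (set_0Vmem A) => [->|[t0 t0A]]; first by rewrite cards0.
pose C := [set t0 i | i : 'I_m].
have AC : A \subset [set t : {ffun 'I_m -> 'I_(size P)} | t \in ffun_on (mem C)].
  apply/fintype.subsetP => t; rewrite !inE in t0A *; move=> /eqP tn; apply/ffun_onP => i.
  have pi : prime (tnth (in_tuple P) (t i)) by apply/Pp/mem_tnth.
  have : (tnth (in_tuple P) (t i) %| \prod_i tnth (in_tuple P) (t0 i))%N.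
    by rewrite (eqP t0A) -tn (bigD1 i) //= dvdn_mulr.
  rewrite Euclid_dvd_prod // big_orE => /existsP[j /= pj].
  have pj' : prime (tnth (in_tuple P) (t0 j)) by apply/Pp/mem_tnth.
  rewrite dvdn_prime2 // in pj.
  have -> : t i = t0 j by apply/(tuple_uniqP (in_tuple P))/eqP.
  by apply/imsetP; exists j.
have CM : (#|C| <= m)%N by rewrite -[leqRHS]card_ord; apply: leq_imset_card.
apply: leq_trans (subset_leq_card AC) _; rewrite cardsE card_ffun_on card_ord.
by case: (m) CM => // k; rewrite leq_exp2r.
Qed.

Section LargeSieve.
Variables (D Z m : nat) (P E : seq nat).
Hypotheses (Pprime : {in P, forall p, prime p}) (PZ : {in P, forall p, (p <= Z)%N}).
Hypotheses (Euniq : uniq E) (Puniq : uniq P) (Esq : {in E, forall d, pos_squarefree d}).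
Hypotheses (ED : {in E, forall d, (d <= D)%N}).
Let S (d : nat) : int := \sum_(p <- P) chi d p.
Let b (n : nat) : int := (\sum_(d <- E) chi d n) ^+ 2.
Let prodt (t : {ffun 'I_m -> 'I_(size P)}) : nat := (\prod_i tnth (in_tuple P) (t i))%N.

(** Opening the square, each diagonal term costs at most [N], and each off-diagonal pair at most 8
    D^2 whatever [N] is. *)
Lemma dual_bound N :
  \sum_(0 <= n < N) b n <= (size E * N + size E ^ 2 * (8 * D * D))%N%:Z.
Proof.
rewrite /b (eq_bigr (fun n => \sum_(d <- E) \sum_(e <- E) chi d n * chi e n)); last first.
  by move=> n _; rewrite expr2 mulr_suml; apply: eq_bigr => d _; rewrite mulr_sumr.
rewrite exchange_big /=; under eq_bigr do rewrite exchange_big /=.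
have le1 d n : chi d n * chi d n <= 1.
  by have := chi_values d n; rewrite !inE => /or3P[] /eqP->.
apply: (@le_trans _ _ (\sum_(d <- E) (N%:Z + \sum_(e <- E) (8 * D * D)%N%:Z))); last first.
  rewrite big_split /= !big_const_seq !count_predT !iter_addr_0 !Posz_mulrn -PoszD lez_nat.
  by rewrite (_ : (N * _ + _)%N = (size E * N + size E ^ 2 * (8 * D * D))%N) //; ring.
rewrite big_seq [leRHS]big_seq; apply: ler_sum => d dE.
rewrite (bigD1_seq d) //=; apply: lerD.
  apply: le_trans (ler_sum _ (fun n _ => le1 d n)) _.
  by rewrite sumr_const_nat subn0 natz.
rewrite [leRHS](bigD1_seq d) //= -[leLHS]add0r; apply: lerD => //.
rewrite big_seq_cond [leRHS]big_seq_cond; apply: ler_sum => e /andP[eE ed].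
rewrite eq_sym in ed; apply: le_trans (chi_pair_sum N (Esq dE) (Esq eE) ed) _.
by rewrite lez_nat !leq_mul // ED.
Qed.

Lemma S_expm d : S d ^+ m = \sum_t chi d (prodt t).
Proof.
have chi1 : chi d 1 = 1.
  rewrite /chi /chi4 /= mul1r big1_seq // => q; rewrite andTb mem_primes => /and3P[pq _ _].
  by rewrite /chiq; case: eqP => // _; rewrite legendre1 mul1r.
rewrite /S big_tnth -[in LHS](card_ord m) -prodr_const bigA_distr_bigA /=.
apply: eq_bigr => t _.
by rewrite /prodt (big_morph (chi d) (chiM d) chi1).
Qed.

(** As [b] is a square, the sum may be extended from products of [m] primes of [P] to all integers
    up to Z^m; unique factorisation bounds how often one integer is hit. *)
Lemma tuples_sum : \sum_t b (prodt t) <= (m ^ m)%N%:Z * \sum_(0 <= n < (Z ^ m).+1) b n.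
Proof.
rewrite big_mkord mulr_sumr.
have pZ t : (prodt t < (Z ^ m).+1)%N.
  rewrite ltnS /prodt -[X in (_ <= Z ^ X)%N](card_ord m) -prod_nat_const.
  by apply: leq_prod => i _; apply/PZ/mem_tnth.
rewrite (partition_big (fun t => inord (prodt t) : 'I_(Z ^ m).+1) predT) //=.
apply: ler_sum => n _.
rewrite (eq_bigr (fun=> b n)); last by move=> t /eqP <-; rewrite inordK.
rewrite sumr_const -mulr_natl; apply: ler_wpM2r; first exact: sqr_ge0.
rewrite natz lez_nat; apply: leq_trans (prime_tuples_le m n Puniq Pprime).
rewrite -cardsE; apply/subset_leq_card/fintype.subsetP => t; rewrite !inE => /eqP <-.
by rewrite /= inordK.
Qed.

(** Duality: [S d ^+ m] is a sum over [m]-tuples of primes, and Cauchy-Schwarz over the tuples moves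
    the square onto the sum over d. An even [m] makes the power blind to the sign of [S d]. The
    factor 4^m is the square of the 2^m lost in the hypothesis on [S d], and m^m is the multiplicity
    of a product. *)
Lemma large_sieve : (0 < size P)%N -> ~~ odd m ->
  {in E, forall d, (size P)%:Z <= 2 * `|S d|} ->
  (size E * size P ^ m <= (4 * m) ^ m * ((Z ^ m).+1 + size E * (8 * D * D)))%N.
Proof.
move=> P0 em HS; case: (posnP (size E)) => [->|E0]; first by rewrite !mul0n.
have Sge d : d \in E -> (size P)%:Z ^+ m <= 2 ^+ m * S d ^+ m.
  move=> /HS h; have -> : S d ^+ m = `|S d| ^+ m.
    by rewrite -normrX ger0_norm //; apply: exprn_even_ge0.
  by rewrite -exprMn lerXn2r ?nnegrE // mulr_ge0.
have lower : (size E)%:Z * (size P)%:Z ^+ m <= 2 ^+ m * \sum_(d <- E) S d ^+ m.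
  rewrite mulr_sumr; apply: le_trans (_ : \sum_(d <- E) (size P)%:Z ^+ m <= _).
    by rewrite big_const_seq count_predT iter_addr_0 -Posz_expn Posz_mulrn PoszM mulrC.
  by rewrite big_seq [leRHS]big_seq; apply: ler_sum => d; apply: Sge.
have CS : (\sum_(d <- E) S d ^+ m) ^+ 2 <= (size P)%:Z ^+ m * \sum_t b (prodt t).
  rewrite (eq_bigr (fun d => \sum_t chi d (prodt t))); last by move=> d _; rewrite S_expm.
  rewrite exchange_big /=; apply: le_trans (sum_sqr_le _) _.
  by rewrite card_ffun !card_ord natz Posz_expn.
have up : (\sum_(d <- E) S d ^+ m) ^+ 2 <=
    (size P)%:Z ^+ m * ((m ^ m)%N%:Z * (size E * (Z ^ m).+1 + size E ^ 2 * (8 * D * D))%N%:Z).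
  apply: le_trans CS _; apply: ler_wpM2l; first by rewrite exprn_ge0.
  by apply: le_trans tuples_sum _; apply: ler_wpM2l (dual_bound _).
have fin : ((size E)%:Z * (size P)%:Z ^+ m) ^+ 2 <= (2 ^+ m) ^+ 2 *
    ((size P)%:Z ^+ m * ((m ^ m)%N%:Z * (size E * (Z ^ m).+1 + size E ^ 2 * (8 * D * D))%N%:Z)).
  apply: le_trans (_ : (2 ^+ m * \sum_(d <- E) S d ^+ m) ^+ 2 <= _); last first.
    by rewrite exprMn; apply: ler_wpM2l; rewrite ?sqr_ge0.
  have l0 : 0 <= (size E)%:Z * (size P)%:Z ^+ m by rewrite mulr_ge0 ?exprn_ge0.
  by apply: lerXn2r; rewrite ?nnegrE // (le_trans l0 lower).
rewrite -lez_nat.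
(* Both sides of [fin] contain the factor |E| |P|^m, so one copy of it is cancelled from the
   square. *)
have P0' : 0 < (size E)%:Z * (size P)%:Z ^+ m by rewrite mulr_gt0 ?exprn_gt0.
rewrite -(ler_pM2l P0'); apply: le_trans (le_trans fin _).
  by rewrite expr2 PoszM Posz_expn.
rewrite le_eqVlt; apply/orP; left; apply/eqP.
have e4 : (2 ^+ m) ^+ 2 = 4 ^+ m :> int by rewrite exprAC.
rewrite e4 [in RHS]PoszM; have -> : ((4 * m) ^ m)%N%:Z = 4 ^+ m * (m ^ m)%N%:Z by rewrite expnMn PoszM Posz_expn.
have -> : (size E * (Z ^ m).+1 + size E ^ 2 * (8 * D * D))%N%:Z =
   (size E)%:Z * ((Z ^ m).+1 + size E * (8 * D * D))%N%:Z.
  by rewrite -PoszM; congr Posz; ring.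
ring.
Qed.
End LargeSieve.

(** * The divisor bound and Chebyshev's lower bound *)

Definition tau (n : nat) : nat := size (divisors n).

Lemma tau_prime_power_mul p a m : prime p -> ~~ (p %| m)%N -> (0 < m)%N ->
  (tau (p ^ a * m) <= a.+1 * tau m)%N.
Proof.
move=> pp pm m0; pose s := [seq (p ^ i * e)%N | i <- iota 0 a.+1, e <- divisors m].
have -> : (a.+1 * tau m = size s)%N by rewrite size_allpairs size_iota.
apply: uniq_leq_size; first exact: divisors_uniq.
have n0 : (0 < p ^ a * m)%N by rewrite muln_gt0 expn_gt0 prime_gt0.
move=> d; rewrite -dvdn_divisors // => dv; have d0 := dvdn_gt0 n0 dv.
have [e pe de] := pfactor_coprime pp d0.
apply/allpairsP; exists (logn p d, e) => /=; split.
- rewrite -[_ :: _]/(iota 0 a.+1) mem_iota /= add0n ltnS.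
  have pa : (0 < p ^ a)%N by rewrite expn_gt0 prime_gt0.
  have := dvdn_leq_log p n0 dv; rewrite (lognM p pa m0) pfactorK // (lognE p m) (negPf pm).
  by rewrite !andbF addn0.
- rewrite -dvdn_divisors //.
  have : (e %| p ^ a * m)%N by apply: dvdn_trans dv; rewrite de dvdn_mulr.
  by rewrite Gauss_dvdr // coprime_sym coprimeXl.
- by rewrite mulnC.
Qed.

Section R.
Variable R : realType.
Implicit Types (e x y : R).

Lemma ln_le_powR e x : 0 < e -> 0 < x -> ln x <= e^-1 * x `^ e.
Proof.
move=> e0 x0; rewrite mulrC ler_pdivlMr // mulrC.
apply: le_trans (_ : 1 + e * ln x <= _); first by rewrite lerDr.
rewrite /powR gt_eqF //; exact: expR_ge1Dx.
Qed.

(** A prime power j^a contributes a + 1 to tau. This is at most K j^(a e) for every j >= 2, and at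
    most j^(a e) once j^e >= 2, so only the boundedly many primes below a fixed B cost a factor
    K. *)
Lemma tau_le e : 0 < e -> exists2 C : R, 0 < C &
  forall n, (0 < n)%N -> (tau n)%:R <= C * n%:R `^ e.
Proof.
move=> e0; have l2 : 0 < ln (2 : R) by rewrite ln_gt0 // ltr1n.
(* Chosen so that a + 1 <= K (1 + a e ln 2) <= K 2^(a e). *)
pose K := 1 + (e * ln 2)^-1; have el : 0 < e * ln 2 by rewrite mulr_gt0.
have K1 : 1 <= K by rewrite lerDl invr_ge0 ltW.
have K0 : 0 < K by apply: lt_le_trans K1.
have HK (a j : nat) : (2 <= j)%N -> a.+1%:R <= K * (j ^ a)%N%:R `^ e.
  move=> j2; apply: le_trans (_ : K * (1 + e * ln 2 * a%:R) <= _).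
    rewrite /K mulrDl mul1r mulrDr mulr1 mulrA mulVf ?gt_eqF // mul1r -natr1.
    have : 0 <= e * ln 2 * a%:R by rewrite mulr_ge0 // ltW.
    have : 0 <= (e * ln (2 : R))^-1 by rewrite invr_ge0 ltW.
    lra.
  rewrite ler_pM2l //; apply: le_trans (_ : (2 ^ a)%N%:R `^ e <= _); last first.
    apply: ge0_ler_powR; rewrite ?nnegrE ?ler0n ?(ltW e0) //.
    by rewrite ler_nat; case: (a) => // a'; rewrite leq_exp2r.
  rewrite natrX -powR_mulrn ?ler0n // -powRrM /powR pnatr_eq0 /=.
  apply: le_trans (expR_ge1Dx _); rewrite lerD2l le_eqVlt; apply/orP; left; apply/eqP; ring.
have [B HB] : exists B : nat, forall j : nat, (B <= j)%N -> 2 <= j%:R `^ e.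
  exists (Num.truncn (2 `^ e^-1 : R)).+1 => j Bj.
  have -> : 2 = (2 `^ e^-1) `^ e :> R by rewrite -powRrM mulVf ?gt_eqF // powRr1.
  apply: ge0_ler_powR; rewrite ?nnegrE ?powR_ge0 ?(ltW e0) //.
  by apply: ltW; apply: lt_le_trans (truncnS_gt _) _; rewrite ler_nat.
exists (K ^+ B); first exact: exprn_gt0.
(* Induction on a strict bound [j] for the prime factors of [n]; [minn j B] bounds the number of
   primes that may have cost a factor [K] so far. *)
suff H j n : (0 < n)%N -> (forall p, prime p -> (p %| n)%N -> (p < j)%N) ->
    (tau n)%:R <= K ^+ (minn j B) * n%:R `^ e.
  move=> n n0; apply: le_trans (H n.+1 n n0 _) _.
    by move=> p _ /dvdn_leq; rewrite ltnS; apply.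
  by rewrite ler_wpM2r ?powR_ge0 // ler_weXn2l // geq_minr.
elim: j n => [|j IH] n n0 Hn.
  have n1 : n = 1%N.
    by apply/eqP; rewrite eqn_leq n0 andbT leqNgt; apply/negP => /pdivP[p pp /(Hn p pp)].
  by rewrite n1 min0n expr0 mul1r powR1.
case pj : (prime j && (j %| n)%N); last first.
  apply: le_trans (IH n n0 _) _.
    move=> p pp pn; have := Hn p pp pn; rewrite ltnS leq_eqVlt => /orP[/eqP pj'|//].
    by rewrite -pj' pp pn in pj.
  rewrite ler_wpM2r ?powR_ge0 // ler_weXn2l // leq_min geq_minr andbT.
  by apply: leq_trans (geq_minl _ _) _.
case/andP: pj => pj jn; have [m cm nE] := pfactor_coprime pj n0.
set a := logn j n in nE; have m0 : (0 < m)%N by move: n0; rewrite nE muln_gt0 => /andP[].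
have jm : ~~ (j %| m)%N by rewrite -prime_coprime.
have := tau_prime_power_mul a pj jm m0; rewrite mulnC -nE -(ler_nat R) natrM => tn.
apply: le_trans tn _.
have {}IH : (tau m)%:R <= K ^+ minn j B * m%:R `^ e.
  apply: IH => // p pp pm; have := Hn p pp; rewrite ltnS leq_eqVlt nE dvdn_mulr //.
  by move=> /(_ isT) /orP[/eqP pj'|//]; rewrite pj' (negPf jm) in pm.
have -> : n%:R `^ e = m%:R `^ e * (j ^ a)%N%:R `^ e :> R by rewrite nE natrM powRM.
case: (ltnP j B) => jB.
  have -> : minn j.+1 B = (minn j B).+1 by rewrite !(minn_idPl _) // ltnW.
  have -> : K ^+ (minn j B).+1 * (m%:R `^ e * (j ^ a)%N%:R `^ e) =
     K * (j ^ a)%N%:R `^ e * (K ^+ minn j B * m%:R `^ e) by rewrite exprS; ring.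
  by apply: ler_pM; rewrite ?ler0n // HK // prime_gt1.
have -> : minn j.+1 B = minn j B by rewrite !(minn_idPr _) // ltnW.
rewrite mulrA mulrC; apply: ler_pM => //; rewrite ?ler0n //.
apply: le_trans (_ : 2 ^+ a <= _).
  by rewrite -natrX ler_nat ltn_expl.
rewrite natrX -powR_mulrn ?ler0n // -powRrM mulrC powRrM powR_mulrn ?powR_ge0 //.
by apply: lerXn2r; rewrite ?nnegrE ?powR_ge0 // HB.
Qed.
End R.

Lemma central_bin_ge n : (2 ^ n <= 'C(n + n, n))%N.
Proof.
elim: n => // n IH; rewrite addSn addnS binS.
have -> : 'C((n + n).+1, n.+1) = 'C((n + n).+1, n).
  by rewrite -bin_sub ?ltnS ?leq_addr // subSS addKn.
have : ('C(n + n, n) <= 'C((n + n).+1, n))%N.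
  by case: (n) => // k; rewrite [leqRHS]binS leq_addr.
rewrite expnS; lia.
Qed.

(** By Legendre's formula the exponent of [p] is the sum over k of floor(2n / p^k) - 2 floor(n /
    p^k); each term is 0 or 1, and it vanishes once p^k > 2n. *)
Lemma central_bin_pfactor p n : prime p -> (0 < n)%N -> (p ^ logn p 'C(n + n, n) <= n + n)%N.
Proof.
move=> pp n0; have n20 : (0 < n + n)%N by rewrite addn_gt0 n0.
have p1 := prime_gt1 pp.
suff le : (logn p 'C(n + n, n) <= trunc_log p (n + n))%N.
  by apply: leq_trans (trunc_logP p1 n20); rewrite leq_exp2l.
have f0 k : (0 < k`!)%N := fact_gt0 k.
have b0 : (0 < 'C(n + n, n))%N by rewrite bin_gt0 leq_addr.
have : (logn p 'C(n + n, n) + (\sum_(1 <= k < (n + n).+1) (n %/ p ^ k + n %/ p ^ k)) =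
       \sum_(1 <= k < (n + n).+1) ((n + n) %/ p ^ k))%N.
  rewrite -logn_fact // -(bin_fact (leq_addr n n)) addKn lognM ?muln_gt0 ?f0 // lognM //.
  congr (_ + _)%N; rewrite big_split /= logn_fact //.
  have -> : (\sum_(1 <= k < (n + n).+1) n %/ p ^ k = \sum_(1 <= k < n.+1) n %/ p ^ k)%N.
    rewrite (@big_cat_nat _ _ _ n.+1) //= ?ltnS ?leq_addr //.
    rewrite [X in (_ + X)%N]big1_seq ?addn0 // => k; rewrite mem_index_iota => /andP[_ /andP[nk _]].
    by rewrite divn_small // (leq_trans nk) // ltnW // ltn_expl.
  by [].
set A := (\sum_(1 <= k < _) _)%N; set B := (\sum_(1 <= k < _) _)%N => AB.
suff : (B <= A + trunc_log p (n + n))%N by lia.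
set t := trunc_log p (n + n).
have tn : (t <= n + n)%N.
  by apply: ltnW; apply: leq_trans (trunc_logP p1 n20); rewrite ltn_expl.
rewrite -(sum_leq_count tn) /A /B -big_split /=.
rewrite !big_seq; apply: leq_sum => k; rewrite mem_index_iota => /andP[k1 kn].
case: (leqP k t) => kt.
  have pk : (0 < p ^ k)%N by rewrite expn_gt0 prime_gt0.
  by rewrite divnD //= leq_add2l leq_b1.
by rewrite divn_small // ltnNge; apply: contraL kt => /(trunc_log_max p1); rewrite -leqNgt.
Qed.

Definition odd_primes (Z : nat) : seq nat := [seq p <- iota 0 Z.+1 | prime p && odd p].

Lemma odd_primesP Z p : (p \in odd_primes Z) = [&& prime p, odd p & (p <= Z)%N].
Proof. by rewrite mem_filter mem_iota /= add0n ltnS andbA. Qed.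

Lemma odd_primes_uniq Z : uniq (odd_primes Z).
Proof. by rewrite filter_uniq ?iota_uniq. Qed.

(** Chebyshev's argument: the primes dividing the central binomial coefficient are at most 2n and
    each contributes at most 2n. The extra 1 in the exponent stands for the prime 2. *)
Lemma pow2_le_primes n : (0 < n)%N -> (2 ^ n <= (n + n) ^ (size (odd_primes (n + n))).+1)%N.
Proof.
move=> n0; apply: leq_trans (central_bin_ge n) _.
have b0 : (0 < 'C(n + n, n))%N by rewrite bin_gt0 leq_addr.
have n2 : (0 < n + n)%N by rewrite addn_gt0 n0.
set C := 'C(n + n, n) in b0 *.
rewrite {1}(prod_prime_decomp b0) prime_decompE big_map /=.
apply: (@leq_trans (\prod_(p <- primes C) (n + n))).
  rewrite big_seq [leqRHS]big_seq; apply: leq_prod => p; rewrite mem_primes => /and3P[pp _ _].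
  exact: central_bin_pfactor.
rewrite big_const_seq count_predT iter_muln_1 leq_pexp2l // -[leqRHS]/(size (2%N :: odd_primes (n + n))).
apply: uniq_leq_size; first exact: primes_uniq.
move=> p; rewrite mem_primes inE odd_primesP => /and3P[pp _ pC]; rewrite pp /=.
case: (even_prime pp) => [->//|op]; rewrite op /= orbC.
suff -> : (p <= n + n)%N by [].
rewrite leqNgt; apply/negP => np; have : (p %| (n + n)`!)%N.
  by rewrite -(bin_fact (leq_addr n n)) dvdn_mulr.
move=> pf; have : (0 < logn p (n + n)`!)%N by rewrite logn_gt0 mem_primes pp fact_gt0.
rewrite logn_fact // big1_seq // => k; rewrite mem_index_iota => /andP[_ /andP[k1 _]].
by rewrite divn_small // (leq_trans np) // -{1}(expn1 p) leq_pexp2l // prime_gt0.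
Qed.

Lemma odd_primes_ge (R : realType) (e : R) : 0 < e -> exists2 C : R, 0 < C &
  forall Z, (3 <= Z)%N -> Z%:R <= C * (size (odd_primes Z))%:R * Z%:R `^ e.
Proof.
move=> e0; have l2 : 0 < ln (2 : R) by rewrite ln_gt0 // ltr1n.
exists (6 / (e * ln 2)); first by rewrite divr_gt0 // mulr_gt0.
move=> Z Z3; set n := (Z./2)%N; have n0 : (0 < n)%N by rewrite /n; lia.
have Zn : (n + n <= Z)%N by rewrite /n; lia.
have Z3n : (Z <= 3 * n)%N by rewrite /n; lia.
set P := size (odd_primes Z).
(* With Z >= 3 the prime 3 is counted, so P + 1 <= 2 P; this 2 and the 3 of Z <= 3 n make the 6 in
   the constant. *)
have P0 : (0 < P)%N.
  have : 3%N \in odd_primes Z by rewrite odd_primesP.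
  by rewrite /P; case: (odd_primes Z).
have le : (size (odd_primes (n + n)) <= P)%N.
  apply: uniq_leq_size; first exact: odd_primes_uniq.
  by move=> p; rewrite !odd_primesP => /and3P[-> -> /leq_trans]; apply.
have := pow2_le_primes n0; rewrite -(ler_nat R) !natrX => H.
have {}H : n%:R * ln 2 <= (P + P)%N%:R * ln (Z%:R : R).
  have : ln ((2 : R) ^+ n) <= ln (((n + n)%N%:R : R) ^+ (size (odd_primes (n + n))).+1).
    by rewrite ler_ln ?posrE ?exprn_gt0 ?ltr0n ?addn_gt0 ?n0.
  rewrite !lnXn ?ltr0n ?addn_gt0 ?n0 // -[ln 2 *+ _]mulr_natl -[X in _ <= X -> _]mulr_natl => /le_trans.
  apply; apply: ler_pM; rewrite ?ler0n ?ln_ge0 ?ler1n ?addn_gt0 ?n0 //.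
    by rewrite ler_nat; lia.
  by rewrite ler_ln ?posrE ?ltr0n ?addn_gt0 ?n0 ?ler_nat //; lia.
have Z0 : 0 < (Z%:R : R) by rewrite ltr0n; lia.
have lz := ln_le_powR e0 Z0.
apply: (@le_trans _ _ (3 * n%:R)); first by rewrite -natrM ler_nat.
have -> : 6 / (e * ln 2) * P%:R * Z%:R `^ e = 3 * (((P + P)%N%:R * (e^-1 * Z%:R `^ e)) / ln 2).
  by rewrite natrD invfM; ring.
rewrite ler_pM2l // ler_pdivlMr //; apply: le_trans H _.
by rewrite ler_wpM2l.
Qed.

(** * Counting representations x^2 + d y^2 = 4n *)

Lemma spaced_count (A : seq nat) (a L M : nat) : uniq A -> (0 < M)%N ->
  {in A, forall x, (a <= x <= a + L)%N} ->
  {in A &, forall x y, x = y %[mod M]} -> (size A <= L %/ M + 1)%N.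
Proof.
move=> uA M0 Aa AM; pose f x := ((x - a) %/ M)%N.
have f_inj : {in A &, injective f}.
  move=> x y xA yA; rewrite /f => e.
  have /andP[ax _] := Aa x xA; have /andP[ay _] := Aa y yA.
  have em : (x - a = y - a %[mod M])%N.
    by apply/eqP; rewrite -(eqn_modDr a) !subnK //; apply/eqP/AM.
  have : (x - a = y - a)%N by rewrite (divn_eq (x - a) M) (divn_eq (y - a) M) e em.
  by move: ax ay; clear; lia.
rewrite -(size_map f) -[leqRHS](size_iota 0); apply: uniq_leq_size.
  by rewrite map_inj_in_uniq.
move=> _ /mapP[x xA ->]; rewrite mem_iota /= add0n addn1 ltnS.
by apply: leq_div2r; have := Aa x xA; clear; lia.
Qed.

(* If y^2 divides x^2 - 4n and x0^2 - 4n, then e = gcd(x - x0, y^2) determines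
   x modulo y^2 / gcd(e, y^2 / e), and that gcd divides 4 as y is prime to n. *)
Lemma square_roots_count (A : seq nat) (n y a L : nat) : uniq A -> (0 < y)%N -> coprime y n ->
  {in A, forall x, (x ^ 2 = 4 * n %[mod y ^ 2])%N} ->
  {in A, forall x, (a <= x <= a + L)%N} ->
  (size A <= tau (y ^ 2) * ((4 * L) %/ y ^ 2 + 1))%N.
Proof.
move=> uA y0 yn Ax AL; case: A uA Ax AL => // a0 A'; set A := a0 :: A' => uA Ax AL.
have [x0 x0A x0min] : exists2 x0, x0 \in A & {in A, forall x, (x0 <= x)%N}.
  have exP : exists x, x \in A by exists a0; rewrite inE eqxx.
  by case: (ex_minnP exP) => x0 x0A H; exists x0 => // x /H.
have y20 : (0 < y ^ 2)%N by rewrite expn_gt0 y0.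
pose e x := gcdn (x - x0) (y ^ 2).
have eD x : e x \in divisors (y ^ 2) by rewrite -dvdn_divisors // dvdn_gcdr.
have -> : size A = (\sum_(k <- divisors (y ^ 2)) count (fun x => e x == k) A)%N.
  rewrite -sum1_size; under [RHS]eq_bigr do rewrite -sum1_count big_mkcond /=.
  rewrite exchange_big /=; apply: eq_bigr => x _.
  rewrite (bigD1_seq (e x)) ?divisors_uniq //= eqxx big1 // => k.
  by rewrite eq_sym => /negPf ->.
apply: (@leq_trans (\sum_(k <- divisors (y ^ 2)) ((4 * L) %/ y ^ 2 + 1))%N); last first.
  by rewrite big_const_seq count_predT iter_addn_0 mulnC.
rewrite big_seq [leqRHS]big_seq; apply: leq_sum => k; rewrite -dvdn_divisors // => ky.
pose k' := (y ^ 2 %/ k)%N; have kk' : (k * k' = y ^ 2)%N by rewrite mulnC divnK.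
have k0 : (0 < k)%N by apply: dvdn_gt0 ky.
have k'0 : (0 < k')%N by have := y20; rewrite -kk' muln_gt0 => /andP[].
have sub x : x \in A -> e x = k -> (k %| x - x0)%N /\ (k' %| x + x0)%N.
  move=> xA ek; have le := x0min x xA.
  have kx : (k %| x - x0)%N by rewrite -ek dvdn_gcdl.
  split=> //; have : (y ^ 2 %| (x - x0) * (x + x0))%N.
    by rewrite -subn_sqr -eqn_mod_dvd ?leq_sqr //; apply/eqP; rewrite !Ax.
  rewrite -kk' -(divnK kx) mulnAC mulnC dvdn_pmul2r // Gauss_dvdr //.
  have := congr1 (fun z => z %/ k)%N ek; rewrite divnn k0 /= => /esym/esym.
  rewrite /e -kk' (mulnC k) -{1}(divnK kx) -muln_gcdl mulnK // => h.
  by rewrite /coprime gcdnC h.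
set F := [seq x <- A | e x == k]; rewrite -size_filter -/F.
have FP x : x \in F -> x \in A /\ e x = k by rewrite mem_filter => /andP[/eqP].
case: (posnP (size F)) => [->//|F0].
have [x1 x1F] : exists x1, x1 \in F by case: (F) F0 => // x1 F' _; exists x1; rewrite inE eqxx.
have [x1A x1k] := FP x1 x1F; have [kx1 k'x1] := sub x1 x1A x1k.
have f4 : (gcdn k k' %| 4)%N.
  set f := gcdn k k'; have fk : (f %| k)%N := dvdn_gcdl _ _; have fk' : (f %| k')%N := dvdn_gcdr _ _.
  have f2y : (f ^ 2 %| y ^ 2)%N by rewrite -kk' expnS expn1 dvdn_mul.
  have fy : (f %| y)%N by rewrite -(dvdn_pexp2r _ _ (isT : (0 < 2)%N)).
  have f2x : (f %| 2 * x0)%N.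
    have : (f %| (x1 + x0) - (x1 - x0))%N.
      by apply: dvdn_sub; [apply: dvdn_trans fk' k'x1|apply: dvdn_trans fk kx1].
    have -> : ((x1 + x0) - (x1 - x0) = 2 * x0)%N by have := x0min x1 x1A; clear; lia.
    by [].
  have f16 : (f ^ 2 %| 16 * n)%N.
    have : (f ^ 2 %| 4 * x0 ^ 2)%N by rewrite -[4%N]/(2 ^ 2)%N -expnMn dvdn_exp2r.
    have h : (x0 ^ 2 = 4 * n %[mod f ^ 2])%N.
      by rewrite -(modn_dvdm (x0 ^ 2) f2y) Ax // modn_dvdm.
    by rewrite /dvdn -modnMmr h modnMmr mulnA.
  have cfn : coprime (f ^ 2) n by rewrite coprimeXl // (coprime_dvdl fy).
  by rewrite -(dvdn_pexp2r _ _ (isT : (0 < 2)%N)); rewrite Gauss_dvdl in f16.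
have uF : uniq F by rewrite filter_uniq.
have lcm0 : (0 < lcmn k k')%N by rewrite lcmn_gt0 k0.
have FL : {in F, forall x, (a <= x <= a + L)%N} by move=> x /FP[/AL].
have FM : {in F &, forall x x', x = x' %[mod lcmn k k']}.
  have W x x' : x \in F -> x' \in F -> (x <= x')%N -> x' = x %[mod lcmn k k'].
    move=> /FP[xA xk] /FP[x'A x'k] le; apply/eqP; rewrite eqn_mod_dvd // dvdn_lcm.
    have [h1 h2] := sub x xA xk; have [h1' h2'] := sub x' x'A x'k.
    have -> : (x' - x = (x' - x0) - (x - x0))%N by move: (x0min x xA) (x0min x' x'A); clear; lia.
    rewrite dvdn_sub //=.
    have -> : ((x' - x0) - (x - x0) = (x' + x0) - (x + x0))%N.
      by move: (x0min x xA) (x0min x' x'A); clear; lia.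
    by rewrite dvdn_sub.
  move=> x x' xF x'F; case: (leqP x x') => [le|/ltnW le]; last exact: W.
  by symmetry; apply: W.
apply: leq_trans (spaced_count uF lcm0 FL FM) _; rewrite leq_add2r.
have l4 : (y ^ 2 <= 4 * lcmn k k')%N.
  by rewrite -kk' -muln_lcm_gcd mulnC leq_mul2r (dvdn_leq _ f4) ?orbT.
rewrite leq_divRL // ; apply: (@leq_trans (L %/ lcmn k k' * (4 * lcmn k k'))%N).
  by rewrite leq_mul2l l4 orbT.
by rewrite mulnCA leq_mul2l /= leq_divM.
Qed.

(** For common [n] and [y], (x - x') (x + x') = (d' - d) y^2 is at most D y^2. If x^2 >= n, dividing
    by x >= sqrt(n) gives the claim; otherwise d y^2 > 3 n, so D y^2 >= n, and x - x' < sqrt(n)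
    suffices. *)
Lemma window_bound n D y d d' x x' : (D <= d < 2 * D)%N -> (D <= d' < 2 * D)%N ->
  (4 * n = x ^ 2 + d * y ^ 2)%N -> (4 * n = x' ^ 2 + d' * y ^ 2)%N -> (x' <= x)%N ->
  ((x - x') ^ 2 * n <= (D * y ^ 2) ^ 2)%N.
Proof.
move=> /andP[Dd dD] /andP[Dd' d'D] e e' le; set Y := (y ^ 2)%N in e e' *.
have [k xE] : exists k, x = (x' + k)%N by exists (x - x')%N; rewrite subnKC.
rewrite xE addKn; rewrite xE in e; clear xE le.
case: (leqP n ((x' + k) ^ 2)) => h.
  apply: (@leq_trans ((k * (x' + k)) ^ 2)%N); first by rewrite expnMn leq_mul2l h orbT.
  rewrite leq_sqr; apply: (@leq_trans (k * (x' + x' + k))%N); first by rewrite leq_mul2l; apply/orP; right; clear; lia.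
  have kk : (k * (x' + x' + k) + x' ^ 2 = (x' + k) ^ 2)%N by ring.
  have : (k * (x' + x' + k) + d * Y = d' * Y)%N by move: kk e e'; clear; lia.
  have : (d' * Y <= 2 * D * Y)%N by rewrite leq_mul2r (ltnW d'D) orbT.
  have : (D * Y <= d * Y)%N by rewrite leq_mul2r Dd orbT.
  clear; lia.
have h1 : (3 * n <= 2 * (D * Y))%N.
  have : (d * Y <= 2 * D * Y)%N by rewrite leq_mul2r (ltnW dD) orbT.
  by move: h e; clear; lia.
apply: (@leq_trans (n ^ 2)%N).
  rewrite [leqRHS]expnS expn1 leq_mul2r; apply/orP; right; apply: ltnW; apply: leq_ltn_trans h.
  by rewrite leq_sqr leq_addl.
by rewrite leq_sqr; move: h1; clear; lia.
Qed.

(** For each [y], [x] determines [d] and stays in a window of length D y^2 / sqrt(n); as x^2 is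
    fixed modulo y^2, at most T (4 D / sqrt(n) + 1) values of [x] remain. Since d y^2 <= 4 n,
    summing over 0 < y <= 2 sqrt(n / D) gives the bound. *)
Lemma rep_count (R : realType) (n D T : nat) (Es : seq nat) : (0 < D)%N -> (1 < n)%N ->
  uniq Es -> (forall y, (0 < y)%N -> (y ^ 2 <= 4 * n)%N -> (tau (y ^ 2) <= T)%N) ->
  {in Es, forall d, (D <= d < 2 * D)%N /\
     exists x y, (4 * n = x ^ 2 + d * y ^ 2)%N /\ coprime y n} ->
  (size Es)%:R <= T%:R * (8 * Num.sqrt D%:R + 2 * (Num.sqrt n%:R / Num.sqrt D%:R)) :> R.
Proof.
move=> D0 n1 uE HT HE; have n0 := ltnW n1.
pose W d (z : nat * nat) := (4 * n = z.1 ^ 2 + d * z.2 ^ 2)%N /\ coprime z.2 n.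
pose z d := xget (0, 0)%N (W d).
have zP d : d \in Es -> W d (z d).
  by move=> /HE[_ [x [y H]]]; apply: xgetPex; exists (x, y).
pose X d := (z d).1; pose Y d := (z d).2.
have Ypos d : d \in Es -> (0 < Y d)%N.
  move=> dE; have [_] := zP d dE; rewrite -/(Y d) lt0n; apply: contraTneq => ->.
  by rewrite /coprime gcd0n gtn_eqF.
set s := Num.sqrt (n%:R : R); set t := Num.sqrt (D%:R : R).
have s0 : 0 < s by rewrite sqrtr_gt0 ltr0n.
have t0 : 0 < t by rewrite sqrtr_gt0 ltr0n.
have s2 : s ^+ 2 = n%:R by rewrite sqr_sqrtr ?ler0n.
have t2 : t ^+ 2 = D%:R by rewrite sqr_sqrtr ?ler0n.
have st0 : 0 <= 2 * (s / t) by rewrite mulr_ge0 // divr_ge0 // ltW.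
pose Ymax := Num.truncn (2 * (s / t)).
have Yle d : d \in Es -> (Y d <= Ymax)%N.
  move=> dE; rewrite truncn_ge_nat // mulrA ler_pdivlMr //.
  have [e _] := zP d dE; have [/andP[Dd _] _] := HE d dE.
  have le : (D * Y d ^ 2 <= 4 * n)%N.
    by rewrite e (leq_trans _ (leq_addl _ _)) // leq_mul2r Dd orbT.
  rewrite -(@ler_pXn2r _ 2) ?nnegrE ?mulr_ge0 ?ler0n ?(ltW s0) ?(ltW t0) //.
  rewrite !exprMn s2 t2 -natrX -!natrM mulnC -[2 ^+ 2]/((2 : R) ^+ 2) -natrX -natrM ler_nat.
  exact: le.
have sizeE : size Es = (\sum_(y <- iota 1 Ymax) count (fun d => Y d == y) Es)%N.
  rewrite -sum1_size; under [RHS]eq_bigr do rewrite -sum1_count big_mkcond /=.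
  rewrite exchange_big /= big_seq [RHS]big_seq; apply: eq_bigr => d dE.
  rewrite (bigD1_seq (Y d)) ?iota_uniq ?mem_iota ?Ypos ?add1n ?ltnS ?Yle //= eqxx big1 // => k.
  by rewrite eq_sym => /negPf ->.
have main y : (0 < y)%N -> (count (fun d => Y d == y) Es)%:R <= T%:R * (4 * D%:R / s + 1) :> R.
  move=> y0; rewrite -size_filter; set F := [seq d <- Es | Y d == y].
  have FP d : d \in F -> d \in Es /\ Y d = y by rewrite mem_filter => /andP[/eqP].
  have FW d : d \in F -> (4 * n = X d ^ 2 + d * y ^ 2)%N.
    by move=> /FP[dE <-]; case: (zP d dE).
  case: (posnP (size F)) => [->|F0]; first by rewrite mulr_ge0 // addr_ge0 // divr_ge0 ?mulr_ge0 // ltW.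
  have [d1 d1F] : exists d1, d1 \in F by case: (F) F0 => // x1 F' _; exists x1; rewrite inE eqxx.
  have [d1E d1y] := FP d1 d1F.
  have yn : coprime y n by have [_] := zP d1 d1E; rewrite -/(Y d1) d1y.
  have y4n : (y ^ 2 <= 4 * n)%N.
    rewrite (FW d1 d1F) (leq_trans _ (leq_addl _ _)) // leq_pmull //.
    by have [/andP[+ _] _] := HE d1 d1E; apply: leq_trans.
  have y20 : (0 < y ^ 2)%N by rewrite expn_gt0 y0.
  pose A := map X F.
  have uA : uniq A.
    rewrite map_inj_in_uniq ?filter_uniq // => d d' dF d'F eX.
    have : (d * y ^ 2 = d' * y ^ 2)%N.
      by apply: (@addnI (X d ^ 2)%N); rewrite -(FW d dF) eX -(FW d' d'F).
    by move/eqP; rewrite eqn_pmul2r // => /eqP.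
  have AP x : x \in A -> exists2 d, (D <= d < 2 * D)%N & (4 * n = x ^ 2 + d * y ^ 2)%N.
    by move=> /mapP[d dF ->]; exists d; [case: (FP d dF) => /HE[]|apply: FW].
  have [a aA amin] : exists2 a, a \in A & {in A, forall x, (a <= x)%N}.
    have exP : exists x, x \in A by exists (X d1); apply: map_f.
    by case: (ex_minnP exP) => a aA H; exists a => // x /H.
  pose L := (\max_(x <- A) (x - a))%N.
  have AL : {in A, forall x, (a <= x <= a + L)%N}.
    move=> x xA; rewrite amin //= -leq_subLR /L.
    by apply: (@leq_bigmax_seq _ A xpredT (fun x => (x - a)%N)).
  have Ax : {in A, forall x, (x ^ 2 = 4 * n %[mod y ^ 2])%N}.
    by move=> x /AP[d _ ->]; rewrite addnC modnMDl.
  have L2 : (L ^ 2 * n <= (D * y ^ 2) ^ 2)%N.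
    rewrite /L big_seq; apply: (big_ind (fun L => L ^ 2 * n <= (D * y ^ 2) ^ 2)%N) => //.
      by move=> u v Hu Hv; case: (leqP u v).
    move=> x xA; have [d dD e] := AP x xA; have [d' d'D e'] := AP a aA.
    by apply: (window_bound dD d'D e e'); apply: amin.
  have Ls : L%:R * s <= D%:R * (y ^ 2)%N%:R.
    rewrite -(@ler_pXn2r _ 2) ?nnegrE ?mulr_ge0 ?ler0n ?(ltW s0) //.
    by rewrite !exprMn s2 -!natrX -!natrM -expnMn ler_nat.
  have szF : size F = size A by rewrite size_map.
  have := square_roots_count uA y0 yn Ax AL; rewrite -szF => cA.
  apply: (@le_trans _ _ (T * ((4 * L) %/ y ^ 2 + 1))%N%:R).
    by rewrite ler_nat (leq_trans cA) // leq_mul2r HT // orbT.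
  rewrite natrM ler_wpM2l // natrD lerD2r.
  rewrite ler_pdivlMr // -(@ler_pM2r _ (y ^ 2)%N%:R) ?ltr0n //.
  have h : ((4 * L) %/ y ^ 2)%N%:R * (y ^ 2)%N%:R <= 4 * L%:R :> R.
    by rewrite -!natrM ler_nat leq_divM.
  apply: (@le_trans _ _ (4 * L%:R * s)).
    by rewrite mulrAC ler_pM2r.
  by rewrite -!mulrA ler_pM2l.
rewrite sizeE natr_sum; apply: (@le_trans _ _ (\sum_(y <- iota 1 Ymax) T%:R * (4 * D%:R / s + 1))).
  rewrite big_seq [leRHS]big_seq; apply: ler_sum => y; rewrite mem_iota => /andP[y0 _].
  exact: main.
rewrite big_const_seq count_predT size_iota iter_addr_0 -[X in X <= _]mulr_natl.
have Ym : Ymax%:R <= 2 * (s / t) by rewrite truncn_le.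
apply: (@le_trans _ _ (2 * (s / t) * (T%:R * (4 * D%:R / s + 1)))).
  by rewrite ler_wpM2r // mulr_ge0 // addr_ge0 // divr_ge0 ?mulr_ge0 // ltW.
have sN : s != 0 by rewrite gt_eqF.
have tN : t != 0 by rewrite gt_eqF.
rewrite -t2 le_eqVlt; apply/orP; left; apply/eqP; field.
by rewrite sN tN.
Qed.

(** * Ideals of imaginary quadratic fields *)

Section Ideals.
Local Open Scope classical_set_scope.

Lemma ideal_mul_in (I J : set algC) x y : I x -> J y -> ideal_mul I J (x * y).
Proof.
move=> Ix Jy; exists [:: (x, y)]; last by rewrite big_seq1.
by move=> p; rewrite inE => /eqP->.
Qed.

Lemma ideal_mul0 (I J : set algC) : ideal_mul I J 0.
Proof. by exists [::]; rewrite ?big_nil. Qed.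

Lemma ideal_mulD (I J : set algC) x y :
  ideal_mul I J x -> ideal_mul I J y -> ideal_mul I J (x + y).
Proof.
move=> [s Hs ->] [t Ht ->]; exists (s ++ t); last by rewrite big_cat.
by move=> p; rewrite mem_cat => /orP[/Hs|/Ht].
Qed.

Lemma ideal_mul_sub (I J Y : set algC) : Y 0 ->
  (forall x y, Y x -> Y y -> Y (x + y)) -> (forall x y, I x -> J y -> Y (x * y)) ->
  ideal_mul I J `<=` Y.
Proof.
move=> Y0 YD YM x [s Hs ->]; elim: s Hs => [|p s IH] Hs; first by rewrite big_nil.
rewrite big_cons; apply: YD.
  by have [] := Hs p (mem_head _ _); apply: YM.
by apply: IH => q qs; apply: Hs; rewrite inE qs orbT.
Qed.

Lemma ideal_mulC (I J : set algC) : ideal_mul I J = ideal_mul J I.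
Proof.
suff S (A B : set algC) : ideal_mul A B `<=` ideal_mul B A by apply/seteqP; split.
apply: ideal_mul_sub => [|x y|x y Ax By]; [exact: ideal_mul0|exact: ideal_mulD|].
by rewrite mulrC; apply: ideal_mul_in.
Qed.

Lemma ideal_mulA (I J L : set algC) :
  ideal_mul I (ideal_mul J L) = ideal_mul (ideal_mul I J) L.
Proof.
have S (A B C : set algC) : ideal_mul (ideal_mul A B) C `<=` ideal_mul A (ideal_mul B C).
  apply: ideal_mul_sub => [|x y|x z ABx Cz]; [exact: ideal_mul0|exact: ideal_mulD|].
  suff : ideal_mul A B `<=` [set x | ideal_mul A (ideal_mul B C) (x * z)] by apply.
  apply: ideal_mul_sub => [|u v|u v Au Bv] /=; first by rewrite mul0r; apply: ideal_mul0.
    by rewrite mulrDl; apply: ideal_mulD.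
  by rewrite -mulrA; apply: ideal_mul_in => //; apply: ideal_mul_in.
apply/seteqP; split; last exact: S.
rewrite ideal_mulC (ideal_mulC J) (ideal_mulC _ L) (ideal_mulC I); exact: S.
Qed.

Lemma ideal_mul_mono (I J I' J' : set algC) : I `<=` I' -> J `<=` J' ->
  ideal_mul I J `<=` ideal_mul I' J'.
Proof.
move=> II' JJ'; apply: ideal_mul_sub => [|x y|x y Ix Jy]; [exact: ideal_mul0|exact: ideal_mulD|].
by apply: ideal_mul_in; [apply: II'|apply: JJ'].
Qed.

Lemma ideal_scale1 (I : set algC) : ideal_scale 1 I = I.
Proof.
apply/seteqP; split=> x; first by move=> [y Iy <-]; rewrite mul1r.
by move=> Ix; exists x; rewrite ?mul1r.
Qed.

Lemma ideal_scaleA a b (I : set algC) : ideal_scale a (ideal_scale b I) = ideal_scale (a * b) I.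
Proof.
apply/seteqP; split=> x.
  by move=> [y [z Iz <-] <-]; exists z; rewrite ?mulrA.
by move=> [z Iz <-]; exists (b * z); rewrite ?mulrA //; exists z.
Qed.

Lemma ideal_scale_mul a b (I J : set algC) :
  ideal_mul (ideal_scale a I) (ideal_scale b J) = ideal_scale (a * b) (ideal_mul I J).
Proof.
apply/seteqP; split.
  apply: ideal_mul_sub => [|x y [u Hu <-] [v Hv <-]|x y [u Iu <-] [v Jv <-]].
  - by exists 0; rewrite ?mulr0 //; apply: ideal_mul0.
  - by exists (u + v); rewrite ?mulrDr //; apply: ideal_mulD.
  - by exists (u * v); [apply: ideal_mul_in|ring].
suff S : ideal_mul I J `<=` [set x | ideal_mul (ideal_scale a I) (ideal_scale b J) (a * b * x)].
  by move=> _ [x /S Hx <-].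
apply: ideal_mul_sub => [|x y|x y Ix Jy] /=; first by rewrite mulr0; apply: ideal_mul0.
  by rewrite mulrDr; apply: ideal_mulD.
have -> : a * b * (x * y) = (a * x) * (b * y) by ring.
by apply: ideal_mul_in; [exists x|exists y].
Qed.

(** Conjugate ideals provide inverses up to scaling, both for arbitrary classes ([lat_mul_conj]) and
    for the primes above [p] ([pideal_norm]). *)
Definition ideal_conj (I : set algC) : set algC := [set x | I x^*].

Lemma ideal_conjK : involutive ideal_conj.
Proof. by move=> I; apply/seteqP; split=> x; rewrite /ideal_conj /= conjCK. Qed.

Lemma ideal_conj_mul (I J : set algC) :
  ideal_conj (ideal_mul I J) = ideal_mul (ideal_conj I) (ideal_conj J).
Proof.
have S (A B : set algC) : ideal_mul (ideal_conj A) (ideal_conj B) `<=` ideal_conj (ideal_mul A B).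
  apply: ideal_mul_sub => [|x y|x y] ; rewrite /ideal_conj /=.
  - by rewrite rmorph0; apply: ideal_mul0.
  - by rewrite rmorphD; apply: ideal_mulD.
  - by rewrite rmorphM; apply: ideal_mul_in.
apply/seteqP; split; last exact: S.
by move=> x; have := S (ideal_conj I) (ideal_conj J) x^*; rewrite !ideal_conjK /ideal_conj /= conjCK.
Qed.

Lemma class_mulC (C D : set (set algC)) : class_mul C D = class_mul D C.
Proof.
suff S (A B : set (set algC)) : class_mul A B `<=` class_mul B A by apply/seteqP; split.
by move=> _ [I AI [J BJ <-]]; exists J => //; exists I => //; rewrite ideal_mulC.
Qed.

Lemma class_mulA (B C D : set (set algC)) :
  class_mul B (class_mul C D) = class_mul (class_mul B C) D.
Proof.
apply/seteqP; split.
  move=> _ [I BI [_ [J CJ [L DL <-]] <-]]; exists (ideal_mul I J); first by exists I => //; exists J.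
  by exists L; rewrite ?ideal_mulA.
move=> _ [_ [I BI [J CJ <-]] [L DL <-]]; exists I => //; exists (ideal_mul J L).
  by exists J => //; exists L.
by rewrite ideal_mulA.
Qed.

Lemma ndvd_of_ndvd_sqrD p b d : ~~ (p %| d)%N -> (p %| b ^ 2 + d)%N -> ~~ (p %| b)%N.
Proof. by move=> pd pb; apply: contra pd => pb0; move: pb; rewrite dvdn_addr // dvdn_exp. Qed.

(** * Integers and fractional ideals of Q(sqrt(-d)) *)

Section Field.
Variable d : nat.
Hypothesis d_gt0 : (0 < d)%N.
Let w : algC := sqrtC (- d%:R).
Let K := imag_quad_field d.
Let O := ring_of_integers d.

Definition quad_elt (a b : rat) : algC := ratr a + ratr b * sqrtC (- d%:R).

Lemma w_sqr : w * w = - d%:R.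
Proof. by rewrite -expr2 sqrtCK. Qed.

Lemma w_neq0 : w != 0.
Proof. by rewrite sqrtC_eq0 oppr_eq0 pnatr_eq0 -lt0n. Qed.

Lemma w_conj : w^* = - w.
Proof.
have : (w^* - w) * (w^* + w) = 0.
  have e : w^* * w^* = w * w by rewrite -rmorphM w_sqr rmorphN rmorph_nat.
  by rewrite mulrDr !mulrBl e; ring.
move/eqP; rewrite mulf_eq0 => /orP[|]; last by rewrite addr_eq0 => /eqP.
rewrite subr_eq0 => /eqP wr.
have : 0 <= w * w by rewrite -{2}wr mul_conjC_ge0.
by rewrite w_sqr oppr_ge0 lt_geF // ltr0n.
Qed.

Lemma conj_elt a b : (quad_elt a b)^* = quad_elt a (- b).
Proof.
have -> : (quad_elt a b)^* = (ratr a)^* + (ratr b)^* * w^* by rewrite /quad_elt rmorphD; congr (_ + _); apply: rmorphM.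
by rewrite w_conj !conj_Crat ?Crat_rat // /quad_elt rmorphN mulrN mulNr.
Qed.

Lemma eltD a b a' b' : quad_elt a b + quad_elt a' b' = quad_elt (a + a') (b + b').
Proof. by rewrite /quad_elt !rmorphD /=; ring. Qed.

Lemma eltN a b : - quad_elt a b = quad_elt (- a) (- b).
Proof. by rewrite /quad_elt !rmorphN /=; ring. Qed.

Lemma eltM a b a' b' : quad_elt a b * quad_elt a' b' = quad_elt (a * a' - d%:R * b * b') (a * b' + a' * b).
Proof.
rewrite /quad_elt rmorphB rmorphD /= !rmorphM /= ratr_nat -/w.
transitivity (ratr a * ratr a' + ratr b * ratr b' * (w * w) + (ratr a * ratr b' + ratr a' * ratr b) * w).
  ring.
rewrite w_sqr; ring.
Qed.

Lemma elt_int (m : int) : m%:~R = quad_elt m%:~R 0.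
Proof. by rewrite /quad_elt ratr_int rmorph0 mul0r addr0. Qed.

Lemma elt_nat (m : nat) : m%:R = quad_elt m%:R 0.
Proof. by rewrite -[LHS]/(m%:~R) elt_int. Qed.

Lemma elt_w : w = quad_elt 0 1.
Proof. by rewrite /quad_elt rmorph0 rmorph1 add0r mul1r. Qed.

Lemma elt_rat (a : rat) : ratr a = quad_elt a 0.
Proof. by rewrite /quad_elt rmorph0 mul0r addr0. Qed.

Lemma elt_inj a b a' b' : quad_elt a b = quad_elt a' b' -> a = a' /\ b = b'.
Proof.
move=> e; have e' := congr1 Num.conj e; rewrite !conj_elt in e'.
have A : quad_elt (a - a') 0 = 0.
  have : quad_elt a b + quad_elt a (- b) = quad_elt a' b' + quad_elt a' (- b') by rewrite e e'.
  rewrite !eltD !subrr -!elt_rat => /(fmorph_inj (ratr : rat -> algC)) h.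
  have : (a - a') *+ 2 = 0 by rewrite mulrnBl !mulr2n h subrr.
  by move/eqP; rewrite mulrn_eq0 /= => /eqP ->; rewrite rmorph0.
have B : quad_elt 0 (b - b') = 0.
  by rewrite -[quad_elt _ _]addr0 -{1}A addrC; have := subrr (quad_elt a b); rewrite {2}e eltN eltD eltD addr0 add0r.
move: A; rewrite -elt_rat => /eqP; rewrite fmorph_eq0 subr_eq0 => /eqP ->.
move: B; rewrite /quad_elt rmorph0 add0r => /eqP; rewrite mulf_eq0 (negPf w_neq0) orbF fmorph_eq0.
by rewrite subr_eq0 => /eqP ->.
Qed.

Lemma imag_quad_fieldP x : K x <-> exists a b, x = quad_elt a b.
Proof. by []. Qed.

Lemma imag_quad_field_elt a b : K (quad_elt a b).
Proof. by exists a, b. Qed.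

Lemma norm_elt a b : quad_elt a b * (quad_elt a b)^* = ratr (a ^+ 2 + d%:R * b ^+ 2).
Proof. by rewrite conj_elt eltM elt_rat; congr quad_elt; ring. Qed.

Lemma elt_eq0 a b : (quad_elt a b == 0) = (a == 0) && (b == 0).
Proof.
apply/eqP/andP => [e|[/eqP-> /eqP->]]; last by rewrite /quad_elt !rmorph0 mul0r addr0.
have : quad_elt a b = quad_elt 0 0 by rewrite e /quad_elt !rmorph0 mul0r addr0.
by move=> /elt_inj[-> ->].
Qed.

Lemma imag_quad_field1 : K 1. Proof. by rewrite -[1]/(1%:R) elt_nat; apply: imag_quad_field_elt. Qed.

Lemma imag_quad_fieldD x y : K x -> K y -> K (x + y).
Proof. by move=> [a [b ->]] [a' [b' ->]]; rewrite eltD; apply: imag_quad_field_elt. Qed.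

Lemma imag_quad_fieldM x y : K x -> K y -> K (x * y).
Proof. by move=> [a [b ->]] [a' [b' ->]]; rewrite eltM; apply: imag_quad_field_elt. Qed.

Lemma imag_quad_field_conj x : K x -> K x^*.
Proof. by move=> [a [b ->]]; rewrite conj_elt; apply: imag_quad_field_elt. Qed.

Lemma imag_quad_fieldV x : K x -> K x^-1.
Proof.
move=> /imag_quad_fieldP[a [b ->]]; case: (eqVneq (quad_elt a b) 0) => [->|x0].
  by rewrite invr0 -[0]/(0%:R) elt_nat; apply: imag_quad_field_elt.
have c0 : (quad_elt a b)^* != 0 by rewrite conjC_eq0.
have -> : (quad_elt a b)^-1 = (quad_elt a b)^* * (quad_elt a b * (quad_elt a b)^*)^-1 by rewrite invfM; field; rewrite c0 x0.
apply: imag_quad_fieldM; first exact/imag_quad_field_conj/imag_quad_field_elt.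
rewrite norm_elt; set q := (_ + _ : rat).
have -> : (ratr q)^-1 = ratr q^-1 :> algC by rewrite fmorphV.
by rewrite elt_rat; apply: imag_quad_field_elt.
Qed.

Lemma Aint_rat a : (ratr a : algC) \in Aint -> exists m : int, a = m%:~R.
Proof.
move=> aA; have /intrP[m e] := Cint_rat_Aint (Crat_rat a) aA.
by exists m; apply: (fmorph_inj (ratr : rat -> algC)); rewrite /= ratr_int.
Qed.

Lemma Aint_conj x : (x^* \in Aint) = (x \in Aint).
Proof. exact: Aint_aut. Qed.

(** The element is a root of X^2 - s X + n, with [s] its trace and [n] its norm. *)
Lemma Aint_elt a b (s n : int) : 2 * a = s%:~R -> a ^+ 2 + d%:R * b ^+ 2 = n%:~R ->
  quad_elt a b \in Aint.
Proof.
move=> ea en; pose p : {poly algC} := 'X^2 - s%:~R *: 'X + (n%:~R)%:P.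
apply: (@root_monic_Aint p).
- rewrite /root /p !hornerE.
  have es : s%:~R = quad_elt a b + (quad_elt a b)^* by rewrite conj_elt eltD subrr -elt_rat -mulr2n -mulr_natl ea ratr_int.
  have en' : n%:~R = quad_elt a b * (quad_elt a b)^* by rewrite norm_elt en ratr_int.
  by apply/eqP; rewrite es en'; ring.
- rewrite monicE /lead_coef.
  have sp : size p = 3%N.
    rewrite /p -addrA size_polyDl ?size_polyXn // (leq_ltn_trans (size_polyD _ _)) //.
    rewrite gtn_max size_polyN (leq_ltn_trans (size_scale_leq _ _)) ?size_polyX //.
    by rewrite (leq_ltn_trans (size_polyC_leq1 _)).
  by rewrite sp /p /= !coefE /= mulr0 subr0 addr0.
- apply/polyOverP => i; rewrite /p !coefE rpredD ?rpredB ?rpredM ?rpred_nat ?rpred_int //.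
  by case: ifP => _; rewrite ?rpred_int ?rpred0.
Qed.

Lemma integers_elt a b : O (quad_elt a b) -> (exists s : int, 2 * a = s%:~R) /\
  (exists n : int, a ^+ 2 + d%:R * b ^+ 2 = n%:~R).
Proof.
move=> [_ xA]; split; apply: Aint_rat.
  have -> : ratr (2 * a) = quad_elt a b + (quad_elt a b)^* by rewrite conj_elt eltD subrr -elt_rat; congr ratr; ring.
  by rewrite rpredD // Aint_conj.
by rewrite -norm_elt rpredM // Aint_conj.
Qed.

Lemma integers_sub_field : O `<=` K. Proof. by move=> x []. Qed.
Lemma integers_int (m : int) : O m%:~R.
Proof. by split; [rewrite elt_int; apply: imag_quad_field_elt|rewrite rpred_int]. Qed.
Lemma integers_nat (m : nat) : O m%:R. Proof. exact: (integers_int m). Qed.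
Lemma integers1 : O 1. Proof. exact: (integers_nat 1). Qed.
Lemma integers0 : O 0. Proof. exact: (integers_nat 0). Qed.
Lemma integersD x y : O x -> O y -> O (x + y).
Proof. by move=> [? ?] [? ?]; split; [apply: imag_quad_fieldD|apply: rpredD]. Qed.
Lemma integersM x y : O x -> O y -> O (x * y).
Proof. by move=> [? ?] [? ?]; split; [apply: imag_quad_fieldM|apply: rpredM]. Qed.
Lemma integers_conj x : O x -> O x^*.
Proof. by move=> [? ?]; split; [apply: imag_quad_field_conj|rewrite Aint_conj]. Qed.
Lemma integers_sqrt : O w.
Proof.
split; first by rewrite elt_w; apply: imag_quad_field_elt.
rewrite elt_w; apply: (@Aint_elt _ _ 0 d); first by rewrite mulr0.
by rewrite expr0n /= add0r expr1n mulr1.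
Qed.
Lemma integers_norm x : O x -> exists n : nat, x * x^* = n%:R.
Proof.
move=> Ox; have [[a [b e]] _] := Ox; rewrite -/(quad_elt a b) in e.
have [_ [n en]] : (exists s : int, 2 * a = s%:~R) /\ (exists n : int, a ^+ 2 + d%:R * b ^+ 2 = n%:~R).
  by apply: integers_elt; rewrite -e.
have : x * x^* = n%:~R by rewrite e norm_elt en ratr_int.
have : 0 <= x * x^* by apply: mul_conjC_ge0.
by case: n {en} => n; [exists n| move=> + e'; rewrite e' NegzE ler0z].
Qed.

Lemma frac_integers : fractional_ideal d O.
Proof.
split; [exact: integers_sub_field|by exists 1; [apply: integers1|apply: oner_neq0]|exact: integersD|exact: integersM|].
by exists 1; [split; [apply: integers1|apply: oner_neq0]|move=> x; rewrite mul1r].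
Qed.

Lemma frac_scale a (I : set algC) : K a -> a != 0 -> fractional_ideal d I ->
  fractional_ideal d (ideal_scale a I).
Proof.
move=> Ka a0 [IK [x Ix x0] ID IM [c [Oc c0] cI]]; split.
- by move=> _ [y Iy <-]; apply: imag_quad_fieldM => //; apply: IK.
- by exists (a * x); [exists x|rewrite mulf_neq0].
- by move=> _ _ [y Iy <-] [z Iz <-]; exists (y + z); rewrite ?mulrDr //; apply: ID.
- by move=> u _ Ou [y Iy <-]; exists (u * y); [apply: IM|rewrite mulrCA].
- have [m [m0 Om]] : exists m : nat, m%:R != 0 :> algC /\ O (m%:R * a^-1).
    have [p [q e]] := (imag_quad_fieldP _).1 (imag_quad_fieldV Ka).
    have [m [m0 [s es] [t et]]] : exists m : nat, [/\ m%:R != 0 :> algC,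
       exists s : int, m%:R * p = s%:~R & exists t : int, m%:R * q = t%:~R].
      exists (`|denq p| * `|denq q|)%N; split.
      + by rewrite pnatr_eq0 muln_eq0 !absz_eq0 negb_or !denq_neq0.
      + exists (numq p * denq q); rewrite natrM !natr_absz !gtr0_norm ?denq_gt0 // intrM.
        by rewrite mulrAC [_ * p]mulrC -numqE.
      + exists (denq p * numq q); rewrite natrM !natr_absz !gtr0_norm ?denq_gt0 // intrM.
        by rewrite -mulrA [_ * q]mulrC -numqE.
    exists m; split => //; rewrite e (elt_nat m) eltM.
    have -> : quad_elt (m%:R * p - d%:R * 0 * q) (m%:R * q + p * 0) = quad_elt s%:~R t%:~R.
      by rewrite -es -et; congr quad_elt; ring.
    have -> : quad_elt s%:~R t%:~R = s%:~R + t%:~R * w by rewrite /quad_elt !ratr_int.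
    by apply: integersD; [apply: integers_int|apply: integersM; [apply: integers_int|apply: integers_sqrt]].
  exists (c * (m%:R * a^-1)).
    by split; [apply: integersM|rewrite !mulf_neq0 // invr_eq0].
  move=> _ [y Iy <-]; have -> : c * (m%:R / a) * (a * y) = m%:R * (c * y).
    by field.
  by apply: integersM; [apply: integers_nat|apply: cI].
Qed.

Lemma frac_mul (I J : set algC) : fractional_ideal d I -> fractional_ideal d J ->
  fractional_ideal d (ideal_mul I J).
Proof.
move=> [IK [x Ix x0] ID IM [c [Oc c0] cI]] [JK [y Jy y0] JD JM [e [Oe e0] eJ]]; split.
- apply: ideal_mul_sub => [|u v|u v Iu Jv]; last by apply: imag_quad_fieldM; [apply: IK|apply: JK].
    exact/integers_sub_field/integers0.
  exact: imag_quad_fieldD.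
- by exists (x * y); [apply: ideal_mul_in|rewrite mulf_neq0].
- exact: ideal_mulD.
- move=> u z Ou; apply: (@ideal_mul_sub I J [set z | ideal_mul I J (u * z)]) => [|a b|a b Ia Jb] /=.
  + by rewrite mulr0; apply: ideal_mul0.
  + by rewrite mulrDr; apply: ideal_mulD.
  + by rewrite mulrA; apply: ideal_mul_in => //; apply: IM.
- exists (c * e); first by split; [apply: integersM|rewrite mulf_neq0].
  apply: (@ideal_mul_sub I J [set z | O (c * e * z)]) => [|a b|a b Ia Jb] /=.
  + by rewrite mulr0; apply: integers0.
  + by rewrite mulrDr; apply: integersD.
  + have -> : c * e * (a * b) = (c * a) * (e * b) by ring.
    by apply: integersM; [apply: cI|apply: eJ].
Qed.

Lemma frac_conj (I : set algC) : fractional_ideal d I -> fractional_ideal d (ideal_conj I).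
Proof.
move=> [IK [x Ix x0] ID IM [c [Oc c0] cI]]; rewrite /ideal_conj; split => /=.
- by move=> y /IK /imag_quad_field_conj; rewrite conjCK.
- by exists x^*; rewrite ?conjCK // conjC_eq0.
- by move=> y z; rewrite rmorphD; apply: ID.
- by move=> u y Ou; rewrite rmorphM; apply: IM; apply: integers_conj.
- exists c^*; first by split; [apply: integers_conj|rewrite conjC_eq0].
  by move=> y /cI /integers_conj; rewrite rmorphM /= conjCK.
Qed.

Lemma integers_mul_ideal (I : set algC) : fractional_ideal d I -> ideal_mul O I = I.
Proof.
move=> [IK [x Ix x0] ID IM _]; apply/seteqP; split.
  apply: ideal_mul_sub => [||u v Ou Iv]; [|exact: ID|exact: IM].
  by rewrite -(mul0r x); apply: IM => //; apply: integers0.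
by move=> y Iy; rewrite -(mul1r y); apply: ideal_mul_in => //; apply: integers1.
Qed.

(** * Products and powers of ideal classes *)

Lemma class_in (I : set algC) : ideal_class d I I.
Proof.
by exists 1; rewrite ?ideal_scale1 //=; split; [apply: imag_quad_field1|apply: oner_neq0].
Qed.

Lemma class_scale a (I : set algC) : K a -> a != 0 ->
  ideal_class d (ideal_scale a I) = ideal_class d I.
Proof.
move=> Ka a0; apply/seteqP; split=> _ [b [Kb b0] <-].
  by exists (b * a); [split; [apply: imag_quad_fieldM|rewrite mulf_neq0]|rewrite ideal_scaleA].
exists (b / a); first by split; [apply: imag_quad_fieldM => //; apply: imag_quad_fieldV|rewrite mulf_neq0 ?invr_eq0].
by rewrite ideal_scaleA divfK.
Qed.

Lemma class_eqP (I J : set algC) : ideal_class d I = ideal_class d J ->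
  exists a, [/\ K a, a != 0 & J = ideal_scale a I].
Proof.
move=> e; have := class_in J; rewrite -e => -[a [Ka a0] <-]; by exists a.
Qed.

Lemma class_mulE (I J : set algC) :
  class_mul (ideal_class d I) (ideal_class d J) = ideal_class d (ideal_mul I J).
Proof.
apply/seteqP; split.
  move=> _ [_ [a [Ka a0] <-] [_ [b [Kb b0] <-] <-]]; rewrite ideal_scale_mul.
  by exists (a * b) => //; split; [apply: imag_quad_fieldM|rewrite mulf_neq0].
move=> _ [a [Ka a0] <-]; exists (ideal_scale a I); first by exists a.
by exists J; [apply: class_in|rewrite -{1}(ideal_scale1 J) ideal_scale_mul mulr1].
Qed.

Definition ideal_pow (I : set algC) n : set algC := iter n (ideal_mul I) (ring_of_integers d).

Lemma class_powE (I : set algC) n : class_pow d (ideal_class d I) n = ideal_class d (ideal_pow I n).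
Proof. by elim: n => // n IH; rewrite /class_pow /= -/(class_pow d _ n) IH class_mulE. Qed.

Lemma principal_mul : class_mul (principal_class d) (principal_class d) = principal_class d.
Proof. by rewrite class_mulE integers_mul_ideal //; apply: frac_integers. Qed.

Lemma class_pow_mul (C D : set (set algC)) n :
  class_pow d (class_mul C D) n = class_mul (class_pow d C n) (class_pow d D n).
Proof.
elim: n => [|n IH]; first by rewrite /class_pow /= principal_mul.
rewrite /class_pow /= -!/(class_pow d _ n) IH.
by rewrite -!class_mulA; congr class_mul; rewrite !class_mulA (class_mulC D).
Qed.

Lemma principal_mull C : class_group d C -> class_mul (principal_class d) C = C.
Proof. by move=> [I fI <-]; rewrite class_mulE integers_mul_ideal. Qed.

Lemma class_group_mul C D : class_group d C -> class_group d D -> class_group d (class_mul C D).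
Proof.
by move=> [I fI <-] [J fJ <-]; exists (ideal_mul I J); [apply: frac_mul|rewrite class_mulE].
Qed.

Lemma frac_pow (I : set algC) n : fractional_ideal d I -> fractional_ideal d (ideal_pow I n).
Proof. by move=> fI; elim: n => [|n IH]; [apply: frac_integers|apply: frac_mul]. Qed.

Lemma ideal_pow_mul (I J : set algC) n :
  ideal_pow (ideal_mul I J) n = ideal_mul (ideal_pow I n) (ideal_pow J n).
Proof.
elim: n => [|n IH]; first by rewrite /ideal_pow /= integers_mul_ideal //; apply: frac_integers.
rewrite /ideal_pow /= -!/(ideal_pow _ n) IH.
by rewrite -!ideal_mulA; congr ideal_mul; rewrite !ideal_mulA (ideal_mulC J).
Qed.

Lemma ideal_conj_O : ideal_conj O = O.
Proof. by apply/seteqP; split=> x; [move=> /integers_conj; rewrite conjCK|apply: integers_conj]. Qed.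

Lemma ideal_conj_pow (I : set algC) n : ideal_conj (ideal_pow I n) = ideal_pow (ideal_conj I) n.
Proof.
elim: n => [|n IH]; first exact: ideal_conj_O.
by rewrite /ideal_pow /= -!/(ideal_pow _ n) ideal_conj_mul IH.
Qed.

Lemma ideal_pow_scaleO a n : ideal_pow (ideal_scale a O) n = ideal_scale (a ^+ n) O.
Proof.
elim: n => [|n IH]; first by rewrite expr0 ideal_scale1.
rewrite /ideal_pow /= -!/(ideal_pow _ n) IH ideal_scale_mul exprS integers_mul_ideal //; exact: frac_integers.
Qed.

Lemma ideal_pow_in (I : set algC) x n : I x -> ideal_pow I n (x ^+ n).
Proof.
move=> Ix; elim: n => [|n IH]; first exact: integers1.
by rewrite exprS; apply: ideal_mul_in.
Qed.

(** The lattice Z + Z (b + sqrt(-d)) / n, attached to the binary form (n, 2b, (b^2 + d) / n): the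
    normal form of an ideal scaled to have shortest vector 1. *)
Definition quad_lattice (n b : nat) : set algC :=
  [set x | exists s t : int, x = quad_elt (s%:~R + t%:~R * (b%:R / n%:R)) (t%:~R / n%:R)].

(** A denominator [c] makes the norms of the [c * y] natural numbers, so there is a nonzero [y] of
    least norm, and [I] is scaled by its inverse. *)
Lemma frac_min (I : set algC) : fractional_ideal d I -> exists a, [/\ K a, a != 0,
  ideal_scale a I 1 & forall x, ideal_scale a I x -> x != 0 -> 1 <= x * x^*].
Proof.
move=> [IK [x Ix x0] ID IM [c [Oc c0] cI]].
pose P (n : nat) := `[< exists y, [/\ I y, y != 0 & (c * y) * (c * y)^* = n%:R] >].
have exP : exists n, P n.
  by have [n en] := integers_norm (cI _ Ix); exists n; apply/asboolP; exists x.
case: (ex_minnP exP) => m /asboolP[y [Iy y0 ey]] minm.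
exists y^-1; split; [exact/imag_quad_fieldV/IK|by rewrite invr_eq0|by exists y; rewrite ?mulVf|].
move=> _ [z Iz <-]; rewrite mulf_eq0 invr_eq0 (negPf y0) /= => z0.
have [n en] := integers_norm (cI _ Iz).
have mn : (m <= n)%N by apply: minm; apply/asboolP; exists z.
have cy0 : 0 < (c * y) * (c * y)^* by rewrite mul_conjC_gt0 mulf_neq0.
have -> : y^-1 * z * (y^-1 * z)^* = ((c * z) * (c * z)^*) / ((c * y) * (c * y)^*).
  rewrite !rmorphM fmorphV /=; have yc : y^* != 0 by rewrite conjC_eq0.
  have cc : c^* != 0 by rewrite conjC_eq0.
  by field; rewrite y0 c0 yc cc.
by rewrite ler_pdivlMr // mul1r ey en ler_nat.
Qed.

(** With k the norm of a denominator c, k x is integral for x in [I], and (k x - conj(k x)) sqrt(-d)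
    = -2 k d b isolates the second coordinate as a rational algebraic integer. *)
Lemma frac_denom (I : set algC) : fractional_ideal d I -> exists2 e : nat, (0 < e)%N &
  forall a b, I (quad_elt a b) -> exists m : int, e%:R * b = m%:~R.
Proof.
move=> [IK _ ID IM [c [Oc c0] cI]]; have [k ek] := integers_norm Oc.
have k0 : (0 < k)%N by rewrite lt0n -(pnatr_eq0 algC) -ek mulf_neq0 ?conjC_eq0.
exists (2 * k * d)%N; first by rewrite !muln_gt0 k0 d_gt0.
move=> a b Ix; have [m em] : exists m : int, (- (2 * k * d)%N%:R * b) = m%:~R.
  apply: Aint_rat.
  have -> : ratr (- (2 * k * d)%N%:R * b) =
     (k%:R * quad_elt a b - (k%:R * quad_elt a b)^*) * w :> algC.
    rewrite [LHS]elt_rat (elt_nat k) eltM conj_elt eltN eltD elt_w eltM.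
    by congr quad_elt; rewrite ?natrM; ring.
  have kA : k%:R * quad_elt a b \in Aint.
    by rewrite -ek (mulrC c) -mulrA rpredM ?Aint_conj //; [case: Oc|case: (cI _ Ix)].
  by rewrite rpredM ?rpredB ?Aint_conj //; case: integers_sqrt.
by exists (- m); rewrite intrN -em; ring.
Qed.

(** Reduction theory: since 1 is a shortest vector, the rational elements of [I] are the integers,
    and [I] is generated by 1 and an element with least positive second coordinate. Minimality of 1
    bounds [n], and stability under sqrt(-d) gives the divisibility. *)
Lemma frac_lattice (I : set algC) : fractional_ideal d I -> I 1 ->
  (forall x, I x -> x != 0 -> 1 <= x * x^*) ->
  exists n b, [/\ (0 < n)%N, (b < n)%N, (3 * n ^ 2 <= 4 * d)%N, (n %| b ^ 2 + d)%N & I = quad_lattice n b].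
Proof.
move=> fI I1 Imin; have [e e0 He] := frac_denom fI; have [IK _ ID IM _] := fI.
have eR0 : (e%:R : rat) != 0 by rewrite pnatr_eq0 -lt0n.
have Iint (m : int) : I m%:~R by rewrite -(mulr1 m%:~R); apply: IM => //; apply: integers_int.
have IZ (m : int) x : I x -> I (m%:~R * x) by apply: IM; apply: integers_int.
have IN x : I x -> I (- x) by move=> Ix; have := IZ (-1) _ Ix; rewrite mulN1r.
have Iw : I w by rewrite -(mulr1 w); apply: IM => //; apply: integers_sqrt.
have Irat (a : rat) : I (ratr a) -> exists m : int, a = m%:~R.
  (* A nonzero fractional part would be an element of [I] of norm less than 1. *)
  move=> Ia; exists (Num.floor a); have /andP[f1 f2] := floor_itv a.
  set r := a - (Num.floor a)%:~R.
  have Ir : I (ratr r) by rewrite rmorphB /= ratr_int; apply: ID => //; apply/IN/Iint.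
  case: (eqVneq r 0) => [/eqP|r0]; first by rewrite subr_eq0 => /eqP.
  have := Imin _ Ir; rewrite fmorph_eq0 => /(_ r0).
  rewrite conj_Crat ?Crat_rat // -rmorphM -(rmorph1 (ratr : rat -> algC)) ler_rat.
  have r_ge0 : 0 <= r by rewrite subr_ge0.
  have r_lt1 : r < 1 by rewrite ltrBlDl -[1]/(1%:~R) -intrD.
  by rewrite leNgt -expr2 expr_lt1 // r_lt1.
pose P (t : nat) := (0 < t)%N && `[< exists a b, I (quad_elt a b) /\ e%:R * b = t%:R >].
have exP : exists t, P t.
  by exists e; rewrite /P e0; apply/asboolP; exists 0, 1; rewrite -elt_w mulr1.
case: (ex_minnP exP) => t /andP[t0 /asboolP[u [v [Iuv ev]]]] mint.
have tR0 : (t%:R : rat) != 0 by rewrite pnatr_eq0 -lt0n.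
have decomp a b : I (quad_elt a b) -> exists s q : int, a = s%:~R + q%:~R * u /\ b = q%:~R * v.
  move=> Iab; have [m em] := He _ _ Iab.
  pose q := (m %/ t)%Z; pose r := (m %% t)%Z.
  have mE : m = q * t + r := divz_eq m t.
  have r_ge0 : 0 <= r by rewrite modz_ge0 //; move: t0; clear; lia.
  have r_lt : r < t by rewrite ltz_pmod.
  have Iq : I (quad_elt (a - q%:~R * u) (b - q%:~R * v)).
    have := ID _ _ Iab (IN _ (IZ q _ Iuv)).
    by rewrite elt_int eltM eltN eltD; congr (I (quad_elt _ _)); ring.
  have eb : e%:R * (b - q%:~R * v) = r%:~R.
    have -> : e%:R * (b - q%:~R * v) = e%:R * b - q%:~R * (e%:R * v) by ring.
    by rewrite em ev mE intrD intrM; ring.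
  have r0 : r = 0.
    case: (posnP `|r|%N) => [/eqP|rp]; first by rewrite absz_eq0 => /eqP.
    have : (t <= `|r|)%N.
      apply: mint; rewrite /P rp; apply/asboolP; exists (a - q%:~R * u), (b - q%:~R * v).
      by split=> //; rewrite eb natr_absz ger0_norm.
    by move: r_ge0 r_lt; clear; lia.
  have b0 : b - q%:~R * v = 0.
    by apply/eqP; move/eqP: eb; rewrite r0 mulf_eq0 (negPf eR0).
  move: Iq; rewrite b0 -elt_rat => /Irat[s es].
  by exists s, q; split; [rewrite -es; ring|apply/eqP; rewrite -subr_eq0 b0].
(* As sqrt(-d) lies in [I], the coordinate 1 is a multiple n v of the least one, whence v = 1/n. *)
have [s [n [e0' e1]]] := decomp 0 1 (eq_ind _ I Iw _ elt_w).
have v0 : 0 < v.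
  have : 0 < e%:R * v by rewrite ev ltr0n.
  by rewrite pmulr_rgt0 // ltr0n.
have n0 : 0 < n.
  have : 0 < n%:~R * v by rewrite -e1.
  by rewrite pmulr_lgt0 // ltr0z.
case: n n0 e0' e1 => // n n0 e0' e1; rewrite -pmulrn in e0' e1.
have {}n0 : (0 < n)%N by [].
have nR0 : (n%:R : rat) != 0 by rewrite pnatr_eq0 -lt0n.
have vE : v = n%:R^-1 by apply: (mulfI nR0); rewrite -e1 mulfV.
have uE : u = - s%:~R / n%:R.
  by apply: (mulfI nR0); rewrite [RHS]mulrC divfK //; apply/eqP; rewrite -addr_eq0 addrC -e0'.
pose b := `|((- s) %% n)%Z|%N; pose k := ((- s) %/ n)%Z.
have sE : - s = k * n + b.
  by rewrite {1}(divz_eq (- s) n) /b gez0_abs ?modz_ge0 //; lia.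
have bn : (b < n)%N by rewrite -ltz_nat /b gez0_abs ?modz_ge0 ?ltz_pmod //; lia.
have uE' : u = k%:~R + b%:R / n%:R.
  by rewrite uE -intrN sE intrD intrM mulrDl mulfK.
have IE : I = quad_lattice n b.
  apply/seteqP; split=> x.
    move=> Ix; have [a [c ec]] := (imag_quad_fieldP _).1 (IK _ Ix); rewrite ec in Ix *.
    have [s' [q [-> ->]]] := decomp _ _ Ix; exists (s' + q * k), q.
    by rewrite uE' vE intrD intrM; congr quad_elt; ring.
  move=> [s' [q ->]]; have := ID _ _ (Iint (s' - q * k)) (IZ q _ Iuv).
  rewrite !elt_int eltM eltD uE' vE intrB intrM; congr (I (quad_elt _ _)); ring.
have Ir (r : int) : (exists j : int, r = b%:Z + j * n) -> (n ^ 2)%N%:Z <= r ^+ 2 + d.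
  move=> [j rE]; have Ix : I (quad_elt (r%:~R / n%:R) n%:R^-1).
    rewrite IE; exists j, 1; congr quad_elt; last by rewrite mul1r.
    by rewrite rE intrD intrM mulrDl mulfK // mul1r addrC.
  have := Imin _ Ix; rewrite elt_eq0 invr_eq0 (negPf nR0) andbF => /(_ isT).
  rewrite norm_elt -(rmorph1 (ratr : rat -> algC)) ler_rat.
  have -> : (r%:~R / n%:R) ^+ 2 + d%:R * n%:R^-1 ^+ 2 = (r ^+ 2 + d)%:~R / (n ^ 2)%N%:R :> rat.
    by rewrite natrX intrD rmorphXn /=; field.
  rewrite ler_pdivlMr ?ltr0n ?expn_gt0 ?n0 // mul1r -[X in X <= _]/((n ^ 2)%N%:~R) ler_int //.
exists n, b; split=> //.
  (* One of b and b - n has absolute value at most n/2, and for that one n^2 <= n^2/4 + d. *)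
  have h1 : (n ^ 2)%N%:Z <= b%:Z ^+ 2 + d by apply: Ir; exists 0; rewrite mul0r addr0.
  have h2 : (n ^ 2)%N%:Z <= (b%:Z - n%:Z) ^+ 2 + d%:Z.
    by apply: Ir; exists (-1)%R; rewrite mulN1r.
  move: h1 h2 bn; clear; case: (leqP (2 * b) n) => hb h1 h2 bn; nia.
(* Expanding sqrt(-d) times the second generator in the lattice basis forces its second coefficient
   to be b, and the first one then exhibits b^2 + d as a multiple of n. *)
have Iww : I (w * quad_elt (b%:R / n%:R) n%:R^-1).
  apply: IM; first exact: integers_sqrt.
  by rewrite IE; exists 0, 1; congr quad_elt; rewrite ?mul1r ?add0r.
move: Iww; rewrite elt_w eltM IE => -[s' [q]] /elt_inj[E1 E2].
have qb : q = b.
  apply/eqP; rewrite -(eqr_int rat); apply/eqP/(mulIf (invr_neq0 nR0)).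
  by rewrite -E2; ring.
have : (b ^ 2 + d)%N%:R = - s'%:~R * n%:R :> rat.
  move: E1; rewrite qb => E1.
  have : (0 * (b%:R / n%:R) - d%:R * 1 / n%:R) * n%:R = (s'%:~R + b%:~R * (b%:R / n%:R)) * n%:R :> rat by rewrite E1.
  have -> : (0 * (b%:R / n%:R) - d%:R * 1 / n%:R) * n%:R = - d%:R :> rat by field.
  have -> : (s'%:~R + b%:~R * (b%:R / n%:R)) * n%:R = s'%:~R * n%:R + b%:R ^+ 2 :> rat by field.
  rewrite natrD natrX => h; lra.
rewrite -intrN -[n%:R]/(n%:~R) -intrM -[LHS]/((b ^ 2 + d)%N%:~R) => /eqP; rewrite eqr_int => /eqP h.
by have := dvdz_mull (- s') (dvdzz n%:Z); rewrite -h.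
Qed.

Lemma class_lattice (C : set (set algC)) : class_group d C -> exists n b,
  [/\ (0 < n)%N, (b < n)%N, (3 * n ^ 2 <= 4 * d)%N, (n %| b ^ 2 + d)%N &
    fractional_ideal d (quad_lattice n b) /\ C = ideal_class d (quad_lattice n b)].
Proof.
move=> [I fI <-]; have [a [Ka a0 I1 Imin]] := frac_min fI.
have faI := frac_scale Ka a0 fI.
have [n [b [n0 bn n3 nb e]]] := frac_lattice faI I1 Imin.
by exists n, b; split=> //; split; rewrite -e ?class_scale.
Qed.

(* With tau = (b + w) / n, the product is generated by 1, tau and the trace and
   norm of tau; 1, trace and norm generate (f / n) Z where f is the content of
   the form (n, 2b, (b^2 + d) / n), and n tau / f is integral. *)
Lemma lat_mul_conj n b : (0 < n)%N -> (n %| b ^ 2 + d)%N -> fractional_ideal d (quad_lattice n b) ->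
  exists q, [/\ K q, q != 0 & ideal_mul (quad_lattice n b) (ideal_conj (quad_lattice n b)) = ideal_scale q O].
Proof.
move=> n0 nb fL; pose c := ((b ^ 2 + d) %/ n)%N; pose f := gcdn n (gcdn (2 * b) c).
have f0 : (0 < f)%N by rewrite gcdn_gt0 n0.
have fn : (f %| n)%N by apply: dvdn_gcdl.
have fb : (f %| 2 * b)%N by apply: dvdn_trans (dvdn_gcdr _ _) (dvdn_gcdl _ _).
have fc : (f %| c)%N by apply: dvdn_trans (dvdn_gcdr _ _) (dvdn_gcdr _ _).
pose N1 := (n %/ f)%N; pose B1 := ((2 * b) %/ f)%N; pose C1 := (c %/ f)%N.
have nE : n%:R = N1%:R * f%:R :> rat by rewrite -natrM divnK.
have bE : 2 * b%:R = B1%:R * f%:R :> rat by rewrite -[RHS]natrM divnK // natrM.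
have dE : d%:R = N1%:R * f%:R * (C1%:R * f%:R) - b%:R ^+ 2 :> rat.
  rewrite -!natrM (divnK fn) (divnK fc) mulnC (divnK nb) natrD natrX; ring.
have fR : (f%:R : rat) != 0 by rewrite pnatr_eq0 -lt0n.
have NR : (N1%:R : rat) != 0 by rewrite pnatr_eq0 -lt0n divn_gt0 // dvdn_leq.
pose q := quad_elt (f%:R / n%:R) 0; pose th := quad_elt (b%:R / f%:R) f%:R^-1.
have Oth : O th.
  split; first exact: imag_quad_field_elt.
  apply: (@Aint_elt _ _ B1 (N1 * C1)%N).
    by rewrite mulrA bE mulfK.
  by rewrite dE -[RHS]/((N1 * C1)%N%:R) natrM; field.
have q0 : q != 0 by rewrite elt_eq0 eqxx andbT mulf_neq0 // invr_eq0 nE mulf_neq0.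
have L1 : quad_lattice n b 1 by exists 1, 0; rewrite -[LHS]/(1%:R) elt_nat; congr quad_elt; rewrite mul0r ?addr0.
pose ta := quad_elt (b%:R / n%:R) n%:R^-1.
have Lta : quad_lattice n b ta by exists 0, 1; congr quad_elt; rewrite mul1r ?add0r.
have fLL := frac_mul fL (frac_conj fL); have [_ _ LD LM _] := fLL.
exists q; split; [exact: imag_quad_field_elt|by []|]; apply/seteqP; split.
  apply: ideal_mul_sub => [|_ _ [x Ox <-] [y Oy <-]|x y].
  - by exists 0; rewrite ?mulr0 //; apply: integers0.
  - by exists (x + y); rewrite ?mulrDr //; apply: integersD.
  move=> [s [t ->]]; rewrite /ideal_conj /= => -[s' [t' e]].
  have -> : y = quad_elt (s'%:~R + t'%:~R * (b%:R / n%:R)) (- (t'%:~R / n%:R)).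
    by rewrite -[LHS]conjCK e conj_elt.
  exists ((N1%:R * s%:~R * s'%:~R + s%:~R * t'%:~R * th^*) + (s'%:~R * t%:~R * th + t%:~R * t'%:~R * C1%:R)).
    have Oc := integers_conj Oth.
    by do !(done || apply: integers_nat || apply: integers_int || apply: integersM || apply: integersD).
  rewrite /q /th conj_elt !elt_int !elt_nat !(eltM, eltD) nE.
  by congr quad_elt; rewrite ?dE; field; rewrite ?fR ?NR.
suff Lq : ideal_mul (quad_lattice n b) (ideal_conj (quad_lattice n b)) q.
  by move=> _ [z Oz <-]; rewrite mulrC; apply: LM.
have [u [v uv]] := Bezoutz n (gcdn (2 * b) c); have [u' [v' uv']] := Bezoutz (2 * b)%N c.
have fE : f%:R = u%:~R * n%:R + v%:~R * (u'%:~R * (2 * b)%N%:R + v'%:~R * c%:R) :> rat.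
  have -> : (2 * b)%N%:R = (2 * b)%N%:~R :> rat by [].
  have -> : c%:R = c%:~R :> rat by [].
  rewrite -!intrM -intrD uv'.
  have -> : gcdz (2 * b)%N c = gcdn (2 * b) c :> int by [].
  have -> : n%:R = n%:~R :> rat by [].
  rewrite -!intrM -intrD uv.
  by have -> : gcdz n (gcdn (2 * b) c) = f :> int by [].
have cE : c%:R = C1%:R * f%:R :> rat by rewrite -natrM divnK.
have -> : q = u%:~R * (1 * 1) + ((v * u')%:~R * (ta * 1 + 1 * ta^*) + (v * v')%:~R * (ta * ta^*)).
  rewrite /q /ta conj_elt !mulr1 !mul1r !elt_int !(eltM, eltD).
  by congr quad_elt; rewrite ?fE ?cE ?nE ?dE ?natrM ?intrM; field; rewrite ?fR ?NR.
have cL1 : ideal_conj (quad_lattice n b) 1 by rewrite /ideal_conj /= rmorph1.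
have cLt : ideal_conj (quad_lattice n b) ta^* by rewrite /ideal_conj /= conjCK.
apply: (LD); first by apply: LM; [apply: integers_int|apply: ideal_mul_in].
apply: (LD); apply: LM; try exact: integers_int; last exact: ideal_mul_in.
by apply: LD; apply: ideal_mul_in.
Qed.

Lemma class_inv C : class_group d C ->
  exists2 D, class_group d D & class_mul C D = principal_class d.
Proof.
move=> /class_lattice[n [b [n0 _ _ nb [fL ->]]]].
have [q [Kq q0 e]] := lat_mul_conj n0 nb fL.
exists (ideal_class d (ideal_conj (quad_lattice n b))).
  by exists (ideal_conj (quad_lattice n b)) => //; apply: frac_conj.
by rewrite class_mulE e class_scale.
Qed.

Lemma class_cancel A C C' : class_group d A -> class_group d C -> class_group d C' ->
  class_mul C A = class_mul C' A -> C = C'.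
Proof.
move=> gA gC gC' e; have [B gB AB] := class_inv gA.
have : class_mul (class_mul C A) B = class_mul (class_mul C' A) B by rewrite e.
by rewrite -!class_mulA AB !(class_mulC _ (principal_class d)) !principal_mull.
Qed.

(** The ideal (p, be). With be = b + sqrt(-d) and p dividing b^2 + d it is a prime ideal above the
    split prime [p], though primality itself is never invoked; only [pideal_norm] matters. *)
Definition pideal (p : nat) (be : algC) : set algC :=
  [set x | exists u v, [/\ ring_of_integers d u, ring_of_integers d v & x = p%:R * u + be * v]].

Lemma pideal_sub_O p be : O be -> pideal p be `<=` O.
Proof.
by move=> Ob _ [u [v [Ou Ov ->]]]; apply: integersD; apply: integersM => //; apply: integers_nat.
Qed.

Lemma frac_pideal p be : (0 < p)%N -> O be -> fractional_ideal d (pideal p be).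
Proof.
move=> p0 Ob; have sO := pideal_sub_O (p := p) Ob; split.
- by move=> x /sO /integers_sub_field.
- exists p%:R; last by rewrite pnatr_eq0 -lt0n.
  by exists 1, 0; rewrite mulr1 mulr0 addr0; split=> //; [apply: integers1|apply: integers0].
- move=> _ _ [u [v [Ou Ov ->]]] [u' [v' [Ou' Ov' ->]]]; exists (u + u'), (v + v').
  by split; [apply: integersD|apply: integersD|ring].
- move=> c _ Oc [u [v [Ou Ov ->]]]; exists (c * u), (c * v).
  by split; [apply: integersM|apply: integersM|ring].
- exists 1; first by split; [apply: integers1|apply: oner_neq0].
  by move=> x /sO; rewrite mul1r.
Qed.

Lemma pideal_conj p be : ideal_conj (pideal p be) = pideal p be^*.
Proof.
have S q c : pideal q c^* `<=` ideal_conj (pideal q c).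
  move=> _ [u [v [Ou Ov ->]]]; exists u^*, v^*; split; [exact: integers_conj|exact: integers_conj|].
  by rewrite rmorphD !rmorphM /= conjCK rmorph_nat.
apply/seteqP; split; last exact: S.
by move=> x Hx; rewrite -[x]conjCK; apply: (S p be^*); rewrite /= conjCK.
Qed.

Let beta (b : nat) : algC := quad_elt b%:R 1.

Lemma integers_beta b : O (beta b).
Proof.
have -> : beta b = b%:R + w by rewrite elt_nat elt_w eltD addr0 add0r.
by apply: integersD; [apply: integers_nat|apply: integers_sqrt].
Qed.

Lemma beta_trace b : beta b + (beta b)^* = (2 * b)%N%:R.
Proof. by rewrite conj_elt eltD elt_nat; congr quad_elt; rewrite ?natrM; ring. Qed.

Lemma beta_norm b : beta b * (beta b)^* = (b ^ 2 + d)%N%:R.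
Proof. by rewrite norm_elt expr1n mulr1 -natrX -natrD ratr_nat. Qed.

(** The product is generated by p^2, p beta, p conj(beta) and b^2 + d, all multiples of p.
    Conversely it contains p^2 and p times the trace 2b, and gcd(p, 2b) = 1 because p is odd and
    prime to d. *)
Lemma pideal_norm p b : prime p -> odd p -> ~~ (p %| d)%N -> (p %| b ^ 2 + d)%N ->
  ideal_mul (pideal p (beta b)) (ideal_conj (pideal p (beta b))) = ideal_scale p%:R O.
Proof.
move=> pp op pd pb; rewrite pideal_conj; have Ob := integers_beta b; have Ob' := integers_conj Ob.
have p0 := prime_gt0 pp.
have [_ _ LD LM _] := frac_mul (frac_pideal p0 Ob) (frac_pideal p0 Ob').
apply/seteqP; split.
  apply: ideal_mul_sub => [|_ _ [x Ox <-] [y Oy <-]|_ _ [u [v [Ou Ov ->]]] [u' [v' [Ou' Ov' ->]]]].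
  - by exists 0; rewrite ?mulr0 //; apply: integers0.
  - by exists (x + y); rewrite ?mulrDr //; apply: integersD.
  exists (p%:R * u * u' + u * (beta b)^* * v' + (beta b * v * u' + ((b ^ 2 + d) %/ p)%N%:R * v * v')).
    by do !(done || apply: integers_nat || apply: integers_int || apply: integersM || apply: integersD).
  have e : p%:R * ((b ^ 2 + d) %/ p)%N%:R = beta b * (beta b)^* by rewrite beta_norm -natrM mulnC divnK.
  transitivity (p%:R * (p%:R * u * u' + u * (beta b)^* * v' + beta b * v * u') +
     (p%:R * ((b ^ 2 + d) %/ p)%N%:R) * v * v'); first by ring.
  by rewrite e; ring.
have pb' := ndvd_of_ndvd_sqrD pd pb.
have c2b : coprime p (2 * b).
  rewrite prime_coprime // Euclid_dvdM // negb_or pb' andbT.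
  by rewrite dvdn_prime2 //; apply: contraL op => /eqP ->.
have [r [s rs]] := Bezoutz p (2 * b)%N.
have {}rs : r%:~R * p%:R + s%:~R * (2 * b)%N%:R = 1 :> algC.
  rewrite -[p%:R]/(p%:~R) -[(2 * b)%N%:R]/((2 * b)%N%:~R) -!intrM -intrD rs.
  by rewrite /gcdz /= (eqP c2b).
have Pp c : pideal p c p%:R.
  by exists 1, 0; rewrite mulr1 mulr0 addr0; split=> //; [apply: integers1|apply: integers0].
have Pc c : pideal p c c.
  by exists 0, 1; rewrite mulr1 mulr0 add0r; split=> //; [apply: integers0|apply: integers1].
suff Lp : ideal_mul (pideal p (beta b)) (pideal p (beta b)^*) p%:R.
  by move=> _ [z Oz <-]; rewrite mulrC; apply: LM.
have -> : p%:R = r%:~R * (p%:R * p%:R) + s%:~R * (beta b * p%:R + p%:R * (beta b)^*) :> algC.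
  transitivity (p%:R * (r%:~R * p%:R + s%:~R * (2 * b)%N%:R) : algC); first by rewrite rs mulr1.
  by rewrite -beta_trace; ring.
apply: (LD); apply: LM; try exact: integers_int; first exact: ideal_mul_in.
by apply: LD; apply: ideal_mul_in.
Qed.

Lemma ideal_pow_sub_O (I : set algC) n : I `<=` O -> ideal_pow I n `<=` O.
Proof.
move=> IO; elim: n => // n IH; rewrite /ideal_pow /= -/(ideal_pow I n).
by rewrite -[X in _ `<=` X](integers_mul_ideal frac_integers); apply: ideal_mul_mono.
Qed.

Lemma sum_pow_expand (x y : algC) n : x \in Aint -> y \in Aint ->
  exists2 q, q \in Aint & (x + y) ^+ n.+1 = x ^+ n.+1 + y ^+ n.+1 + x * y * q.
Proof.
move=> xA yA; elim: n => [|n [q qA e]]; first by exists 0; rewrite ?rpred0 //; ring.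
exists (x ^+ n + y ^+ n + (x + y) * q); first by rewrite !(rpredD, rpredM, rpredX).
by rewrite exprS e !exprS; ring.
Qed.

(* Otherwise p divides beta^g p'^g, hence its trace; but the g-th power of the
   trace 2b of beta is congruent to the trace of beta^g modulo the norm of beta,
   which is a multiple of p. *)
Lemma prime_ndvd_coef g p b p' (s t : int) z : (1 < g)%N ->
  prime p -> odd p -> ~~ (p %| d)%N -> (p %| b ^ 2 + d)%N -> ~~ (p %| p')%N ->
  s ^+ 2 + d%:Z * t ^+ 2 = (4 * (p * p') ^ g)%N ->
  O z -> (beta b) ^+ g * p'%:R ^+ g = quad_elt (s%:~R / 2) (t%:~R / 2) * z ->
  ~~ (p %| `|t|)%N.
Proof.
move=> g1 pp op pd pb pp' eN Oz ez; apply/negP => pt.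
have pb' := ndvd_of_ndvd_sqrD pd pb.
have ps : (p %| `|s|)%N.
  have : (p %| `|s ^+ 2|)%N.
    have -> : s ^+ 2 = (4 * (p * p') ^ g)%N%:Z - d%:Z * t ^+ 2 by rewrite -eN addrK.
    rewrite -[(_ %| _)%N]/((p%:Z %| _)%Z) rpredB //.
      by rewrite dvdzE /= dvdn_mull // dvdn_exp // ?(ltnW g1) // dvdn_mulr.
    by rewrite dvdz_mull // expr2 dvdz_mull // dvdzE.
  by rewrite abszX Euclid_dvdX // => /andP[].
have /dvdzP[s1 es] : (p%:Z %| s)%Z by rewrite dvdzE.
have /dvdzP[t1 et] : (p%:Z %| t)%Z by rewrite dvdzE.
have pR : (p%:R : rat) != 0 by rewrite pnatr_eq0 -lt0n prime_gt0.
have integers1' : O (quad_elt (s1%:~R / 2) (t1%:~R / 2)).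
  split; first exact: imag_quad_field_elt.
  apply: (@Aint_elt _ _ s1 (p ^ (g - 2) * p' ^ g)%N); first by field.
  have h : (s1 ^+ 2 + d%:Z * t1 ^+ 2) * p%:Z ^+ 2 = (4 * (p * p') ^ g)%N.
    by rewrite -eN es et; ring.
  have h' : (s1%:~R ^+ 2 + d%:R * t1%:~R ^+ 2) * p%:R ^+ 2 = 4 * (p%:R * p'%:R) ^+ g :> rat.
    have := congr1 (fun x : int => x%:~R : rat) h.
    rewrite intrM intrD intrM !rmorphXn /= => ->.
    by rewrite -[LHS]/((4 * (p * p') ^ g)%N%:R) natrM natrX natrM.
  have p2R : (p%:R ^+ 2 : rat) != 0 by rewrite expf_neq0.
  apply: (mulIf p2R); rewrite -[X in _ = X * _]/((p ^ (g - 2) * p' ^ g)%N%:R) natrM !natrX.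
  transitivity ((s1%:~R ^+ 2 + d%:R * t1%:~R ^+ 2) * p%:R ^+ 2 / 4 : rat); first by field.
  rewrite h' [RHS]mulrAC -exprD subnK // exprMn; by field.
pose de := quad_elt (s1%:~R / 2) (t1%:~R / 2) * z.
have Ode : O de by apply: integersM.
have ede : (beta b) ^+ g * p'%:R ^+ g = p%:R * de.
  rewrite ez /de mulrA; congr (_ * _); rewrite elt_nat eltM es et !intrM.
  by congr quad_elt; ring.
have [_ bA] := integers_beta b; have bA' : (beta b)^* \in Aint by rewrite Aint_conj.
have [q qA eq] := sum_pow_expand g.-1 bA bA'; rewrite prednK ?(ltnW g1) // in eq.
rewrite beta_trace beta_norm in eq.
have ecj : (beta b)^* ^+ g * p'%:R ^+ g = p%:R * de^*.
  by have := congr1 Num.conj ede; rewrite !rmorphM !rmorphXn /= !rmorph_nat.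
have fin : (2 * b)%N%:R ^+ g * p'%:R ^+ g =
    p%:R * (de + de^* + ((b ^ 2 + d) %/ p)%N%:R * q * p'%:R ^+ g) :> algC.
  have e : p%:R * ((b ^ 2 + d) %/ p)%N%:R = (b ^ 2 + d)%N%:R :> algC by rewrite -natrM mulnC divnK.
  rewrite eq -e !mulrDl ede ecj; ring.
set Y := (_ + _ : algC) in fin.
have YA : Y \in Aint.
  have [_ dA] := Ode; have dA' : de^* \in Aint by rewrite Aint_conj.
  by rewrite /Y; do !(done || apply: rpred_nat || apply: rpredX || apply: rpredM || apply: rpredD).
have pC : (p%:R : algC) != 0 by rewrite pnatr_eq0 -lt0n prime_gt0.
have [m em] : exists m : int, ((2 * b)%N%:R ^+ g * p'%:R ^+ g / p%:R : rat) = m%:~R.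
  apply: Aint_rat; suff -> : ratr ((2 * b)%N%:R ^+ g * p'%:R ^+ g / p%:R) = Y :> algC by [].
  rewrite -!natrX -natrM rmorphM /= fmorphV /= !ratr_nat natrM !natrX fin.
  by rewrite mulrC mulKf.
have : (p %| (2 * b) ^ g * p' ^ g)%N.
  rewrite -[(_ %| _)%N]/((p%:Z %| ((2 * b) ^ g * p' ^ g)%N%:Z)%Z).
  apply/dvdzP; exists m; apply/eqP; rewrite -(eqr_int rat) intrM -em.
  by rewrite -[p%:~R]/(p%:R) divfK // -!natrX -natrM.
rewrite Euclid_dvdM // !Euclid_dvdX // Euclid_dvdM // (negPf pb') (negPf pp') andFb !orbF.
by rewrite dvdn_prime2 // => /andP[/eqP p2]; rewrite p2 in op.
Qed.

(** Trace and norm make d (2b)^2 an integer, so the square of the denominator of 2b divides the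
    squarefree [d]. This avoids a case split on d modulo 4. *)
Lemma squarefree_elt a b : squarefree d -> O (quad_elt a b) ->
  exists s t : int, a = s%:~R / 2 /\ b = t%:~R / 2.
Proof.
move=> sq /integers_elt[[s es] [n en]]; exists s.
pose c := 2 * b; have ec : d%:R * c ^+ 2 = (4 * n - s ^+ 2)%:~R.
  rewrite intrB intrM rmorphXn /= -en -es /c; ring.
have dv : (`|denq c| ^ 2 %| d)%N.
  have : ((denq c) ^+ 2 %| d%:Z * (numq c) ^+ 2)%Z.
    apply/dvdzP; exists (4 * n - s ^+ 2); apply/eqP; rewrite -(eqr_int rat).
    have -> : (d%:Z * numq c ^+ 2)%:~R = d%:R * (c * (denq c)%:~R) ^+ 2 :> rat.
      by rewrite -numqE rmorphM rmorphXn.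
    have -> : ((4 * n - s ^+ 2) * denq c ^+ 2)%:~R = (4 * n - s ^+ 2)%:~R * (denq c)%:~R ^+ 2 :> rat.
      by rewrite rmorphM rmorphXn.
    by rewrite -ec exprMn mulrA.
  rewrite dvdzE abszM !abszX Gauss_dvdl //=.
  by rewrite coprimeXl // coprimeXr // coprime_sym coprime_num_den.
have d1 : `|denq c|%N = 1%N := sq _ dv.
exists (numq c); split; first by rewrite -es; field.
have : c = (numq c)%:~R.
  have := numqE c; have -> : denq c = 1 by rewrite -(gtz0_abs (denq_gt0 c)) d1.
  by rewrite mulr1.
by rewrite {1}/c => <-; field.
Qed.

(** The 4 clears the halves in the coordinates of integers; the coprimality is what
    [square_roots_count] relies on. *)
Definition norm_rep (g p q : nat) : Prop :=
  exists x y, (4 * (p * q) ^ g = x ^ 2 + d * y ^ 2)%N /\ coprime y (p * q).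

(** If P^g = a Q^g, then A = P^g conj(Q)^g = a (Q conj(Q))^g is the principal ideal generated by
    [al] = a q^g. It is integral and A conj(A) = ((p q)^g), so [al] has norm (p q)^g and its
    half-integral coordinates give x and y. *)
Lemma same_pow_norm_rep g p q b c : squarefree d -> (1 < g)%N ->
  prime p -> odd p -> ~~ (p %| d)%N -> (p %| b ^ 2 + d)%N ->
  prime q -> odd q -> ~~ (q %| d)%N -> (q %| c ^ 2 + d)%N -> p != q ->
  class_pow d (ideal_class d (pideal p (beta b))) g =
  class_pow d (ideal_class d (pideal q (beta c))) g -> norm_rep g p q.
Proof.
move=> sq g1 pp op pd pb pq oq qd qc pnq; rewrite !class_powE => /esym/class_eqP[a [Ka a0 eP]].
have Ob := integers_beta b; have Oc := integers_beta c.
set P := pideal p (beta b) in eP; set Q := pideal q (beta c) in eP.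
pose A := ideal_mul (ideal_pow P g) (ideal_pow (ideal_conj Q) g).
pose al := a * q%:R ^+ g.
have nP : ideal_mul P (ideal_conj P) = ideal_scale p%:R O by apply: pideal_norm.
have nQ : ideal_mul Q (ideal_conj Q) = ideal_scale q%:R O by apply: pideal_norm.
have fO := frac_integers.
have AE : A = ideal_scale al O.
  rewrite /A eP -(ideal_scale1 (ideal_pow (ideal_conj Q) g)) ideal_scale_mul mulr1.
  by rewrite -ideal_pow_mul nQ ideal_pow_scaleO ideal_scaleA.
have PO : P `<=` O by apply: pideal_sub_O.
have QO : Q `<=` O by apply: pideal_sub_O.
have QO' : ideal_conj Q `<=` O by move=> x /QO /integers_conj; rewrite conjCK.
have AO : A `<=` O.
  by rewrite /A -[X in _ `<=` X](integers_mul_ideal fO); apply: ideal_mul_mono; apply: ideal_pow_sub_O.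
have Aal : A al by rewrite AE; exists 1; rewrite ?mulr1 //; apply: integers1.
have Oal : O al by apply: AO.
have cA : ideal_conj A = ideal_scale al^* O.
  rewrite AE; apply/seteqP; split=> x.
    by move=> [y Oy e]; exists y^*; [apply: integers_conj|rewrite -rmorphM e /= conjCK].
  by move=> [y Oy <-]; exists y^*; [apply: integers_conj|rewrite rmorphM /= conjCK].
have cA' : ideal_conj A = ideal_mul (ideal_pow Q g) (ideal_pow (ideal_conj P) g).
  by rewrite /A ideal_conj_mul !ideal_conj_pow ideal_conjK ideal_mulC.
have AA : ideal_scale (al * al^*) O = ideal_scale ((p%:R * q%:R) ^+ g) O.
  have e1 : ideal_mul A (ideal_conj A) = ideal_scale (al * al^*) O.
    by rewrite cA AE ideal_scale_mul integers_mul_ideal.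
  rewrite -e1 cA' /A.
  rewrite -ideal_mulA (ideal_mulA (ideal_pow (ideal_conj Q) g)) (ideal_mulC (ideal_pow (ideal_conj Q) g)).
  rewrite ideal_mulA (ideal_mulC (ideal_pow P g)) -ideal_mulA -!ideal_pow_mul nP nQ.
  by rewrite ideal_scale_mul integers_mul_ideal // ideal_pow_scaleO mulrC.
have [m em] := integers_norm Oal.
pose N := ((p * q) ^ g)%N; have NE : N%:R = (p%:R * q%:R) ^+ g :> algC by rewrite natrX natrM.
have N0 : (0 < N)%N by rewrite expn_gt0 muln_gt0 !prime_gt0.
rewrite em -NE in AA.
(* Passes from ideals to numbers: the quotient of two natural generators is a rational algebraic
   integer, hence an integer. *)
have dvdO u v : (0 < u)%N -> ideal_scale u%:R O = ideal_scale v%:R O -> (u %| v)%N.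
  move=> u0 e; have : ideal_scale v%:R O v%:R by exists 1; rewrite ?mulr1 //; apply: integers1.
  rewrite -e => -[z [_ zA] ez].
  have uC : (u%:R : algC) != 0 by rewrite pnatr_eq0 -lt0n.
  have uQ : (u%:R : rat) != 0 by rewrite pnatr_eq0 -lt0n.
  have [k ek] : exists k : int, (v%:R / u%:R : rat) = k%:~R.
    apply: Aint_rat; suff -> : ratr (v%:R / u%:R) = z :> algC by [].
    by rewrite rmorphM /= fmorphV /= !ratr_nat -ez mulrC mulKf.
  rewrite -[(_ %| _)%N]/((u%:Z %| v%:Z)%Z); apply/dvdzP; exists k.
  by apply/eqP; rewrite -(eqr_int rat) intrM -ek -[(u%:Z)%:~R]/(u%:R) divfK.
have m0 : (0 < m)%N.
  rewrite lt0n -(pnatr_eq0 algC) -em mulf_neq0 // ?conjC_eq0 mulf_neq0 // expf_neq0 //.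
    by rewrite pnatr_eq0 -lt0n prime_gt0.
  by rewrite pnatr_eq0 -lt0n prime_gt0.
have mN : m = N by apply/eqP; rewrite eqn_dvd !dvdO.
have [a1 [b1 ea]] := (imag_quad_fieldP _).1 (integers_sub_field Oal).
have [s [t [ea1 eb1]]] : exists s t : int, a1 = s%:~R / 2 /\ b1 = t%:~R / 2.
  by apply: squarefree_elt => //; rewrite -ea.
have {ea1 eb1}ea : al = quad_elt (s%:~R / 2) (t%:~R / 2) by rewrite ea ea1 eb1.
have eN : s ^+ 2 + d%:Z * t ^+ 2 = (4 * N)%N.
  move: em; rewrite ea norm_elt mN -(ratr_nat _ N) => /(fmorph_inj (ratr : rat -> algC)) h.
  apply/eqP; rewrite -(eqr_int rat) -[X in _ == X]/((4 * N)%N%:R) natrM -h.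
  by rewrite intrD intrM !rmorphXn /=; apply/eqP; field.
exists `|s|%N, `|t|%N; split.
  have := congr1 absz eN; rewrite -[X in absz X](_ : (`|s| ^ 2 + d * `|t| ^ 2)%N%:Z = _).
    by rewrite !absz_nat => ->.
  by rewrite PoszD PoszM -!abszX !gez0_abs ?sqr_ge0.
rewrite coprime_sym coprimeMl !prime_coprime //.
have Pbe x c' : pideal x c' c'.
  by exists 0, 1; rewrite mulr1 mulr0 add0r; split=> //; [apply: integers0|apply: integers1].
have Pp x c' : pideal x c' x%:R.
  by exists 1, 0; rewrite mulr1 mulr0 addr0; split=> //; [apply: integers1|apply: integers0].
apply/andP; split.
  have : A (beta b ^+ g * q%:R ^+ g).
    apply: ideal_mul_in; apply: ideal_pow_in; first exact: Pbe.
    by rewrite /Q pideal_conj.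
  rewrite AE => -[z Oz ez].
  apply: (@prime_ndvd_coef g p b q s t z) => //; last by rewrite -ea.
  by rewrite dvdn_prime2.
(* The prime q is treated like p through conj(A) = Q^g conj(P)^g, whose generator conj([al]) has
   second coordinate of opposite sign. *)
have : ideal_conj A (beta c ^+ g * p%:R ^+ g).
  rewrite cA'; apply: ideal_mul_in; apply: ideal_pow_in; first exact: Pbe.
  by rewrite /P pideal_conj.
rewrite cA => -[z Oz ez].
rewrite -abszN; apply: (@prime_ndvd_coef g q c p s (- t) z) => //.
- by rewrite dvdn_prime2 // eq_sym.
- by rewrite sqrrN eN /N (mulnC q).
- by rewrite -ez ea conj_elt intrN mulNr.
Qed.

Lemma pideal_class p b : prime p -> class_group d (ideal_class d (pideal p (beta b))).
Proof.
by move=> pp; exists (pideal p (beta b)) => //; apply: frac_pideal; [apply: prime_gt0|apply: integers_beta].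
Qed.

(** From b < n and 3 n^2 <= 4 d < 3 S^2 follows b < S, so pairs (b, n) with n dividing b^2 + d list
    all classes. Repetitions are harmless, and this upper bound stands in for a class number
    formula. *)
Lemma class_list S : (4 * d < 3 * S ^ 2)%N ->
  exists2 r : seq (set (set algC)), size r = (\sum_(0 <= b < S) size (divisors (b ^ 2 + d)))%N &
    forall C, class_group d C -> C \in r.
Proof.
move=> dS; exists (flatten [seq [seq ideal_class d (quad_lattice n b) | n <- divisors (b ^ 2 + d)] | b <- iota 0 S]).
  rewrite size_flatten /shape -map_comp sumnE big_map /index_iota subn0.
  by apply: eq_bigr => b _; rewrite /= size_map.
move=> C /class_lattice[n [b [n0 bn n3 nb [_ ->]]]].
apply/flatten_mapP; exists b.
  rewrite mem_iota /= add0n ltnNge; apply/negP => Sb.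
  have : (S ^ 2 <= n ^ 2)%N by rewrite leq_sqr (leq_trans Sb) // ltnW.
  by move: dS n3; move: (S ^ 2)%N (n ^ 2)%N; clear; lia.
by apply/mapP; exists n => //; rewrite -dvdn_divisors // addn_gt0 d_gt0 orbT.
Qed.
End Field.

End Ideals.

(** * Torsion bound from small split primes *)

Lemma sum_sqr_le_seq (T : eqType) (s : seq T) (c : T -> nat) :
  ((\sum_(u <- s) c u) ^ 2 <= size s * \sum_(u <- s) c u ^ 2)%N.
Proof.
rewrite !(big_tnth _ _ s) -lez_nat Posz_expn PoszM.
have sumz (F : 'I_(size s) -> nat) : (\sum_i F i)%N%:Z = \sum_i (F i)%:Z by rewrite (big_morph Posz PoszD (erefl _)).
rewrite !sumz; apply: le_trans (sum_sqr_le _) _; rewrite card_ord natz.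
by under [in leRHS]eq_bigr do rewrite Posz_expn.
Qed.

(** Cauchy-Schwarz over the fibres of [f]: their sizes add up to the size of [s], and their squares
    add up to the number of collisions. *)
Lemma collision_bound (T U : eqType) (s : seq T) (f : T -> U) (r : seq U) :
  (forall x, x \in s -> f x \in r) ->
  (size s ^ 2 <= size r * \sum_(x <- s) \sum_(y <- s) (f x == f y))%N.
Proof.
move=> sr; pose ur := undup r; pose c u := (\sum_(x <- s) (f x == u))%N.
have one (v : U) (g : U -> nat) : v \in ur -> (\sum_(u <- ur) (v == u) * g u = g v)%N.
  move=> vu; rewrite (bigD1_seq v) ?undup_uniq //= eqxx mul1n big1 ?addn0 //.
  by move=> u; rewrite eq_sym => /negPf ->.
have inr x : x \in s -> f x \in ur by move=> /sr; rewrite mem_undup.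
have s1 : (size s = \sum_(u <- ur) c u)%N.
  rewrite /c exchange_big /= -sum1_size big_seq [RHS]big_seq; apply: eq_bigr => x /inr fx.
  by rewrite -[LHS](one (f x) (fun=> 1%N)) //; apply: eq_bigr => u _; rewrite muln1.
have s2 : (\sum_(x <- s) \sum_(y <- s) (f x == f y) = \sum_(u <- ur) c u ^ 2)%N.
  transitivity (\sum_(x <- s) \sum_(u <- ur) (f x == u) * c u)%N.
    rewrite big_seq [RHS]big_seq; apply: eq_bigr => x /inr fx; rewrite one //.
    by apply: eq_bigr => y _; rewrite eq_sym.
  rewrite exchange_big /=; apply: eq_bigr => u _.
  by rewrite -big_distrl /= -/(c u) expnS expn1.
rewrite s2 {1}s1; apply: leq_trans (sum_sqr_le_seq _ _) _.
by rewrite leq_mul2r size_undup orbT.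
Qed.

Section Torsion.
Local Open Scope classical_set_scope.
Variables (d g S : nat).
Hypotheses (d_gt0 : (0 < d)%N) (sq : squarefree d) (g1 : (1 < g)%N) (dS : (4 * d < 3 * S ^ 2)%N).
Let cl : nat := (\sum_(0 <= b < S) tau (b ^ 2 + d))%N.
Let H : set (set (set algC)) := [set C | class_group d C /\ class_pow d C g = principal_class d].
Let HS : seq (set (set algC)) := enum_fset (fset_set H).

Let H_finite : finite_set H.
Proof.
have [r _ Hr] := class_list d_gt0 dS.
apply: (@sub_finite_set _ _ [set` r]); last exact: finite_seq.
by move=> C [/Hr].
Qed.

Let HSP C : C \in HS -> H C.
Proof. by move=> hC; apply: set_mem; rewrite -(in_fset_set H_finite). Qed.

Lemma class_torsion_le : (class_torsion g d <= cl)%N.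
Proof.
have [r sr Hr] := class_list d_gt0 dS; rewrite /cl -[X in (_ <= X)%N]sr.
apply: (@uniq_leq_size _ HS); first exact: fset_uniq.
by move=> C /HSP[/Hr].
Qed.

Variable Q : seq nat.
Hypotheses (Quniq : uniq Q)
  (Qp : {in Q, forall p, [/\ prime p, odd p, ~~ (p %| d)%N & exists b, (p %| b ^ 2 + d)%N]}).

Definition rep_pairs (g d : nat) (Q : seq nat) : nat :=
  (\sum_(p <- Q) \sum_(q <- Q) ((p != q) && `[< norm_rep d g p q >]))%N.

Lemma torsion_bound :
  (class_torsion g d * size Q ^ 2 <= cl * (size Q + rep_pairs g d Q))%N.
Proof.
have [r sr Hr] := class_list d_gt0 dS; rewrite -/cl in sr.
pose b p := xget 0%N [set b | (p %| b ^ 2 + d)%N].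
have bP p : p \in Q -> (p %| (b p) ^ 2 + d)%N.
  by move=> /Qp[_ _ _ exb]; apply: (xgetPex 0%N exb).
pose P p := ideal_class d (pideal d p (quad_elt d (b p)%:R 1)).
have gP p : p \in Q -> class_group d (P p) by move=> /Qp[pp _ _ _]; apply: pideal_class.
have uH : uniq HS by apply: fset_uniq.
set h := class_torsion g d; have hE : h = size HS by [].
case: (posnP h) => [->|h0]; first by rewrite mul0n.
pose s := [seq (C, p) | C <- HS, p <- Q].
pose f (x : set (set algC) * nat) := class_mul x.1 (P x.2).
have fr x : x \in s -> f x \in r.
  move=> /allpairsP[[C p] /= [CH pQ ->]]; apply: Hr.
  by apply: class_group_mul; [case: (HSP CH)|apply: gP].
have := collision_bound fr; rewrite size_allpairs -hE sr => CB.
have coll : (\sum_(x <- s) \sum_(y <- s) (f x == f y) <= h * (size Q + rep_pairs g d Q))%N.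
  rewrite big_allpairs_dep /=.
  under eq_bigr do under eq_bigr do rewrite big_allpairs_dep /=.
  apply: (@leq_trans (\sum_(C <- HS) \sum_(p <- Q) \sum_(q <- Q) ((p == q) || ((p != q) && `[< norm_rep d g p q >])))%N).
    rewrite big_seq [leqRHS]big_seq; apply: leq_sum => C CH.
    rewrite big_seq [leqRHS]big_seq; apply: leq_sum => p pQ.
    rewrite exchange_big /= big_seq [leqRHS]big_seq; apply: leq_sum => q qQ.
    have [gC C1] := HSP CH; have gp := gP p pQ; have gq := gP q qQ.
    case: (boolP (has (fun C' => f (C, p) == f (C', q)) HS)) => [|/hasPn no]; last first.
      by rewrite big1_seq // => C' /andP[_ /no /negPf ->].
    case/hasP => C0 C0H /eqP e0; have [gC0 C01] := HSP C0H.
    (* For fixed [C], [p], [q], cancelling the class of the prime above [q] leaves a single possible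
       partner [C0]. *)
    rewrite (bigD1_seq C0) //= big1_seq ?addn0; last first.
      move=> C' /andP[ne C'H]; have [gC' _] := HSP C'H; apply/eqP; rewrite eqb0.
      apply: contraNN ne => /eqP e; apply/eqP.
      by apply: (class_cancel d_gt0 gq gC' gC0); exact: etrans (esym e) e0.
    rewrite -e0 eqxx /=; case: (eqVneq p q) => //= pq.
    suff : norm_rep d g p q by move=> /asboolP ->.
    have [pp op pd _] := Qp pQ; have [pq' oq qd _] := Qp qQ.
    apply: (same_pow_norm_rep d_gt0 sq g1 pp op pd (bP p pQ) pq' oq qd (bP q qQ) pq).
    (* Raising to the power [g] kills the torsion classes and leaves an equality between g-th powers
       of prime classes. *)
    have := congr1 (fun C => class_pow d C g) e0; rewrite /f /= !class_pow_mul // C1 C01.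
    by rewrite !class_powE // !principal_mull //; eexists; try reflexivity; apply: frac_pow => //; apply: frac_pideal => //; try apply: prime_gt0; try apply: integers_beta.
  rewrite big_const_seq count_predT iter_addn_0 -hE mulnC leq_mul2l.
  apply/orP; right; rewrite -sum1_size -big_split /= big_seq [leqRHS]big_seq.
  apply: leq_sum => p pQ; rewrite -[X in (_ <= X + _)%N](_ : (\sum_(q <- Q) (p == q))%N = 1%N).
    rewrite -big_split /=; apply: leq_sum => q _; by case: eqP.
  by rewrite (bigD1_seq p) //= eqxx big1 ?addn0 // => q; rewrite eq_sym => /negPf ->.
move: CB coll; set T := (\sum_(x <- s) _)%N; set N := (size Q + _)%N => CB coll.
have : ((h * size Q) ^ 2 <= cl * (h * N))%N by apply: leq_trans CB _; rewrite leq_mul2l coll orbT.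
by rewrite expnMn [leqRHS]mulnCA {1}expnS expn1 -mulnA leq_pmul2l.
Qed.
End Torsion.

(** * Uniform bounds on dyadic blocks *)

Section Bounds.
Variable R : realType.
Implicit Types (e z eta C : R) (D d n : nat).

Lemma powR_add (x a b : R) : 0 < x -> x `^ (a + b) = x `^ a * x `^ b.
Proof. by move=> x0; rewrite powRD // (gt_eqF x0) implybT. Qed.

Lemma powR_exp (x a : R) n : (x `^ a) ^+ n = x `^ (a * n%:R).
Proof. by rewrite powRrM powR_mulrn ?powR_ge0. Qed.

Lemma powR_eventually_ge z (B : R) : 0 < z -> exists2 C : R, 0 < C &
  forall x : R, C <= x -> B <= x `^ z.
Proof.
move=> z0; exists (`|B| `^ z^-1 + 1); first by rewrite ltr_wpDl ?powR_ge0.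
move=> x Cx; apply: le_trans (ler_norm B) _.
have -> : `|B| = (`|B| `^ z^-1) `^ z by rewrite -powRrM mulVf ?gt_eqF // powRr1.
apply: ge0_ler_powR; rewrite ?nnegrE ?powR_ge0 ?(ltW z0) //.
  by apply: le_trans Cx; rewrite addr_ge0 ?powR_ge0.
by apply: le_trans Cx; rewrite lerDl.
Qed.

Lemma powR_le1 (x a : R) : 1 <= x -> 0 <= a -> 1 <= x `^ a.
Proof. by move=> x1 a0; rewrite -(powRr0 x) ler_powR. Qed.

Lemma classes_le e : 0 < e -> exists2 C : R, 0 < C & forall D d, (0 < D)%N -> (D <= d < 2 * D)%N ->
  exists2 S, (4 * d < 3 * S ^ 2)%N &
    (\sum_(0 <= b < S) tau (b ^ 2 + d))%N%:R <= C * D%:R `^ (2^-1 + e).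
Proof.
move=> e0; have [C0 C00 HC0] := tau_le e0.
exists (3 * (C0 * 6 `^ e)); first by rewrite !mulr_gt0 ?powR_gt0.
move=> D d D0 /andP[Dd dD]; set t := Num.sqrt (D%:R : R).
have t1 : 1 <= t by rewrite -[leLHS]sqrtr1 ler_sqrt ?ler1n ?ltr0n.
have t2 : t ^+ 2 = D%:R by rewrite sqr_sqrtr ?ler0n.
have t0 : 0 <= 2 * t by lra.
(* With S > 2 sqrt(D), 3 S^2 > 12 D > 4 d; and b <= 2 sqrt(D) keeps b^2 + d below 6 D. *)
exists (Num.truncn (2 * t)).+1.
  have : 2 * t < (Num.truncn (2 * t)).+1%:R by apply: truncnS_gt.
  rewrite -(@ltr_pXn2r _ 2) ?nnegrE ?ler0n // exprMn t2 -natrX -natrX -natrM ltr_nat.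
  by move: ((Num.truncn (2 * t)).+1 ^ 2)%N dD => M; rewrite -[(2 ^ 2)%N]/4%N; clear; lia.
rewrite big_nat; apply: (@le_trans _ _ (\sum_(0 <= b < (Num.truncn (2 * t)).+1) (C0 * (6 * D%:R) `^ e))).
  rewrite natr_sum -big_nat big_nat [leRHS]big_nat; apply: ler_sum => b /andP[_ bS].
  have b4 : (b ^ 2 <= 4 * D)%N.
    rewrite ltnS truncn_ge_nat // in bS.
    rewrite -(ler_nat R) natrX natrM -t2; have b0 : 0 <= b%:R :> R by rewrite ler0n.
    by nra.
  apply: le_trans (HC0 _ _) _; first by rewrite addn_gt0 (leq_trans D0 Dd) orbT.
  rewrite ler_pM2l //; apply: ge0_ler_powR; rewrite ?nnegrE ?(ltW e0) ?ler0n ?mulr_ge0 //.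
  by rewrite -natrM ler_nat; move: (b ^ 2)%N b4 dD => ?; clear; lia.
rewrite sumr_const_nat subn0 -[X in X <= _]mulr_natl powRM ?ler0n // powR_add ?ltr0n //.
rewrite powR12_sqrt ?ler0n // -/t.
have -> : 3 * (C0 * 6 `^ e) * (t * D%:R `^ e) = (3 * t) * (C0 * (6 `^ e * D%:R `^ e)) by ring.
rewrite ler_wpM2r ?mulr_ge0 ?powR_ge0 ?(ltW C00) // -natr1.
have : (Num.truncn (2 * t))%:R <= 2 * t by rewrite truncn_le.
lra.
Qed.

Definition primes_upto z D : seq nat := odd_primes (Num.truncn (D%:R `^ z : R)).

Lemma trunc_powR_le z D : (Num.truncn (D%:R `^ z : R))%:R <= D%:R `^ z :> R.
Proof. by rewrite truncn_le powR_ge0. Qed.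

Lemma size_primes_upto_le z D : (size (primes_upto z D))%:R <= D%:R `^ z :> R.
Proof.
apply: le_trans (trunc_powR_le z D); rewrite ler_nat.
set Z := Num.truncn _; rewrite -[leqRHS](size_iota 1); apply: uniq_leq_size.
  exact: odd_primes_uniq.
by move=> p; rewrite odd_primesP mem_iota add1n ltnS => /and3P[/prime_gt0 -> _ ->].
Qed.

Lemma size_primes_upto_ge z e : 0 < z <= 1 -> 0 < e -> exists2 C : R, 0 < C &
  forall D, C <= D%:R -> D%:R `^ z <= C * D%:R `^ e * (size (primes_upto z D))%:R.
Proof.
move=> /andP[z0 z1] e0; have [C1 C10 HC1] := odd_primes_ge e0.
have [C2 C20 HC2] := powR_eventually_ge 3 z0.
exists (2 * C1 + C2 + 1); first by rewrite !addr_gt0 ?mulr_gt0.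
move=> D CD; have D1 : 1 <= D%:R :> R by apply: le_trans CD; rewrite lerDr !addr_ge0 ?mulr_ge0 // ltW.
have D3 : 3 <= D%:R `^ z :> R by apply: HC2; apply: le_trans CD; lra.
set Z := Num.truncn (D%:R `^ z : R).
have Z3 : (3 <= Z)%N by rewrite /Z truncn_ge_nat ?powR_ge0.
have ZD : Z%:R <= D%:R `^ z :> R := trunc_powR_le z D.
have DZ : D%:R `^ z <= 2 * Z%:R :> R.
  have : D%:R `^ z < Z.+1%:R :> R by apply: truncnS_gt.
  have : 1 <= Z%:R :> R by rewrite ler1n; lia.
  rewrite -natr1; lra.
apply: le_trans DZ _; apply: (@le_trans _ _ (2 * (C1 * (size (odd_primes Z))%:R * Z%:R `^ e))).
  by rewrite ler_pM2l // HC1.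
have Ze : Z%:R `^ e <= D%:R `^ e :> R.
  apply: ge0_ler_powR; rewrite ?nnegrE ?ler0n ?(ltW e0) //; apply: le_trans ZD _.
  by rewrite -[leRHS]powRr1 ?ler0n // ler_powR.
rewrite -/(primes_upto z D); set P := (size _)%:R.
have P0 : 0 <= P by rewrite ler0n.
rewrite [leRHS]mulrAC mulrA; apply: ler_pM => //; rewrite ?powR_ge0 //.
  by rewrite !mulr_ge0 // ltW.
by rewrite mulrA ler_wpM2r //; lra.
Qed.

Definition split_primes d (P : seq nat) : seq nat := [seq p <- P | chi d p == 1].

Definition block D : seq nat := [seq d <- index_iota D (2 * D) | `[< squarefree d >]].

Lemma blockP D d : d \in block D -> (0 < D)%N -> [/\ (D <= d < 2 * D)%N, squarefree d & pos_squarefree d].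
Proof.
rewrite mem_filter mem_index_iota => /andP[/asboolP sq Dd] D0; split=> //; split=> //.
by apply: leq_trans D0 _; case/andP: Dd.
Qed.

Lemma block_uniq D : uniq (block D).
Proof. by rewrite filter_uniq ?iota_uniq. Qed.

Definition exceptional z D : seq nat :=
  [seq d <- block D | (8 * size (split_primes d (primes_upto z D)) < size (primes_upto z D))%N].

(** Fewer than 1/8 of the primes split and, as ramified primes divide d, at most 1/4 ramify. More
    than 5/8 are then inert, and the sum is below -1/2 of the size of [P]. *)
Lemma exceptional_chi_sum d (P : seq nat) : pos_squarefree d -> uniq P ->
  {in P, forall p, prime p && odd p} ->
  (8 * size (split_primes d P) < size P)%N -> (4 * tau d <= size P)%N ->
  (size P)%:Z <= 2 * `| \sum_(p <- P) chi d p |.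
Proof.
move=> sd uP Pp ex ram; have [d0 sq] := sd.
have sumE : \sum_(p <- P) chi d p =
    (count (fun p => chi d p == 1) P)%:Z - (count (fun p => chi d p == -1) P)%:Z.
  elim: (P) => [|p s IH]; first by rewrite big_nil.
  rewrite big_cons IH /=; have := chi_values d p.
  by rewrite !inE => /or3P[] /eqP -> /=; rewrite !PoszD; ring.
have szE : (size P = count (fun p => chi d p == 1) P + count (fun p => chi d p == -1)%R P +
    count (fun p => chi d p == 0) P)%N.
  elim: (P) => // p s IH /=; rewrite {1}IH; have := chi_values d p.
  by rewrite !inE => /or3P[] /eqP -> /=; clear; lia.
have r0 : (count (fun p => chi d p == 0) P <= tau d)%N.
  rewrite -size_filter; apply: uniq_leq_size; first by rewrite filter_uniq.
  move=> p; rewrite mem_filter => /andP[/eqP c0 /Pp /andP[pp op]].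
  by rewrite -dvdn_divisors //; apply: chi_prime0.
move: ex; rewrite /split_primes size_filter sumE => ex.
move: ex ram r0 szE; set a := count _ P; set b := count _ P; set c := count _ P; set t := tau d.
move: (size P) => N; move: a b c t; clear; lia.
Qed.

(** The moment [m] is taken so large that |P|^m exceeds a multiple of D^2, which absorbs the
    off-diagonal part of the sieve; what remains is D^(m z) / |P|^m, only as large as Chebyshev's
    loss. *)
Lemma exceptional_le z e : 0 < z <= 1 -> 0 < e -> exists2 C : R, 0 < C &
  forall D, C <= D%:R -> (size (exceptional z D))%:R <= C * D%:R `^ e.
Proof.
move=> /andP[z0 z1] e0.
(* Even, with m z >= 6, so that even half of z leaves |P|^m >> D^3. *)
pose m := (2 * (Num.truncn (3 / z)).+1)%N.
have m0 : 0 < m%:R :> R by rewrite ltr0n.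
have mz : 6 <= m%:R * z.
  have : 3 / z < (Num.truncn (3 / z)).+1%:R by apply: truncnS_gt.
  by rewrite ltr_pdivrMr // /m natrM; lra.
(* The first bound keeps |P| >> D^(z/2); the second keeps the total loss D^(m e') within D^e. *)
pose e' := Num.min (z / 2) (e / m%:R).
have e'0 : 0 < e' by rewrite lt_min !divr_gt0.
have e'z : e' <= z / 2 by rewrite ge_min lexx.
have e'm : m%:R * e' <= e by rewrite mulrC -ler_pdivlMr // ge_min lexx orbT.
have [C1 C10 HC1] := size_primes_upto_ge (introT andP (conj z0 z1)) e'0.
have z40 : 0 < z / 4 by rewrite divr_gt0.
have [C2 C20 HC2] := tau_le z40.
have [C3 C30 HC3] := powR_eventually_ge (4 * C1 * C2 * 2 `^ (z / 4)) z40.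
pose M : R := (4 * m%:R) ^+ m; have M0 : 0 < M by rewrite exprn_gt0 // mulr_gt0.
have C1m : 0 < C1 ^+ m by rewrite exprn_gt0.
have MC : 0 < M * C1 ^+ m by rewrite mulr_gt0.
exists (C1 + C3 + 64 * (M * C1 ^+ m) + 1); first by lra.
move=> D CD; have [D1 DC1 DC3 DM] : [/\ 1 <= D%:R :> R, C1 <= D%:R, C3 <= D%:R & 64 * (M * C1 ^+ m) <= D%:R].
  by split; lra.
have D0 : (0 < D)%N by rewrite -(ler1n R).
have DR0 : 0 < D%:R :> R by rewrite ltr0n.
set P := primes_upto z D; set E := exceptional z D.
have Plow : D%:R `^ (z - e') <= C1 * (size P)%:R.
  have := HC1 D DC1; rewrite -/P => h; rewrite powR_add // powRN ler_pdivrMr ?powR_gt0 //.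
  by rewrite mulrAC.
have P0 : (0 < size P)%N.
  rewrite -(ltr0n R) -(pmulr_rgt0 _ C10); apply: lt_le_trans Plow; exact: powR_gt0.
have Pm : D%:R `^ (m%:R * (z - e')) <= C1 ^+ m * (size P)%:R ^+ m.
  rewrite mulrC -powR_exp -exprMn; apply: lerXn2r; rewrite ?nnegrE ?powR_ge0 //.
  by rewrite mulr_ge0 // ltW.
have ram d : d \in block D -> (4 * tau d <= size P)%N.
  move=> dB; have [/andP[Dd dD] _ [d0 _]] := blockP dB D0.
  rewrite -(ler_nat R) natrM -(ler_pM2l C10); apply: le_trans Plow.
  apply: (@le_trans _ _ (4 * C1 * (C2 * (2 * D%:R) `^ (z / 4)))).
    rewrite mulrA (mulrC C1) ler_pM2l ?mulr_gt0 //; apply: le_trans (HC2 d d0) _.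
    rewrite ler_pM2l //; apply: ge0_ler_powR; rewrite ?nnegrE ?ler0n ?(ltW z40) ?mulr_ge0 //.
    by rewrite -natrM ler_nat ltnW.
  rewrite powRM ?ler0n //.
  apply: (@le_trans _ _ (D%:R `^ (z / 4) * D%:R `^ (z / 4))).
    have := HC3 _ DC3; set w := 2 `^ (z / 4); set y := D%:R `^ (z / 4) => h.
    have -> : 4 * C1 * (C2 * (w * y)) = (4 * C1 * C2 * w) * y by ring.
    by rewrite ler_pM2r ?powR_gt0.
  by rewrite -powR_add // ler_powR //; lra.
have EP : {in E, forall d, (size P)%:Z <= 2 * `| \sum_(p <- P) chi d p |}.
  move=> d; rewrite mem_filter => /andP[ex dB]; have [_ _ sd] := blockP dB D0.
  apply: exceptional_chi_sum => //; [exact: odd_primes_uniq| |exact: ram].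
  by move=> p; rewrite odd_primesP => /and3P[-> -> _].
set Z := Num.truncn (D%:R `^ z : R).
have LS : (size E * size P ^ m <= (4 * m) ^ m * ((Z ^ m).+1 + size E * (8 * (2 * D) * (2 * D))))%N.
  apply: large_sieve => //.
  - by move=> p; rewrite odd_primesP => /and3P[].
  - by move=> p; rewrite odd_primesP => /and3P[].
  - by rewrite filter_uniq ?block_uniq.
  - exact: odd_primes_uniq.
  - by move=> d; rewrite mem_filter => /andP[_ /blockP /(_ D0)[]].
  - move=> d; rewrite mem_filter => /andP[_ /blockP /(_ D0)[/andP[_ /ltnW]]] //.
  - by rewrite /m mul2n odd_double.
set x : R := (size E)%:R; have x0 : 0 <= x by rewrite ler0n.
set p : R := (size P)%:R ^+ m in Pm.
have p0 : 0 < p by rewrite exprn_gt0 // ltr0n.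
have LSR : x * p <= M * (Z%:R ^+ m + 1 + x * (32 * D%:R ^+ 2)).
  have eL : (size E * size P ^ m)%N%:R = x * p :> R by rewrite natrM natrX.
  have e32 : (8 * (2 * D) * (2 * D))%N%:R = 32 * D%:R ^+ 2 :> R by rewrite !natrM; ring.
  have eR : ((4 * m) ^ m * ((Z ^ m).+1 + size E * (8 * (2 * D) * (2 * D))))%N%:R =
      M * (Z%:R ^+ m + 1 + x * (32 * D%:R ^+ 2)) :> R.
    rewrite natrM; congr (_ * _); first by rewrite natrX natrM.
    by rewrite natrD -natr1 natrX natrM e32.
  by rewrite -eL -eR ler_nat.
(* Twice the coefficient of x on the right of [LSR]: the off-diagonal term is at most half of the
   left side. One of the three powers of D pays for the constants. *)
have big : 64 * M * D%:R ^+ 2 <= p.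
  rewrite -(ler_pM2l C1m); apply: le_trans Pm; apply: (@le_trans _ _ (D%:R ^+ 3)).
    have -> : C1 ^+ m * (64 * M * D%:R ^+ 2) = 64 * (M * C1 ^+ m) * D%:R ^+ 2 by ring.
    by rewrite exprS ler_wpM2r // exprn_ge0.
  rewrite -powR_mulrn ?ler0n // ler_powR //.
  have : m%:R * (z / 2) <= m%:R * (z - e') by rewrite ler_pM2l //; lra.
  lra.
have ZD : Z%:R ^+ m <= D%:R `^ (m%:R * z) :> R.
  rewrite mulrC -powR_exp; apply: lerXn2r; rewrite ?nnegrE ?powR_ge0 ?ler0n //; exact: trunc_powR_le.
have ZD1 : 1 <= D%:R `^ (m%:R * z) :> R by apply: powR_le1 => //; lra.
have xp : x * p <= 4 * M * D%:R `^ (m%:R * z).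
  have h1 : x * (64 * M * D%:R ^+ 2) <= x * p by rewrite ler_wpM2l.
  have h2 : M * (Z%:R ^+ m + 1) <= M * (2 * D%:R `^ (m%:R * z)) by rewrite ler_pM2l //; lra.
  have h3 : M * (Z%:R ^+ m + 1 + x * (32 * D%:R ^+ 2)) =
    M * (Z%:R ^+ m + 1) + x * (64 * M * D%:R ^+ 2) / 2 by field.
  lra.
have xfin : x <= 4 * (M * C1 ^+ m) * D%:R `^ (m%:R * e').
  rewrite -(ler_pM2r p0); apply: le_trans xp _.
  have -> : m%:R * z = m%:R * e' + m%:R * (z - e') by ring.
  rewrite powR_add // -!mulrA; rewrite ler_pM2l // ler_pM2l // mulrCA.
  rewrite [leRHS](_ : _ = D%:R `^ (m%:R * e') * (C1 ^+ m * p)); last by ring.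
  by rewrite ler_pM2l ?powR_gt0.
apply: le_trans xfin _; apply: ler_pM; [by rewrite mulr_ge0 // ltW|exact: powR_ge0|lra|].
by rewrite ler_powR.
Qed.

Lemma rep_pairs_sub g d (P Q : seq nat) : subseq Q P -> (rep_pairs g d Q <= rep_pairs g d P)%N.
Proof.
have sub (f : nat -> nat) : subseq Q P -> (\sum_(p <- Q) f p <= \sum_(p <- P) f p)%N.
  elim: P Q => [|p P IH] [|q Q] //=; rewrite ?big_nil //.
  case: eqP => [->|_] s; first by rewrite !big_cons leq_add2l IH.
  by rewrite [leqRHS]big_cons (leq_trans (IH _ s)) // leq_addl.
move=> s; rewrite /rep_pairs.
apply: leq_trans (sub _ s); apply: leq_sum => p _; exact: sub.
Qed.

Lemma class_torsion_block e g : (1 < g)%N -> 0 < e -> exists2 C : R, 0 < C &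
  forall D, (0 < D)%N -> {in block D, forall d,
    (class_torsion g d)%:R <= C * D%:R `^ (2^-1 + e)}.
Proof.
move=> g1 e0; have [C C0 HC] := classes_le e0; exists C => // D D0 d dB.
have [Dd sq [d0 _]] := blockP dB D0; have [S dS HS] := HC D d D0 Dd.
apply: le_trans HS; rewrite ler_nat; exact: class_torsion_le.
Qed.

(** Apply [torsion_bound] to the split primes, which make up at least 1/8 of all, whence the 64. The
    loss e is shared between the class number and the two factors |P| of the division by |P|^2. *)
Lemma torsion_nonexceptional z e g : (1 < g)%N -> 0 < z <= 1 -> 0 < e ->
  exists2 C : R, 0 < C & forall D, C <= D%:R -> {in block D, forall d,
    d \notin exceptional z D ->
    (class_torsion g d)%:R <= C * D%:R `^ (2^-1 - 2 * z + e) *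
      (D%:R `^ z + (rep_pairs g d (primes_upto z D))%:R)}.
Proof.
move=> g1 zz e0; have e30 : 0 < e / 3 by rewrite divr_gt0.
have [C1 C10 HC1] := size_primes_upto_ge zz e30.
have [C2 C20 HC2] := classes_le e30.
exists (C1 + 64 * C2 * C1 ^+ 2 + 1).
  by rewrite !addr_gt0 // !mulr_gt0 // exprn_gt0.
have C3 : 0 < C2 * C1 ^+ 2 by rewrite mulr_gt0 // exprn_gt0.
move=> D CD d dB; have [D1 DC1] : 1 <= D%:R :> R /\ C1 <= D%:R by split; lra.
have D0 : (0 < D)%N by rewrite -(ler1n R).
have DR0 : 0 < D%:R :> R by rewrite ltr0n.
rewrite mem_filter dB andbT -leqNgt => ex.
have [Dd sq sd] := blockP dB D0; have [d0 _] := sd.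
have [S dS HS] := HC2 D d D0 Dd.
set P := primes_upto z D in ex *; set Q := split_primes d P in ex *.
have Plow := HC1 D DC1; rewrite -/P in Plow.
have P0 : (0 < size P)%N.
  rewrite lt0n; apply/eqP => p0; move: Plow; rewrite p0 mulr0 leNgt powR_gt0 //.
have Q0 : (0 < size Q)%N by move: ex P0; clear; lia.
have Qp : {in Q, forall p, [/\ prime p, odd p, ~~ (p %| d)%N & exists b, (p %| b ^ 2 + d)%N]}.
  move=> p; rewrite mem_filter odd_primesP => /andP[/eqP c1 /and3P[pp op _]].
  by have [] := chi_prime1 d0 sd.2 pp op c1.
have Qu : uniq Q by rewrite filter_uniq ?odd_primes_uniq.
have := torsion_bound d0 sq g1 dS Qu Qp; set cl := (\sum_(0 <= b < S) _)%N in HS * => TB.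
have NQ : (rep_pairs g d Q <= rep_pairs g d P)%N by apply: rep_pairs_sub; apply: filter_subseq.
set N := rep_pairs g d P in NQ *; set h := class_torsion g d in TB *.
have key : (h * size P ^ 2 <= 64 * (cl * (size P + N)))%N.
  have qP : (size Q <= size P)%N by rewrite size_filter count_size.
  apply: (@leq_trans (h * (8 * size Q) ^ 2)%N); first by rewrite leq_mul2l leq_sqr ex orbT.
  rewrite expnMn mulnCA -[(8 ^ 2)%N]/64%N leq_mul2l /=; apply: leq_trans TB _.
  by rewrite leq_mul2l leq_add ?orbT.
have key2 : h%:R * (size P)%:R ^+ 2 <= 64 * (C2 * D%:R `^ (2^-1 + e / 3)) * (D%:R `^ z + N%:R) :> R.
  apply: (@le_trans _ _ (64 * (cl * (size P + N)))%N%:R).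
    by rewrite -natrX -natrM ler_nat.
  rewrite natrM natrM natrD mulrA; apply: ler_pM; rewrite ?mulr_ge0 ?addr_ge0 //.
    by rewrite ler_pM2l.
  by rewrite lerD2r size_primes_upto_le.
have DN : 0 <= D%:R `^ z + N%:R :> R by rewrite addr_ge0 ?powR_ge0.
set pz := D%:R `^ z in Plow DN key2 *; have pz0 : 0 < pz by rewrite powR_gt0.
have sqP : pz ^+ 2 <= (C1 * D%:R `^ (e / 3)) ^+ 2 * (size P)%:R ^+ 2.
  rewrite -exprMn; apply: lerXn2r; rewrite ?nnegrE ?(ltW pz0) //.
  by rewrite !mulr_ge0 ?powR_ge0 // ltW.
have step : h%:R * pz ^+ 2 <= 64 * C2 * C1 ^+ 2 * D%:R `^ (2^-1 + e) * (pz + N%:R) :> R.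
  apply: (@le_trans _ _ (h%:R * ((C1 * D%:R `^ (e / 3)) ^+ 2 * (size P)%:R ^+ 2))).
    by rewrite ler_wpM2l.
  have -> : h%:R * ((C1 * D%:R `^ (e / 3)) ^+ 2 * (size P)%:R ^+ 2) =
     (C1 * D%:R `^ (e / 3)) ^+ 2 * (h%:R * (size P)%:R ^+ 2) by ring.
  apply: (@le_trans _ _ ((C1 * D%:R `^ (e / 3)) ^+ 2 * (64 * (C2 * D%:R `^ (2^-1 + e / 3)) * (pz + N%:R)))).
    by rewrite ler_wpM2l // sqr_ge0.
  have -> : 2^-1 + e = (2^-1 + e / 3) + (e / 3 + e / 3) by field.
  rewrite [D%:R `^ (_ + (e / 3 + e / 3))]powR_add // [D%:R `^ (e / 3 + e / 3)]powR_add //.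
  by rewrite le_eqVlt; apply/orP; left; apply/eqP; ring.
have -> : 2^-1 - 2 * z + e = (2^-1 + e) - (z + z) by ring.
rewrite powR_add // powRN (powR_add z z DR0) -/pz.
have pzz : 0 < pz * pz by rewrite mulr_gt0.
rewrite mulrA mulrAC -(ler_pM2r pzz) -expr2 divfK ?gt_eqF //.
  apply: le_trans step _; rewrite ler_wpM2r // ler_wpM2r ?powR_ge0 //; lra.
Qed.

(** Exchange the sums: there are at most D^(2 z) pairs of primes, and each is handled by [rep_count]
    with n = (p q)^g <= D^(2 g z). *)
Lemma rep_pairs_sum z e g : (0 < g)%N -> 0 < z <= 1 -> 0 < e ->
  exists2 C : R, 0 < C & forall D, (0 < D)%N ->
    (\sum_(d <- block D) rep_pairs g d (primes_upto z D))%N%:R <=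
      C * D%:R `^ (2 * z + e) * (D%:R `^ 2^-1 + D%:R `^ (g%:R * z - 2^-1)).
Proof.
move=> g0 /andP[z0 z1] e0; have gR : 0 < g%:R :> R by rewrite ltr0n.
(* As y^2 <= 4 n <= 4 D^(2 g), this makes tau(y^2) << D^e. *)
pose e' := e / (2 * g%:R); have e'0 : 0 < e' by rewrite divr_gt0 // mulr_gt0.
have [C1 C10 HC1] := tau_le e'0.
exists (8 * (C1 * 4 `^ e')); first by rewrite !mulr_gt0 ?powR_gt0.
move=> D D0; have D1 : 1 <= D%:R :> R by rewrite ler1n.
have DR0 : 0 < D%:R :> R by rewrite ltr0n.
set P := primes_upto z D.
pose B : R := C1 * 4 `^ e' * D%:R `^ e * (8 * D%:R `^ 2^-1 + 2 * D%:R `^ (g%:R * z - 2^-1)).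
have B0 : 0 <= B by rewrite !mulr_ge0 ?addr_ge0 ?mulr_ge0 ?powR_ge0 // ltW.
have inner p q : p \in P -> q \in P ->
    (\sum_(d <- block D) ((p != q) && `[< norm_rep d g p q >]))%N%:R <= B.
  rewrite !odd_primesP => /and3P[pp op pZ] /and3P[pq oq qZ].
  pose Es := [seq d <- block D | (p != q) && `[< norm_rep d g p q >]].
  have -> : (\sum_(d <- block D) ((p != q) && `[< norm_rep d g p q >]))%N = size Es.
    by rewrite size_filter -sum1_count [RHS]big_mkcond; apply: eq_bigr => d _; case: ifP.
  pose n := ((p * q) ^ g)%N.
  have pq1 : (1 < p * q)%N by rewrite (leq_trans (prime_gt1 pp)) // leq_pmulr // prime_gt0.
  have n1 : (1 < n)%N by rewrite /n -(exp1n g) ltn_exp2r.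
  have nR : n%:R <= D%:R `^ (2 * g%:R * z) :> R.
    have -> : 2 * g%:R * z = (z + z) * g%:R by ring.
    rewrite -powR_exp natrX powR_add //; apply: lerXn2r; rewrite ?nnegrE ?mulr_ge0 ?powR_ge0 //.
    rewrite natrM; apply: ler_pM => //; apply: le_trans (trunc_powR_le z D); by rewrite ler_nat.
  have nD : n%:R <= D%:R `^ (2 * g%:R) :> R.
    apply: le_trans nR _; rewrite ler_powR // -[leRHS]mulr1 ler_pM2l // mulr_gt0 //.
  pose T := Num.truncn (C1 * 4 `^ e' * D%:R `^ e).
  have T0 : 0 <= C1 * 4 `^ e' * D%:R `^ e by rewrite !mulr_ge0 ?powR_ge0 // ltW.
  have HT y : (0 < y)%N -> (y ^ 2 <= 4 * n)%N -> (tau (y ^ 2) <= T)%N.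
    move=> y0 yn; rewrite /T truncn_ge_nat //; apply: le_trans (HC1 _ _) _; first by rewrite expn_gt0 y0.
    rewrite -mulrA ler_pM2l //; apply: (@le_trans _ _ ((4 * D%:R `^ (2 * g%:R)) `^ e')).
      apply: ge0_ler_powR; rewrite ?nnegrE ?(ltW e'0) ?mulr_ge0 ?powR_ge0 //.
      apply: (@le_trans _ _ (4 * n)%N%:R); first by rewrite ler_nat.
      by rewrite natrM ler_pM2l.
    rewrite powRM ?powR_ge0 // -powRrM ler_pM2l ?powR_gt0 //.
    by rewrite /e' mulrC divfK // gt_eqF // mulr_gt0.
  have HE : {in Es, forall d, (D <= d < 2 * D)%N /\
     exists x y, (4 * n = x ^ 2 + d * y ^ 2)%N /\ coprime y n}.
    move=> d; rewrite mem_filter => /andP[/andP[_ /asboolP[x [y [exy cy]]]] /blockP /(_ D0)[Dd _ _]].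
    by split=> //; exists x, y; split=> //; rewrite /n coprimeXr.
  have uE : uniq Es by rewrite filter_uniq ?block_uniq.
  apply: le_trans (rep_count R D0 n1 uE HT HE) _; apply: ler_pM; rewrite ?ler0n //.
    by rewrite truncn_le.
  rewrite -[Num.sqrt D%:R]powR12_sqrt ?ler0n // lerD2l ler_pM2l // powR_add // powRN.
  rewrite ler_pM2r ?invr_gt0 ?powR_gt0 // -powR12_sqrt ?ler0n //.
  have -> : g%:R * z = (2 * g%:R * z) * 2^-1 by field.
  rewrite (powRrM _ (2 * g%:R * z)); apply: ge0_ler_powR; rewrite ?nnegrE ?powR_ge0 ?invr_ge0 ?ler0n //.
have -> : (\sum_(d <- block D) rep_pairs g d P = \sum_(p <- P) \sum_(q <- P)
     \sum_(d <- block D) ((p != q) && `[< norm_rep d g p q >]))%N.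
  by rewrite /rep_pairs exchange_big /=; apply: eq_bigr => p _; rewrite exchange_big.
rewrite natr_sum; apply: (@le_trans _ _ (\sum_(p <- P) \sum_(q <- P) B)).
  rewrite big_seq [leRHS]big_seq; apply: ler_sum => p pP; rewrite natr_sum.
  by rewrite big_seq [leRHS]big_seq; apply: ler_sum => q qP; apply: inner.
rewrite !big_const_seq !count_predT !iter_addr_0 -mulrnA -[X in X <= _]mulr_natl natrM.
have Pz : (size P)%:R <= D%:R `^ z :> R := size_primes_upto_le z D.
apply: (@le_trans _ _ (D%:R `^ z * D%:R `^ z * B)).
  by apply: ler_wpM2r => //; apply: ler_pM.
have -> : 2 * z + e = z + z + e by ring.
rewrite powR_add // powR_add // /B; set u := D%:R `^ 2^-1; set v := D%:R `^ (_ - _).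
have v0 : 0 <= v by rewrite powR_ge0.
have -> : 8 * (C1 * 4 `^ e') * (D%:R `^ z * D%:R `^ z * D%:R `^ e) * (u + v) =
   D%:R `^ z * D%:R `^ z * (C1 * 4 `^ e' * D%:R `^ e * (8 * u + 8 * v)) by ring.
apply: ler_wpM2l; first by rewrite mulr_ge0 ?powR_ge0.
apply: ler_wpM2l; first by rewrite !mulr_ge0 ?powR_ge0 // ltW.
lra.
Qed.

(** A representation has y > 0, so D <= d <= 4 (p q)^g <= 4 D^(2 g z), which fails for large D. This
    is where the 1/(2 g) in [expo2] originates. *)
Lemma rep_pairs_eq0 z g : (0 < g)%N -> 0 < z -> 2 * g%:R * z < 1 ->
  exists2 C : R, 0 < C & forall D, C <= D%:R -> {in block D, forall d,
    rep_pairs g d (primes_upto z D) = 0%N}.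
Proof.
move=> g0 z0 gz; have a0 : 0 < 1 - 2 * g%:R * z by rewrite subr_gt0.
have [C C0 HC] := powR_eventually_ge 5 a0.
exists (C + 1); first by rewrite addr_gt0.
move=> D CD d dB; have [D1 DC] : 1 <= D%:R :> R /\ C <= D%:R by split; lra.
have D0 : (0 < D)%N by rewrite -(ler1n R).
have DR0 : 0 < D%:R :> R by rewrite ltr0n.
have [/andP[Dd _] _ _] := blockP dB D0.
rewrite /rep_pairs big_seq big1 // => p pP; rewrite big_seq big1 // => q qP.
apply/eqP; rewrite eqb0; apply/negP => /andP[_ /asboolP[x [y [e cy]]]].
move: pP qP; rewrite !odd_primesP => /and3P[pp op pZ] /and3P[pq oq qZ].
have y0 : (0 < y)%N.
  rewrite lt0n; apply: contraTneq cy => ->; rewrite /coprime gcd0n.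
  by rewrite gtn_eqF // (leq_trans (prime_gt1 pp)) // leq_pmulr // prime_gt0.
have dn : (D <= 4 * (p * q) ^ g)%N.
  rewrite e (leq_trans Dd) // (leq_trans _ (leq_addl _ _)) // leq_pmulr // expn_gt0 y0 //.
have nR : ((p * q) ^ g)%N%:R <= D%:R `^ (2 * g%:R * z) :> R.
  have -> : 2 * g%:R * z = (z + z) * g%:R by ring.
  rewrite -powR_exp natrX powR_add //; apply: lerXn2r; rewrite ?nnegrE ?mulr_ge0 ?powR_ge0 //.
  rewrite natrM; apply: ler_pM => //; apply: le_trans (trunc_powR_le z D); by rewrite ler_nat.
have : D%:R <= 4 * D%:R `^ (2 * g%:R * z) :> R.
  apply: (@le_trans _ _ (4 * (p * q) ^ g)%N%:R); first by rewrite ler_nat.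
  by rewrite natrM ler_pM2l.
have DE : D%:R = D%:R `^ (1 - 2 * g%:R * z) * D%:R `^ (2 * g%:R * z) :> R.
  by rewrite -powR_add // subrK powRr1 // ltW.
rewrite {1}DE ler_pM2r ?powR_gt0 // leNgt => /negP; apply.
by apply: lt_le_trans (HC _ DC); rewrite ltr_nat.
Qed.
End Bounds.

(** * Moments *)

Section Moments.
Variable R : realType.
Implicit Types (e z C : R) (D d n : nat).

(* C is both the implied constant and the threshold above which the bounds hold,
   which makes the statement monotone in C. *)
Definition grid_facts (g : nat) z e C : Prop := forall D, C <= D%:R ->
  [/\ (size (exceptional z D))%:R <= C * D%:R `^ e,
      {in block D, forall d, d \notin exceptional z D ->
        (class_torsion g d)%:R <= C * D%:R `^ (2^-1 - 2 * z + e) *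
          (D%:R `^ z + (rep_pairs g d (primes_upto z D))%:R)},
      (\sum_(d <- block D) rep_pairs g d (primes_upto z D))%N%:R <=
        C * D%:R `^ (2 * z + e) * (D%:R `^ 2^-1 + D%:R `^ (g%:R * z - 2^-1)) &
      2 * g%:R * z < 1 -> {in block D, forall d, rep_pairs g d (primes_upto z D) = 0%N}].

Lemma grid_facts_mono g z e C C' : C <= C' -> grid_facts g z e C -> grid_facts g z e C'.
Proof.
move=> CC H D CD; have [h1 h2 h3 h4] := H D (le_trans CC CD); split => //.
- by apply: le_trans h1 _; rewrite ler_wpM2r ?powR_ge0.
- move=> d dB ex; apply: le_trans (h2 d dB ex) _.
  by rewrite ler_wpM2r ?addr_ge0 ?powR_ge0 // ler_wpM2r ?powR_ge0.
- apply: le_trans h3 _.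
  by rewrite ler_wpM2r ?addr_ge0 ?powR_ge0 // ler_wpM2r ?powR_ge0.
Qed.

Lemma grid_facts_ex g z e : (1 < g)%N -> 0 < z <= 1 -> 0 < e ->
  exists2 C : R, 0 < C & grid_facts g z e C.
Proof.
move=> g1 zz e0; have g0 := ltnW g1; have /andP[z0 z1] := zz.
have [C1 C10 H1] := exceptional_le zz e0.
have [C2 C20 H2] := torsion_nonexceptional g1 zz e0.
have [C3 C30 H3] := rep_pairs_sum g0 zz e0.
have [C4 C40 H4] : exists2 C : R, 0 < C & forall D, C <= D%:R -> 2 * g%:R * z < 1 ->
    {in block D, forall d, rep_pairs g d (primes_upto z D) = 0%N}.
  have [gz|gz] := ltP (2 * g%:R * z) 1; last by exists 1 => // D _; rewrite ltNge gz.
  by have [C C0 H] := rep_pairs_eq0 g0 z0 gz; exists C => // D CD _; apply: H.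
exists (C1 + C2 + C3 + C4 + 1); first lra.
move=> D CD; have D0 : (0 < D)%N by rewrite -(ltr0n R); apply: lt_le_trans CD; lra.
split.
- by apply: le_trans (H1 D _) _; [lra|rewrite ler_wpM2r ?powR_ge0 //; lra].
- move=> d dB ex; apply: le_trans (H2 D _ d dB ex) _; first lra.
  by rewrite ler_wpM2r ?addr_ge0 ?powR_ge0 // ler_wpM2r ?powR_ge0 //; lra.
- apply: le_trans (H3 D D0) _.
  by rewrite ler_wpM2r ?addr_ge0 ?powR_ge0 // ler_wpM2r ?powR_ge0 //; lra.
- by apply: H4; lra.
Qed.

Lemma grid_facts_uniform g e J (zf : nat -> R) : (1 < g)%N -> 0 < e ->
  (forall j, (0 < j <= J)%N -> 0 < zf j <= 1) ->
  exists2 C : R, 0 < C & forall j, (0 < j <= J)%N -> grid_facts g (zf j) e C.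
Proof.
move=> g1 e0; elim: J => [|J IH] Hz; first by exists 1 => // j /andP[]; case: j.
have [C C0 HC] : exists2 C : R, 0 < C & forall j, (0 < j <= J)%N -> grid_facts g (zf j) e C.
  by apply: IH => j /andP[j0 jJ]; apply: Hz; rewrite j0 leqW.
have [C' C'0 HC'] := grid_facts_ex g1 (Hz J.+1 (leqnn _)) e0.
exists (C + C'); first by rewrite addr_gt0.
move=> j /andP[j0]; rewrite leq_eqVlt => /orP[/eqP ->|jJ].
  by apply: grid_facts_mono HC'; rewrite lerDr ltW.
by apply: grid_facts_mono (HC j _); rewrite ?lerDl ?(ltW C'0) // j0 -ltnS.
Qed.

(** If [J] is bad, take the largest index [j] that is 0 or not bad: [h] is at most [B j], and [j.+1]
    is bad, so the corresponding term of the sum pays. *)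
Lemma grid_bound (h k : R) (B : nat -> R) (bad : nat -> bool) J : 0 <= h -> 0 <= k ->
  h <= B 0%N -> (forall j, (0 < j <= J)%N -> ~~ bad j -> h <= B j) ->
  h `^ k <= B J `^ k + \sum_(0 <= j < J) (bad j.+1)%:R * B j `^ k.
Proof.
move=> h0 k0 hB; have mono j : h <= B j -> h `^ k <= B j `^ k.
  by move=> hj; apply: ge0_ler_powR; rewrite ?nnegrE // (le_trans h0).
elim: J => [|J IH] H; first by rewrite big_geq // addr0; apply: mono.
rewrite big_nat_recr //=; case bJ : (bad J.+1).
  rewrite mul1r addrA [leRHS]addrC.
  apply: le_trans (IH _) _; first by move=> j /andP[j0 jJ]; apply: H; rewrite j0 leqW.
  have := powR_ge0 (B J.+1) k; lra.
rewrite mul0r addr0; apply: le_trans (mono _ (H J.+1 _ _)) _; rewrite ?bJ ?leqnn //.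
rewrite lerDl; apply: sumr_ge0 => j _; by rewrite mulr_ge0 ?ler0n ?powR_ge0.
Qed.

(** Equals 1 + k (1/2 - z) at the end z = 3 / (2 g + 2) of the grid. *)
Definition expo1 (g : nat) (k : R) : R := 1 + k * ((g%:R - 2) / (2 * g%:R + 2)).
Definition expo2 (g : nat) (k : R) : R :=
  1 + k * ((g%:R - 1) / (2 * g%:R)) - (g%:R - 1) / (2 * g%:R).
(** Summing the three candidates postpones the case distinction on k to [expo_regimes]. *)
Definition weight (g : nat) (k x : R) : R := x `^ (k / 2) + x `^ expo1 g k + x `^ expo2 g k.

Lemma weight_ge0 g k x : 0 <= weight g k x.
Proof. by rewrite /weight !addr_ge0 ?powR_ge0. Qed.

(** The left side is non-increasing in [z] because k >= 1, and at z = 1/(2 g) it equals [expo2]. *)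
Lemma expo2_bound g (k z : R) : (0 < g)%N -> 1 <= k -> 1 <= 2 * g%:R * z ->
  k * 2^-1 - k * z + z + 2^-1 <= expo2 g k.
Proof.
move=> g0 k1 gz; have G0 : 0 < g%:R :> R by rewrite ltr0n.
have e : expo2 g k = k / 2 + 2^-1 - (k - 1) / (2 * g%:R).
  by rewrite /expo2; field; rewrite gt_eqF.
have : (k - 1) / (2 * g%:R) <= (k - 1) * z.
  rewrite ler_pdivrMr ?mulr_gt0 // -mulrA -[leLHS]mulr1; apply: ler_wpM2l; first lra.
  by rewrite mulrC.
rewrite e; lra.
Qed.

(** The exponent k/2 - 1/2 + (g + 1 - k) z is linear in [z]: for k <= g + 1 it is largest at the
    right end, where it is [expo1]; otherwise it stays below k/2. *)
Lemma expo1_bound g (k z x : R) : (0 < g)%N -> 1 <= x -> 1 <= k -> 0 < z <= 3 / (2 * g%:R + 2) ->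
  x `^ (k * 2^-1 - k * z + z + g%:R * z - 2^-1) <= x `^ (k / 2) + x `^ expo1 g k.
Proof.
move=> g0 x1 k1 /andP[z0 zz]; have G0 : 0 < g%:R :> R by rewrite ltr0n.
have G2 : (2 * g%:R + 2 : R) != 0 by rewrite gt_eqF //; lra.
have e1 : k * 2^-1 - k * z + z + g%:R * z - 2^-1 = k / 2 - 2^-1 + (g%:R + 1 - k) * z by ring.
have [kg|kg] := leP k (g%:R + 1).
  apply: (@le_trans _ _ (x `^ expo1 g k)); last by rewrite lerDr powR_ge0.
  rewrite ler_powR // e1.
  have -> : expo1 g k = k / 2 - 2^-1 + (g%:R + 1 - k) * (3 / (2 * g%:R + 2)).
    by rewrite /expo1; field.
  by rewrite lerD2l ler_wpM2l // subr_ge0.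
apply: (@le_trans _ _ (x `^ (k / 2))); last by rewrite lerDl powR_ge0.
rewrite ler_powR // e1.
have : (g%:R + 1 - k) * z <= 0 by rewrite mulr_le0_ge0 ?(ltW z0) // subr_le0 ltW.
lra.
Qed.

Lemma size_block D : (size (block D) <= D)%N.
Proof.
rewrite size_filter (leq_trans (count_size _ _)) // size_iota.
by rewrite mul2n -addnn addnK.
Qed.

Lemma block_moment g (k del : R) : (1 < g)%N -> 1 <= k -> 0 < del ->
  exists2 C : R, 0 < C & forall D, C <= D%:R ->
    \sum_(d <- block D) (class_torsion g d)%:R `^ k <= C * (D%:R `^ del * weight g k D%:R).
Proof.
move=> g1 k1 del0; have g0 := ltnW g1; have k0 : 0 < k by lra.
have G0 : 0 < g%:R :> R by rewrite ltr0n.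
pose zeta : R := 3 / (2 * g%:R + 2).
have zeta0 : 0 < zeta by rewrite divr_gt0 //; lra.
have zeta1 : zeta <= 1.
  have : 1 <= g%:R :> R by rewrite ler1n.
  by rewrite /zeta ler_pdivrMr; lra.
(* Fine enough for one grid step to cost at most D^(del/2) in the k-th power. *)
pose J := (Num.truncn (2 * k * zeta / del)).+1.
have J0 : 0 < J%:R :> R by rewrite ltr0n.
have JR : k * (zeta / J%:R) <= del / 2.
  have : 2 * k * zeta / del < J%:R by apply: truncnS_gt.
  rewrite ltr_pdivrMr // => h; rewrite mulrA ler_pdivrMr //; lra.
(* The loss e occurs k times in the k-th power of h and once in a count of d; together these make
   del/2. *)
pose e := del / (2 * (k + 1)).
have e0 : 0 < e by rewrite divr_gt0 // mulr_gt0 //; lra.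
have ke : (k + 1) * e = del / 2 by rewrite /e; field; rewrite gt_eqF //; lra.
pose zf (j : nat) : R := j%:R * (zeta / J%:R).
have zfJ : zf J = zeta by rewrite /zf mulrC divfK // gt_eqF.
have zf_range j : (0 < j <= J)%N -> 0 < zf j <= zeta.
  move=> /andP[j0 jJ]; rewrite mulr_gt0 ?ltr0n ?divr_gt0 //= -zfJ /zf ler_pM2r ?divr_gt0 //.
  by rewrite ler_nat.
have [C1 C10 H1] : exists2 C : R, 0 < C & forall j, (0 < j <= J)%N -> grid_facts g (zf j) e C.
  apply: grid_facts_uniform => // j /zf_range/andP[-> h]; exact: le_trans h zeta1.
have [C2 C20 H2] := class_torsion_block g1 e0.
pose C := C1 + C2 + 1; have C0 : 0 < C by rewrite /C; lra.
have Ck : 0 < (2 * C) `^ k by rewrite powR_gt0 // mulr_gt0.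
exists (C + (2 * C) `^ k * (2 * J%:R * C + 1)).
  by rewrite addr_gt0 // mulr_gt0 // addr_gt0 // !mulr_gt0.
move=> D CD; have CD' : C <= D%:R.
  apply: le_trans CD; rewrite lerDl mulr_ge0 ?(ltW Ck) // addr_ge0 // !mulr_ge0 // ltW //.
have D1 : 1 <= D%:R :> R by apply: le_trans CD'; rewrite /C; lra.
have D0 : (0 < D)%N by rewrite -(ler1n R).
have DR0 : 0 < D%:R :> R by rewrite ltr0n.
have H1' j : (0 < j <= J)%N -> grid_facts g (zf j) e C.
  by move=> jJ; apply: grid_facts_mono (H1 j jJ); rewrite /C; lra.
(* The torsion bound when at most D^z pairs are represented at z = [zf j]; since [zf 0] is 0, [B 0]
   is the class number bound. *)
pose B (j : nat) : R := 2 * C * D%:R `^ (2^-1 - zf j + e).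
have B0 j : 0 <= B j by rewrite !mulr_ge0 ?powR_ge0 // ltW.
have BE j : B j `^ k = (2 * C) `^ k * D%:R `^ (k * 2^-1 - k * zf j + k * e).
  rewrite /B powRM ?powR_ge0 //; last by rewrite mulr_ge0 // ltW.
  by rewrite -powRrM; congr (_ * _ `^ _); ring.
pose N j d := rep_pairs g d (primes_upto (zf j) D).
pose bad d j := (D%:R `^ zf j < (N j d)%:R :> R).
(* A d exceptional at some grid point is charged [B 0]; every other one goes through
   [grid_bound]. *)
have pw d : d \in block D -> (class_torsion g d)%:R `^ k <=
   \sum_(0 <= j < J) (d \in exceptional (zf j.+1) D)%:R * B 0%N `^ k +
   (B J `^ k + \sum_(0 <= j < J) (bad d j.+1)%:R * B j `^ k).
  move=> dB; set h : R := _%:R.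
  have hB : h <= B 0%N.
    apply: le_trans (H2 D D0 d dB) _; rewrite /B /zf mul0r subr0.
    by rewrite ler_wpM2r ?powR_ge0 // /C; lra.
  case: (boolP [forall j : 'I_J, d \notin exceptional (zf j.+1) D]) => [/forallP ne|].
    apply: (@le_trans _ _ (B J `^ k + \sum_(0 <= j < J) (bad d j.+1)%:R * B j `^ k)); last first.
      by rewrite lerDr; apply: sumr_ge0 => j _; rewrite mulr_ge0 ?ler0n ?powR_ge0.
    apply: (@grid_bound h k B (bad d)) => //; first exact: ltW.
    move=> j jJ nb; have [_ h2 _ _] := H1' j jJ D CD'.
    have /andP[j0 jJ'] := jJ; have jm : (j.-1 < J)%N by rewrite prednK.
    have := ne (Ordinal jm); rewrite /= prednK // => nex.
    apply: le_trans (h2 d dB nex) _; rewrite -leNgt in nb.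
    apply: (@le_trans _ _ (C * D%:R `^ (2^-1 - 2 * zf j + e) * (2 * D%:R `^ zf j))).
      apply: ler_wpM2l; first by rewrite mulr_ge0 ?powR_ge0 // ltW.
      by move: nb; rewrite /N; lra.
    rewrite /B; have -> : 2^-1 - zf j + e = 2^-1 - 2 * zf j + e + zf j by ring.
    by rewrite [D%:R `^ (_ + zf j)]powR_add // le_eqVlt; apply/orP; left; apply/eqP; ring.
  rewrite negb_forall => /existsP[j]; rewrite negbK => dj.
  apply: (@le_trans _ _ (B 0%N `^ k)).
    by apply: ge0_ler_powR; rewrite ?nnegrE ?(ltW k0) ?ler0n.
  rewrite -[leLHS]addr0; apply: lerD.
    rewrite big_mkord (bigD1 j) // dj mul1r lerDl.
    by apply: sumr_ge0 => i _; rewrite mulr_ge0 ?ler0n ?powR_ge0.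
  apply: addr_ge0; first exact: powR_ge0.
  by apply: sumr_ge0 => i _; rewrite mulr_ge0 ?ler0n ?powR_ge0.
pose W := weight g k (D%:R : R); have W0 : 0 <= W by apply: weight_ge0.
have ed : k * e <= del by have := ke; rewrite mulrDl mul1r; lra.
have kee : k * e + e = del / 2 by rewrite -ke; ring.
have S1 : \sum_(d <- block D) \sum_(0 <= j < J) (d \in exceptional (zf j.+1) D)%:R * B 0%N `^ k
    <= J%:R * C * (2 * C) `^ k * (D%:R `^ del * W).
  rewrite exchange_big /=; apply: (@le_trans _ _ (\sum_(0 <= j < J) (C * (2 * C) `^ k * (D%:R `^ del * W)))).
    rewrite big_nat [leRHS]big_nat; apply: ler_sum => j /andP[_ jJ].
    have [h1 _ _ _] := H1' j.+1 jJ D CD'.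
    rewrite -mulr_suml.
    apply: (@le_trans _ _ (C * D%:R `^ e * B 0%N `^ k)).
      rewrite ler_wpM2r ?powR_ge0 //; apply: le_trans h1; rewrite -natr_sum ler_nat.
      have -> : (\sum_(d <- block D) (d \in exceptional (zf j.+1) D))%N =
          size [seq d <- block D | d \in exceptional (zf j.+1) D].
        by rewrite size_filter -sum1_count [RHS]big_mkcond; apply: eq_bigr => d _; case: ifP.
      apply: uniq_leq_size; first by rewrite filter_uniq ?block_uniq.
      by move=> d; rewrite mem_filter => /andP[].
    rewrite BE /zf mul0r mulr0 subr0.
    have -> : C * D%:R `^ e * ((2 * C) `^ k * D%:R `^ (k * 2^-1 + k * e)) =
      C * (2 * C) `^ k * (D%:R `^ e * D%:R `^ (k * 2^-1 + k * e)) by ring.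
    rewrite -powR_add // ler_pM2l ?mulr_gt0 //.
    apply: (@le_trans _ _ (D%:R `^ (del + k / 2))); first by rewrite ler_powR //; lra.
    rewrite powR_add // ler_wpM2l ?powR_ge0 // /W /weight -addrA lerDl addr_ge0 ?powR_ge0 //.
  by rewrite sumr_const_nat subn0 -[X in X <= _]mulr_natl !mulrA.
have S2 : \sum_(d <- block D) B J `^ k <= (2 * C) `^ k * (D%:R `^ del * W).
  rewrite big_const_seq count_predT iter_addr_0 -[X in X <= _]mulr_natl.
  apply: (@le_trans _ _ (D%:R * B J `^ k)).
    by rewrite ler_wpM2r ?powR_ge0 // ler_nat size_block.
  rewrite BE zfJ mulrCA ler_pM2l //.
  rewrite -{1}(powRr1 (ltW DR0)) -powR_add //.
  apply: (@le_trans _ _ (D%:R `^ (del + expo1 g k))).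
    rewrite ler_powR //; suff -> : expo1 g k = 1 + (k * 2^-1 - k * zeta) by lra.
    by rewrite /expo1 /zeta; field; rewrite gt_eqF //; lra.
  rewrite powR_add // ler_wpM2l ?powR_ge0 // /W /weight addrAC lerDr addr_ge0 ?powR_ge0 //.
have S3 : \sum_(d <- block D) \sum_(0 <= j < J) (bad d j.+1)%:R * B j `^ k
    <= J%:R * C * (2 * C) `^ k * (D%:R `^ del * W).
  rewrite exchange_big /=; apply: (@le_trans _ _ (\sum_(0 <= j < J) (C * (2 * C) `^ k * (D%:R `^ del * W)))).
    rewrite big_nat [leRHS]big_nat; apply: ler_sum => j /andP[_ jJ].
    have [_ _ h3 h4] := H1' j.+1 jJ D CD'; have zr := zf_range j.+1 jJ.
    rewrite -mulr_suml; set z := zf j.+1 in h3 h4 zr *.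
    have [gz|gz] := ltP (2 * g%:R * z) 1.
      rewrite big_seq big1; first by rewrite mul0r !mulr_ge0 ?powR_ge0 // ltW.
      move=> d dB; rewrite /bad /N -/z (h4 gz d dB) ltNge powR_ge0 //.
    (* Markov's inequality: a bad d has more than D^z represented pairs. *)
    have Nb : \sum_(d <- block D) (bad d j.+1)%:R <=
       D%:R `^ (- z) * (C * D%:R `^ (2 * z + e) * (D%:R `^ 2^-1 + D%:R `^ (g%:R * z - 2^-1))).
      apply: (@le_trans _ _ (D%:R `^ (- z) * (\sum_(d <- block D) N j.+1 d)%N%:R)); last first.
        by rewrite ler_wpM2l ?powR_ge0.
      rewrite natr_sum mulr_sumr; apply: ler_sum => d _.
      rewrite powRN mulrC; case: (boolP (bad d j.+1)) => [b|_]; last first.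
        by rewrite divr_ge0 ?ler0n ?powR_ge0.
      by rewrite ler_pdivlMr ?powR_gt0 // mul1r ltW.
    apply: le_trans (ler_wpM2r (powR_ge0 _ _) Nb) _; rewrite BE.
    (* A failure at [zf j.+1] is charged [B j], one grid step earlier; the difference goes into
       D^del. *)
    have zj : zf j = z - zeta / J%:R by rewrite /z /zf -natr1; ring.
    set u := D%:R `^ 2^-1; set v := D%:R `^ (g%:R * z - 2^-1).
    have -> : D%:R `^ (- z) * (C * D%:R `^ (2 * z + e) * (u + v)) *
       ((2 * C) `^ k * D%:R `^ (k * 2^-1 - k * zf j + k * e)) =
       C * (2 * C) `^ k * (D%:R `^ (- z) * D%:R `^ (2 * z + e) *
          D%:R `^ (k * 2^-1 - k * zf j + k * e) * (u + v)) by ring.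
    rewrite ler_pM2l ?mulr_gt0 // -!powR_add // zj.
    apply: (@le_trans _ _ (D%:R `^ (del + (k * 2^-1 - k * z + z)) * (u + v))).
      rewrite ler_wpM2r ?addr_ge0 ?powR_ge0 // ler_powR //; lra.
    rewrite [D%:R `^ (del + _)]powR_add // -mulrA ler_wpM2l ?powR_ge0 // mulrDr -!powR_add //.
    rewrite /W /weight addrC; apply: lerD.
      by rewrite addrA; apply: expo1_bound.
    by rewrite ler_powR //; apply: expo2_bound.
  by rewrite sumr_const_nat subn0 -[X in X <= _]mulr_natl !mulrA.
apply: (@le_trans _ _ (J%:R * C * (2 * C) `^ k * (D%:R `^ del * W) + ((2 * C) `^ k * (D%:R `^ del * W) +
   J%:R * C * (2 * C) `^ k * (D%:R `^ del * W)))).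
  rewrite big_seq; apply: le_trans (ler_sum _ pw) _; rewrite -big_seq !big_split /=.
  exact: lerD S1 (lerD S2 S3).
have X0 : 0 <= D%:R `^ del * W by rewrite mulr_ge0 ?powR_ge0.
have : 0 <= C * (D%:R `^ del * W) by rewrite mulr_ge0 // ltW.
set X := D%:R `^ del * W in X0 *; move: ((2 * C) `^ k) => c h.
have -> : (C + c * (2 * J%:R * C + 1)) * X = C * X + (J%:R * C * c * X + (c * X + J%:R * C * c * X)).
  by ring.
by rewrite lerDr.
Qed.

Lemma ler_sum_subset (s t : seq nat) (F : nat -> R) : uniq s -> {subset s <= t} ->
  (forall x, 0 <= F x) -> \sum_(x <- s) F x <= \sum_(x <- t) F x.
Proof.
move=> + + F0; elim: s t => [|x s IH] t; first by rewrite big_nil => _ _; apply: sumr_ge0.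
rewrite cons_uniq => /andP[xs us] st; have xt : x \in t by apply: st; rewrite mem_head.
rewrite (perm_big _ (perm_to_rem xt)) !big_cons lerD2l; apply: IH => // y ys.
have := st y; rewrite inE ys orbT => /(_ isT); rewrite (perm_mem (perm_to_rem xt)) inE.
by case/orP => // /eqP yx; rewrite -yx ys in xs.
Qed.

Lemma torsion_moment_blocks g (k X : R) : 2 <= X ->
  torsion_moment g k X <= \sum_(0 <= n < (trunc_log 2 (Num.truncn X)).+1)
    \sum_(d <- block (2 ^ n)) (class_torsion g d)%:R `^ k.
Proof.
move=> X2; rewrite /torsion_moment; set A : set nat := (X in \sum_(d \in X) _).
have X0 : 0 <= X by lra.
have Afin : finite_set A.
  apply: (@sub_finite_set _ _ [set` iota 0 (Num.truncn X).+1]); last exact: finite_seq.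
  move=> d [_ _ dX]; have : d \in iota 0 (Num.truncn X).+1.
    by rewrite mem_iota add0n ltnS truncn_ge_nat // ltW.
  by [].
rewrite fsbig_finite //; set N := _.+1.
pose t := flatten [seq block (2 ^ n) | n <- index_iota 0 N].
have -> : \sum_(0 <= n < N) \sum_(d <- block (2 ^ n)) (class_torsion g d)%:R `^ k =
    \sum_(d <- t) (class_torsion g d)%:R `^ k by rewrite /t big_flatten big_map.
apply: ler_sum_subset; [exact: finmap.fset_uniq| |by move=> d; apply: powR_ge0].
move=> d; rewrite in_fset_set // inE => -[d0 sq dX].
apply/flatten_mapP; exists (trunc_log 2 d).
  rewrite mem_index_iota /N /= ltnS; apply: leq_trunc_log.
  by rewrite truncn_ge_nat // ltW.
rewrite mem_filter mem_index_iota; have := trunc_log_bounds (isT : 1 < 2)%N d0.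
by rewrite /= expnS => ->; rewrite andbT; apply/asboolP.
Qed.

Lemma weight_mono g (k x y : R) : (2 <= g)%N -> 1 <= k -> 0 <= x -> x <= y ->
  weight g k x <= weight g k y.
Proof.
move=> g2 k1 x0 xy; have G2 : 2 <= g%:R :> R by rewrite ler_nat.
have y0 := le_trans x0 xy.
have G0 : 0 < g%:R :> R by lra.
have mono (a : R) : 0 <= a -> x `^ a <= y `^ a.
  by move=> a0; apply: ge0_ler_powR; rewrite ?nnegrE.
have e2 : 0 <= expo2 g k.
  rewrite /expo2 -addrA -[X in _ - X]mul1r -mulrBl addr_ge0 // mulr_ge0 ?divr_ge0 ?mulr_ge0 //; lra.
rewrite /weight !lerD // mono //; first by rewrite divr_ge0 //; lra.
by rewrite /expo1 addr_ge0 // mulr_ge0 ?divr_ge0 //; lra.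
Qed.

(** Half of eps is spent on each dyadic block and half on the number of blocks, which is logarithmic
    in X. *)
Lemma torsion_moment_bound g (k eps : R) : (2 <= g)%N -> 1 <= k -> 0 < eps ->
  exists2 C : R, 0 < C & forall X, 2 <= X ->
    torsion_moment g k X <= C * (X `^ eps * weight g k X).
Proof.
move=> g2 k1 eps0; have e20 : 0 < eps / 2 by rewrite divr_gt0.
have [C1 C10 H1] := block_moment g2 k1 e20.
pose T n : R := \sum_(d <- block (2 ^ n)) (class_torsion g d)%:R `^ k.
have T0 n : 0 <= T n by apply: sumr_ge0 => d _; apply: powR_ge0.
(* The finitely many blocks below the threshold of [block_moment] are absorbed into the constant. *)
pose n0 := (Num.truncn C1).+1; pose C2 := \sum_(0 <= n < n0) T n.
have C20 : 0 <= C2 by apply: sumr_ge0.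
have l2 : 0 < ln (2 : R) by rewrite ln_gt0 // ltr1n.
pose L := 1 + (eps / 2 * ln 2)^-1.
have L0 : 0 < L by rewrite ltr_pwDl // invr_ge0 mulr_ge0 ?ltW.
exists (L * (C1 + C2)); first by rewrite mulr_gt0 // ltr_pwDl.
move=> X X2; have X0 : 0 < X by lra.
have X1 : 1 <= X by lra.
have W1 : 1 <= weight g k X.
  rewrite /weight -addrA ler_wpDr ?addr_ge0 ?powR_ge0 // powR_le1 // divr_ge0 //; lra.
have Xe1 : 1 <= X `^ (eps / 2) by rewrite powR_le1 // ltW.
apply: le_trans (torsion_moment_blocks g k X2) _; set N := trunc_log 2 _.
have tX : (0 < Num.truncn X)%N by rewrite truncn_gt0.
have NX : (2 ^ N)%N%:R <= X.
  apply: (@le_trans _ _ (Num.truncn X)%:R); last by rewrite truncn_le ltW.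
  by rewrite ler_nat; apply: trunc_logP.
have Tn n : (n < N.+1)%N -> T n <= (C1 + C2) * (X `^ (eps / 2) * weight g k X).
  move=> nN; have [Cn|nC] := leP C1 (2 ^ n)%N%:R.
    have nX : (2 ^ n)%N%:R <= X by apply: le_trans NX; rewrite ler_nat leq_exp2l.
    apply: le_trans (H1 _ Cn) _; apply: ler_pM; rewrite ?(ltW C10) ?mulr_ge0 ?powR_ge0 ?weight_ge0 //.
      by rewrite lerDl.
    apply: ler_pM; rewrite ?powR_ge0 ?weight_ge0 //; last exact: weight_mono.
    by apply: ge0_ler_powR; rewrite ?nnegrE ?(ltW X0) ?ler0n // ltW.
  have nn0 : (n < n0)%N.
    rewrite /n0 ltnS truncn_ge_nat ?(ltW C10) //; apply/ltW/(lt_trans _ nC).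
    by rewrite ltr_nat ltn_expl.
  apply: (@le_trans _ _ C2).
    rewrite /C2 big_mkord (bigD1 (Ordinal nn0)) //= lerDl.
    by apply: sumr_ge0 => i _; apply: T0.
  rewrite -[leLHS]mulr1; apply: ler_pM => //; first by rewrite lerDr ltW.
  by rewrite -[leLHS]mulr1; apply: ler_pM.
have XW : 0 <= X `^ (eps / 2) * weight g k X by rewrite mulr_ge0 ?powR_ge0 ?weight_ge0.
apply: (@le_trans _ _ (\sum_(0 <= n < N.+1) (C1 + C2) * (X `^ (eps / 2) * weight g k X))).
  by rewrite big_nat [leRHS]big_nat; apply: ler_sum => n /andP[_ nN]; apply: Tn.
rewrite sumr_const_nat subn0 -[X in X <= _]mulr_natl.
have NL : N.+1%:R <= L * X `^ (eps / 2).
  have : ln ((2 : R) ^+ N) <= ln X by rewrite ler_ln ?posrE ?exprn_gt0 // -natrX.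
  rewrite lnXn // -[X in X <= _]mulr_natl => h.
  have h' := le_trans h (ln_le_powR e20 X0).
  have : N%:R <= (eps / 2 * ln 2)^-1 * X `^ (eps / 2).
    by rewrite invfM mulrAC ler_pdivlMr.
  by rewrite /L mulrDl mul1r -natr1; lra.
have -> : X `^ eps = X `^ (eps / 2) * X `^ (eps / 2) by rewrite -powR_add //; congr powR; field.
have -> : L * (C1 + C2) * (X `^ (eps / 2) * X `^ (eps / 2) * weight g k X) =
   (L * X `^ (eps / 2)) * ((C1 + C2) * (X `^ (eps / 2) * weight g k X)) by ring.
by rewrite ler_wpM2r // mulr_ge0 // addr_ge0 // ltW.
Qed.

(** The differences are affine in k: [expo1] meets k/2 at (2 g + 2)/3, [expo2] meets k/2 at g + 1,
    and the two meet each other at (g^2 - 1)/(2 g - 1). *)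
Lemma expo_regimes g (k : R) : (2 <= g)%N ->
  [/\ k <= (g%:R ^+ 2 - 1) / (2 * g%:R - 1) ->
        k / 2 <= expo1 g k /\ expo2 g k <= expo1 g k,
      (g%:R ^+ 2 - 1) / (2 * g%:R - 1) <= k <= g%:R + 1 ->
        k / 2 <= expo2 g k /\ expo1 g k <= expo2 g k &
      g%:R + 1 <= k -> expo1 g k <= k / 2 /\ expo2 g k <= k / 2].
Proof.
move=> g2; have G2 : 2 <= g%:R :> R by rewrite ler_nat.
have G0 : g%:R != 0 :> R by rewrite gt_eqF //; lra.
have G1 : g%:R + 1 != 0 :> R by rewrite gt_eqF //; lra.
have G22 : 2 * g%:R + 2 != 0 :> R by rewrite gt_eqF //; lra.
have d1 : expo1 g k - k / 2 = (2 * g%:R + 2 - 3 * k) / (2 * g%:R + 2) by rewrite /expo1; field.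
have d2 : expo2 g k - k / 2 = (g%:R + 1 - k) / (2 * g%:R) by rewrite /expo2; field.
have d12 : expo1 g k - expo2 g k =
    (g%:R ^+ 2 - 1 - k * (2 * g%:R - 1)) / (2 * g%:R * (g%:R + 1)).
  by rewrite /expo1 /expo2; field; rewrite G0 G1 G22.
have p1 : 0 < 2 * g%:R - 1 :> R by lra.
have p2 : 0 <= (2 * g%:R + 2)^-1 :> R by rewrite invr_ge0; lra.
have p3 : 0 <= (2 * g%:R)^-1 :> R by rewrite invr_ge0; lra.
have p4 : 0 <= (2 * g%:R * (g%:R + 1))^-1 :> R by rewrite invr_ge0 mulr_ge0 //; lra.
split.
- rewrite ler_pdivlMr // => kg.
  have h12 : 0 <= expo1 g k - expo2 g k by rewrite d12 mulr_ge0 // subr_ge0.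
  have h1 : 0 <= expo1 g k - k / 2.
    rewrite d1 mulr_ge0 // -(pmulr_lge0 _ p1).
    (* Certifies that (g^2 - 1)/(2 g - 1) lies below (2 g + 2)/3, so k/2 has not yet overtaken
       [expo1]. *)
    have -> : (2 * g%:R + 2 - 3 * k) * (2 * g%:R - 1) =
       3 * (g%:R ^+ 2 - 1 - k * (2 * g%:R - 1)) + (g%:R + 1) ^+ 2 by ring.
    by rewrite addr_ge0 ?sqr_ge0 // mulr_ge0 // subr_ge0.
  by rewrite -subr_ge0 h1 -subr_ge0 h12.
- rewrite ler_pdivrMr // => /andP[kg gk].
  have h2 : 0 <= expo2 g k - k / 2 by rewrite d2 mulr_ge0 // subr_ge0.
  have h12 : expo1 g k - expo2 g k <= 0 by rewrite d12 mulr_le0_ge0 // subr_le0.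
  by rewrite -subr_ge0 h2 -subr_le0 h12.
- move=> gk.
  have h1 : expo1 g k - k / 2 <= 0 by rewrite d1 mulr_le0_ge0 //; lra.
  have h2 : expo2 g k - k / 2 <= 0 by rewrite d2 mulr_le0_ge0 //; lra.
  by rewrite -subr_le0 h1 -subr_le0 h2.
Qed.

Lemma weight_le g (k x a : R) : 1 <= x -> k / 2 <= a -> expo1 g k <= a -> expo2 g k <= a ->
  weight g k x <= 3 * x `^ a.
Proof.
move=> x1 h1 h2 h3; rewrite /weight.
have := ler_powR x1 h1; have := ler_powR x1 h2; have := ler_powR x1 h3; lra.
Qed.
End Moments.

Theorem theorem3 (R : realType) (g : nat) (k eps : R) :
  prime g -> (5 <= g)%N -> 1 <= k -> 0 < eps ->
  exists2 C : R, 0 < C &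
    forall X : R, 2 <= X ->
      [/\ 1 <= k <= (g%:R ^+ 2 - 1) / (2 * g%:R - 1) ->
            torsion_moment g k X <=
              C * X `^ (1 + k * ((g%:R - 2) / (2 * g%:R + 2)) + eps),
          (g%:R ^+ 2 - 1) / (2 * g%:R - 1) <= k <= g%:R + 1 ->
            torsion_moment g k X <=
              C * X `^ (1 + k * ((g%:R - 1) / (2 * g%:R))
                          - (g%:R - 1) / (2 * g%:R) + eps)
        & g%:R + 1 <= k ->
            torsion_moment g k X <= C * X `^ (k / 2 + eps)].
Proof.
move=> _ g5 k1 eps0; have g2 : (2 <= g)%N by apply: leq_trans g5.
have [C C0 H] := torsion_moment_bound g2 k1 eps0.
exists (3 * C); first by rewrite mulr_gt0.
move=> X X2; have X0 : 0 < X by lra.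
have X1 : 1 <= X by lra.
have [r1 r2 r3] := expo_regimes k g2.
have fin a : k / 2 <= a -> expo1 g k <= a -> expo2 g k <= a ->
    torsion_moment g k X <= 3 * C * X `^ (a + eps).
  move=> h1 h2 h3; apply: le_trans (H X X2) _.
  have := weight_le X1 h1 h2 h3 => W; rewrite powR_add //.
  apply: (@le_trans _ _ (C * (X `^ eps * (3 * X `^ a)))).
    by rewrite ler_pM2l // ler_wpM2l ?powR_ge0.
  by rewrite le_eqVlt; apply/orP; left; apply/eqP; ring.
split=> [/andP[_ h]|h|h].
- by have [h1 h2] := r1 h; apply: fin.
- by have [h1 h2] := r2 h; apply: fin.
- by have [h1 h2] := r3 h; apply: fin.
Qed.
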